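(* Let $G$ be a totally disconnected, locally compact group with property (LD) such that $\mathrm{QZ}(G)=\{1\}$. Then $G$ is first-countable and has an open subgroup of the form $$M = M_1 \times M_2 \times \dots \times M_n,$$ where for $1 \le i \le n$ the groups $M_i$ have the following properties: (i) $M_i$ is closed and characteristic in every closed locally normal subgroup of $G$ containing $M_i$. (ii) $M_i$ is locally isomorphic to a just infinite profinite group $J_i$, so in particular $M_i$ is locally monomial; additionally $M_i$ contains every closed locally normal subgroup of $G$ that is locally similar to $J_i$. (iii) In the case that $G$ contains a compact just infinite representative $J_i$ of $[M_i]$, then $J_i \le M_i$ and every nontrivial closed normal subgroup of $M_i$ is open in $M_i$. (iv) If $G = \mathscr{L}(G)$, then $G = M$, $\mathscr{L}(M_i) = M_i$ for $1 \le i \le n$, and $M_i$ has a just infinite compact open subgroup for all $1 \le i \le n$.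
   Context: All groups are locally compact Hausdorff topological groups; ''t.d.l.c.'' means totally disconnected locally compact. Direct products carry the product topology; direct factors are closed subgroups. The case $n=0$ (trivial $M$) is allowed. Characteristic means invariant under all topological group automorphisms. A subgroup of $G$ is locally normal if its normalizer is open in $G$. Two subgroups $H,K$ of $G$ are locally equivalent if $H\cap K$ is open in both; $[H]$ denotes the local equivalence class of $H$, and its members are called representatives. The quasi-centre $\mathrm{QZ}(G)$ is the set of elements with open centralizer. Property (LD): for every closed locally normal subgroup $K$ of $G$ there is an open subgroup $L$ of $K$ that is a direct factor of an open subgroup of $G$. A profinite group is just infinite if it is infinite and every nontrivial closed normal subgroup has finite index. Two t.d.l.c. groups $H,K$ are locally isomorphic if there is a continuous injective open homomorphism from an open subgroup of $H$ to $K$. T.d.l.c. groups $G_1,G_2$ are commensurable if there is an isomorphism from a finite index open subgroup of $G_1$ to a finite index open subgroup of $G_2$; similar if there are positive integers $a_1,a_2$ such that $G_1^{a_1}$ is commensurable with $G_2^{a_2}$; locally similar if they have compact open subgroups $U_1,U_2$ respectively with $U_1$ similar to $U_2$. A t.d.l.c. group $G$ is locally monomial if it is nondiscrete and locally similar to every nondiscrete closed locally normal subgroup of $G^a$ for all natural numbers $a$. Group of germs: for a t.d.l.c. group $G$ with $\mathrm{QZ}(G)=\{1\}$, $\mathscr{L}(G)$ is the group of equivalence classes of topological isomorphisms between open subgroups of $G$, where two such are equivalent if they agree on some open subgroup of $G$, with multiplication induced by composition. Conjugation gives an injective homomorphism $G\to\mathscr{L}(G)$, and $\mathscr{L}(G)$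 is given the t.d.l.c. group topology making this an open embedding. ''$G=\mathscr{L}(G)$'' means that this embedding is surjective (and likewise for $M_i$).
   Formalization: In (iii) the compact just infinite representative J_i of [M_i] is also required to be locally normal in G; without this J_i ≤ M_i can fail, e.g. a twisted copy of PGL_2(Z_p) in PGL_2(Q_p) × PGL_2(Q_q), and J_i ≤ M_i itself forces local normality. *)

(* Defs.v *)
From HB Require Import structures.
From mathcomp Require Import all_boot all_classical topology.

Set Implicit Arguments.
Unset Strict Implicit.
Unset Printing Implicit Defensive.

Local Open Scope classical_set_scope.
Local Open Scope group_scope.

HB.mixin Record Group_Topological_isTopGroup T of Group T & Topological T := {
  mulg_continuous : continuous (fun x : T * T => x.1 * x.2);
  invg_continuous : continuous (fun x : T => x^-1)
}.

#[short(type="topGroupType")]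
HB.structure Definition TopGroup :=
  {T of Group T & Topological T & Group_Topological_isTopGroup T}.

Lemma continuous_mulg (T : topologicalType) (G : topGroupType) (f g : T -> G) :
  continuous f -> continuous g -> continuous (fun x => f x * g x).
Proof.
move=> cf cg x.
exact: (cvg_comp2 (h := @mul G) (cf x) (cg x) (@mulg_continuous G (f x, g x))).
Qed.

Lemma continuous_invg (T : topologicalType) (G : topGroupType) (f : T -> G) :
  continuous f -> continuous (fun x => (f x)^-1).
Proof. by move=> cf x; exact: (@cvg_comp _ _ _ f (@monoid.inv G) _ _ _ (cf x) (@invg_continuous G (f x))). Qed.

Lemma continuous_prod_topology (T : topologicalType) (I : Type)
    (K : I -> topologicalType) (f : T -> prod_topology K) :
  (forall i, continuous (fun x => f x i)) -> continuous f.
Proof.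
move=> cf x; apply/cvg_sup => i A [_ [[B Bop <-] Bfx sBA]].
by apply: filterS sBA _; apply: (cf i x); exact: open_nbhs_nbhs.
Qed.

Section PairTopGroup.
Variables G H : topGroupType.

Fact pair_mulg_continuous :
  continuous (fun x : (G * H) * (G * H) => x.1 * x.2).
Proof.
have c1 : continuous (fun x : (G * H) * (G * H) => x.1.1 * x.2.1).
  apply: continuous_mulg => y.
  - exact: (@cvg_comp _ _ _ fst fst _ _ _ cvg_fst cvg_fst).
  - exact: (@cvg_comp _ _ _ snd fst _ _ _ cvg_snd cvg_fst).
have c2 : continuous (fun x : (G * H) * (G * H) => x.1.2 * x.2.2).
  apply: continuous_mulg => y.
  - exact: (@cvg_comp _ _ _ fst snd _ _ _ cvg_fst cvg_snd).
  - exact: (@cvg_comp _ _ _ snd snd _ _ _ cvg_snd cvg_snd).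
by move=> x; exact: cvg_pair (c1 x) (c2 x).
Qed.

Fact pair_invg_continuous : continuous (fun x : G * H => x^-1).
Proof.
have c1 : continuous (fun x : G * H => x.1^-1).
  by apply: continuous_invg => y; exact: cvg_fst.
have c2 : continuous (fun x : G * H => x.2^-1).
  by apply: continuous_invg => y; exact: cvg_snd.
by move=> x; exact: cvg_pair (c1 x) (c2 x).
Qed.

HB.instance Definition _ := Group_Topological_isTopGroup.Build (G * H)%type
  pair_mulg_continuous pair_invg_continuous.

End PairTopGroup.

Section ProdTopGroup.
Variables (I : eqType) (T : I -> topGroupType).

Definition prod_one : prod_topology T := fun=> 1.
Definition prod_inv (f : prod_topology T) : prod_topology T :=
  fun i => (f i)^-1.
Definition prod_mul (f g : prod_topology T) : prod_topology T :=
  fun i => f i * g i.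

Fact prod_mulgA : associative prod_mul.
Proof. by move=> f g h; apply: functional_extensionality_dep => i; exact: mulgA. Qed.
Fact prod_mul1g : left_id prod_one prod_mul.
Proof. by move=> f; apply: functional_extensionality_dep => i; exact: mul1g. Qed.
Fact prod_mulg1 : right_id prod_one prod_mul.
Proof. by move=> f; apply: functional_extensionality_dep => i; exact: mulg1. Qed.
Fact prod_mulVg : left_inverse prod_one prod_inv prod_mul.
Proof. by move=> f; apply: functional_extensionality_dep => i; exact: mulVg. Qed.
Fact prod_mulgV : right_inverse prod_one prod_inv prod_mul.
Proof. by move=> f; apply: functional_extensionality_dep => i; exact: mulgV. Qed.

HB.instance Definition _ := isGroup.Build (prod_topology T)
  prod_mulgA prod_mul1g prod_mulg1 prod_mulVg prod_mulgV.

Fact prod_mulg_continuous :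
  continuous (fun x : prod_topology T * prod_topology T => x.1 * x.2).
Proof.
apply: continuous_prod_topology => i; apply: continuous_mulg => y.
- exact: (@cvg_comp _ _ _ fst (@proj I T i) _ _ _ cvg_fst (@proj_continuous I T i y.1)).
- exact: (@cvg_comp _ _ _ snd (@proj I T i) _ _ _ cvg_snd (@proj_continuous I T i y.2)).
Qed.

Fact prod_invg_continuous : continuous (fun x : prod_topology T => x^-1).
Proof.
apply: continuous_prod_topology => i; apply: continuous_invg => y.
exact: (@proj_continuous I T i y).
Qed.

HB.instance Definition _ := Group_Topological_isTopGroup.Build (prod_topology T)
  prod_mulg_continuous prod_invg_continuous.

End ProdTopGroup.

(* Groups are handled as subgroups [A : set G] of an ambient topological group
   with the subspace topology; an abstract group [G] is [[set: G]]. *)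

Section Subgroups.
Variable G : topGroupType.
Implicit Types (A H K N : set G).

Definition open_in A (U : set G) := U `<=` A /\ open (U : set (subspace A)).

Definition closed_in A (U : set G) := U `<=` A /\ closed (U : set (subspace A)).

Definition subgroup A H :=
  [/\ H `<=` A, H 1, forall x y, H x -> H y -> H (x * y)
    & forall x, H x -> H x^-1].

Definition open_subgroup A H := subgroup A H /\ open_in A H.

Definition closed_subgroup A H := subgroup A H /\ closed_in A H.

Definition compact_open_subgroup A H := open_subgroup A H /\ compact H.

Definition normaliser H := [set g : G | [set g * x * g^-1 | x in H] = H].

Definition normal_subgroup A N := subgroup A N /\ A `<=` normaliser N.

Definition closed_locally_normal A H :=
  closed_subgroup A H /\ open_in A (A `&` normaliser H).

Definition locally_equivalent H K :=
  open_in H (H `&` K) /\ open_in K (H `&` K).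

Definition quasi_centre A :=
  [set x | A x /\ open_in A (A `&` [set g | commute g x])].

Definition finite_index A H :=
  finite_set [set [set g * x | x in H] | g in A].

Definition discrete_subgroup A := forall x, A x -> open_in A [set x].

Definition just_infinite A :=
  infinite_set A /\
  forall N, normal_subgroup A N -> closed_in A N -> N <> [set 1] ->
    finite_index A N.

End Subgroups.

Definition hom_on (G H : topGroupType) (A : set G) (B : set H) (f : G -> H) :=
  [/\ set_fun A B f, forall x y, A x -> A y -> f (x * y) = f x * f y
    & {within A, continuous f}].

(* The values of [f] outside [A] are irrelevant. *)
Definition top_iso (G H : topGroupType) (A : set G) (B : set H) (f : G -> H) :=
  hom_on A B f /\
  exists g : H -> G, [/\ hom_on B A g, forall x, A x -> g (f x) = x
                       & forall y, B y -> f (g y) = y].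

Definition characteristic (G : topGroupType) (A N : set G) :=
  subgroup A N /\ forall f : G -> G, top_iso A A f -> f @` N = N.

Definition locally_isomorphic (G H : topGroupType) (A : set G) (B : set H) :=
  exists (O : set G) (f : G -> H),
    [/\ open_subgroup A O, hom_on O B f, set_inj O f
      & forall U, open_in O U -> open_in B (f @` U)].

Definition direct_factor (G : topGroupType) (A L : set G) :=
  exists C : set G, [/\ closed_subgroup A L, closed_subgroup A C
    & top_iso (L `*` C) A (fun x => x.1 * x.2)].

Definition box (G : topGroupType) (n : nat) (M : 'I_n -> set G) :
    set {ptws 'I_n -> G} :=
  [set f | forall i, M i (f i)].

Definition power (G : topGroupType) (A : set G) (a : nat) :
    set {ptws 'I_a -> G} :=
  box (fun=> A).
Arguments power {G} A a.

Definition internal_product (G : topGroupType) (n : nat) (M : 'I_n -> set G)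
    (P : set G) :=
  (forall i, subgroup P (M i)) /\
  top_iso (box M) P (fun f => \prod_(i < n) f i).

Definition commensurable (G H : topGroupType) (A : set G) (B : set H) :=
  exists (A' : set G) (B' : set H) (f : G -> H),
    [/\ open_subgroup A A' /\ finite_index A A',
        open_subgroup B B' /\ finite_index B B' & top_iso A' B' f].

Definition similar (G H : topGroupType) (A : set G) (B : set H) :=
  exists a b : nat,
    [/\ (0 < a)%N, (0 < b)%N & commensurable (power A a) (power B b)].

Definition locally_similar (G H : topGroupType) (A : set G) (B : set H) :=
  exists (U : set G) (V : set H),
    [/\ compact_open_subgroup A U, compact_open_subgroup B V & similar U V].

Definition locally_monomial (G : topGroupType) (A : set G) :=
  ~ discrete_subgroup A /\
  forall (a : nat) (K : set {ptws 'I_a -> G}),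
    closed_locally_normal (power A a) K -> ~ discrete_subgroup K ->
    locally_similar A K.

Section Germs.
Variable G : topGroupType.
Implicit Types (A : set G).

Record partial_map := PartialMap {
  pm_dom : set G;
  pm_cod : set G;
  pm_fun : G -> G
}.

Definition local_automorphisms A : set partial_map :=
  [set p | [/\ open_subgroup A (pm_dom p), open_subgroup A (pm_cod p)
             & top_iso (pm_dom p) (pm_cod p) (pm_fun p)]].

Definition same_germ A (p q : partial_map) :=
  exists O, [/\ open_subgroup A O, O `<=` pm_dom p, O `<=` pm_dom q
              & forall x, O x -> pm_fun p x = pm_fun q x].

Definition germ A (p : partial_map) : set partial_map :=
  [set q | local_automorphisms A q /\ same_germ A p q].

(* The underlying set of the group of germs of [A]. *)
Definition germ_group A : set (set partial_map) :=
  [set germ A p | p in local_automorphisms A].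

Definition conj_germ A (g : G) : set partial_map :=
  germ A (PartialMap A A (fun x => g * x * g^-1)).

(* The group of germs is only formed when the quasi-centre is trivial, i.e. when
   [conj_germ] is injective. That [A] equals it is surjectivity of [conj_germ],
   which involves neither the product nor the topology on germs. *)
Definition equals_germ_group A :=
  quasi_centre A = [set 1] /\ [set conj_germ A g | g in A] = germ_group A.

End Germs.

Definition tdlc (G : topGroupType) :=
  [/\ hausdorff_space G, locally_compact [set: G]
    & totally_disconnected [set: G]].

Definition profinite (G : topGroupType) :=
  [/\ hausdorff_space G, compact [set: G] & totally_disconnected [set: G]].

Definition first_countable (T : topologicalType) :=
  forall x : T, exists B : set (set T),
    [/\ countable B, B `<=` nbhs x & filter_from B id --> x].

Definition property_LD (G : topGroupType) :=
  forall K : set G, closed_locally_normal [set: G] K ->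
  exists L O : set G,
    [/\ open_subgroup K L, open_subgroup [set: G] O & direct_factor O L].

(* Main.v *)
(** The quasi-centralizer [perp K] of a closed locally normal subgroup [K] depends only on
the local class of [K]. By (LD) and triviality of the quasi-centre, [perp] is a complement
on local classes, and these form a Boolean algebra with canonical representatives
[R = perp (perp R)]. A pigeonhole argument in a compact open subgroup [U], applied to (LD),
shows that the [U]-invariant elements form a finite algebra.

Call [R] and [S] linked if they contain isomorphic nontrivial compact locally normal
subgroups. The [M_i] are the atoms of the algebra of the [R] not linked to their
complement. They are invariant under all local isomorphisms, whence (i). Inside [M_i], the
atoms of the algebra of [V]-invariant elements, for [V] open and normal in [U], are
permuted transitively by [U] below each [U]-invariant atom, so that every invariant part of
[M_i] is locally a power of one such atom [E]. This gives local monomiality.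

The stabilizer of [E] in [U] acts on [E] irreducibly, so its image [W] in the automorphisms
of an open subgroup [Y] of [E] yields a just infinite profinite group, the wreath product
of [W] by [Sym I], in which [Y^I] is open; for suitable [I], [M_i] is locally isomorphic
to [Y^I]. For first-countability, the open normal subgroups of [U] in a sequence strictly
decreasing on a [U]-invariant atom meet that atom trivially in the limit, again by
pigeonhole. For (iv), a local automorphism of [M_i] is extended by the identity on its
complement. *)

From HB Require Import structures.
Require Import Defs.
From mathcomp Require Import all_boot perm all_classical topology.

Set Implicit Arguments.
Unset Strict Implicit.
Unset Printing Implicit Defensive.

Local Open Scope classical_set_scope.
Local Open Scope group_scope.

(** * Subgroups of abstract and topological groups *)

(** The proof works with germs at 1: [nbhs 1 [set x | K x -> L x]] says that [K] lies locally in
    [L]. Two facts bring germs back to elements. A locally normal subgroup that is discrete is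
    trivial, because its elements have open centralizers; so a commutator lying in both [K] and
    [perp K] vanishes, and suitable elements commute outright. And applying [perp] twice spreads a
    local inclusion over a whole group.

    One obstacle is that two [U]-invariant atoms below [M_i] are only linked, not isomorphic. A link
    compares small parts of them, so [V] has to be chosen after the links and must normalise those
    parts. A tile of one atom can then be carried to the others.

    Another obstacle is that [M_i] may not contain enough symmetries to make an open subgroup just
    infinite. The wreath product supplies them: the permutations of the tiles, and on each tile
    separately the action of the full stabilizer of [E]. Elements of the stabilizer that act alike
    on [Y] must be identified there, since otherwise the kernel of the action would be a further
    normal subgroup. *)

Definition group_normE := (@mulgA, @invgM, @invgK, @mulgK, @mulgVK, @mulgV, @mulVg,
  @mul1g, @mulg1, @invg1).

Section AbstractGroup.
Variable G : groupType.
Implicit Types (H K : set G) (x y g : G).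

Definition sgp H :=
  [/\ H 1, forall x y, H x -> H y -> H (x * y) & forall x, H x -> H x^-1].

Lemma sgp1 H : sgp H -> H 1. Proof. by case. Qed.
Lemma sgpM H x y : sgp H -> H x -> H y -> H (x * y).
Proof. by case=> _ + _; apply. Qed.
Lemma sgpV H x : sgp H -> H x -> H x^-1. Proof. by case=> _ _; apply. Qed.
Lemma sgpVE H x : sgp H -> H x^-1 -> H x.
Proof. by move=> sH /(sgpV sH); rewrite invgK. Qed.
Lemma sgpMl H x y : sgp H -> H x -> H (x * y) -> H y.
Proof. by move=> sH /(sgpV sH) Hx /(sgpM sH Hx); rewrite !group_normE. Qed.
Lemma sgpMr H x y : sgp H -> H y -> H (x * y) -> H x.
Proof. by move=> sH /(sgpV sH) Hx Hy; have := sgpM sH Hy Hx; rewrite !group_normE. Qed.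

Lemma sgpI H K : sgp H -> sgp K -> sgp (H `&` K).
Proof.
move=> sH sK; split; first by split; apply: sgp1.
- by move=> x y [? ?] [? ?]; split; apply: sgpM.
- by move=> x [? ?]; split; apply: sgpV.
Qed.

Lemma sgp_bigcap (I : Type) (D : set I) (H : I -> set G) :
  (forall i, D i -> sgp (H i)) -> sgp (\bigcap_(i in D) H i).
Proof.
move=> sH; split; first by move=> i /sH; apply: sgp1.
- by move=> x y hx hy i Di; apply: sgpM; [exact: sH|exact: hx|exact: hy].
- by move=> x hx i Di; apply: sgpV; [exact: sH|exact: hx].
Qed.

Lemma sgpT : sgp [set: G]. Proof. by []. Qed.

Lemma sgp_1 : sgp [set (1 : G)].
Proof. by split=> // [x y -> ->|x ->]; rewrite ?mulg1 ?invg1. Qed.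

(** Only one inclusion is asked for, so [nz K] is closed under products but perhaps not under
    inverses. If [nz K] is a neighbourhood of 1, so is the set of [g] with [g] and [g^-1] both in
    it. *)
Definition nz K := [set g | forall x, K x -> K (g * x * g^-1)].

Lemma nzM K g h : nz K g -> nz K h -> nz K (g * h).
Proof. by move=> ng nh x /nh/ng; rewrite !group_normE. Qed.
Lemma nz1 K : nz K 1. Proof. by move=> x; rewrite !group_normE. Qed.
Lemma nz_sgp K : sgp K -> K `<=` nz K.
Proof. by move=> sK x Kx y Ky; apply: sgpM (sgpM _ _ _) (sgpV _ _). Qed.
Lemma nzI K H : nz K `&` nz H `<=` nz (K `&` H).
Proof. by move=> g [nK nH] x [Kx Hx]; split; [apply: nK|apply: nH]. Qed.
Lemma nz_bigcap (I : Type) (D : set I) (H : I -> set G) g :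
  (forall i, D i -> nz (H i) g) -> nz (\bigcap_(i in D) H i) g.
Proof. by move=> h x hx i Di; apply: h => //; apply: hx. Qed.

(** This is [g K g^-1], written as a preimage so that membership and closedness are immediate. *)
Definition cj g K := [set x | K (g^-1 * x * g)].
Lemma cjK g K : cj g^-1 (cj g K) = K.
Proof. by apply/seteqP; split=> x; rewrite /cj/= !group_normE. Qed.
Lemma cjVK g K : cj g (cj g^-1 K) = K.
Proof. by rewrite -{1}[g]invgK cjK. Qed.
Lemma cjM g h K : cj (g * h) K = cj g (cj h K).
Proof. by apply/seteqP; split=> x; rewrite /cj/= !group_normE. Qed.
Lemma cj1 K : cj 1 K = K.
Proof. by apply/seteqP; split=> x; rewrite /cj/= !group_normE. Qed.
Lemma cj_sgp g K : sgp K -> sgp (cj g K).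
Proof.
move=> sK; split=> [|x y Kx Ky|x Kx]; rewrite /cj/= ?group_normE ?mulVg; first exact: sgp1.
- by have := sgpM sK Kx Ky; rewrite !group_normE.
- by have := sgpV sK Kx; rewrite !group_normE.
Qed.
Lemma nz_cj g K : nz K g -> nz K g^-1 -> cj g K = K.
Proof.
move=> n1 n2; apply/seteqP; split=> x Kx; last first.
  by rewrite /cj/=; have := n2 _ Kx; rewrite invgK.
by have := n1 _ Kx; rewrite !group_normE.
Qed.
Lemma cj_nz g K : cj g K = K -> nz K g.
Proof. by move=> e x Kx; rewrite -e /cj/= !group_normE. Qed.
Lemma cjS g K H : K `<=` H -> cj g K `<=` cj g H.
Proof. by move=> s x; apply: s. Qed.
Lemma cj_set1 g : cj g [set 1] = [set 1].
Proof.
apply/seteqP; split=> x /=; rewrite /cj/=; last by move=> ->; rewrite !group_normE.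
by move=> e; apply: (@mulIg _ g); apply: (@mulgI _ g^-1); rewrite mulgA e !group_normE.
Qed.
Lemma cj_nzE g h K : nz K (g^-1 * h * g) -> nz (cj g K) h.
Proof. by move=> n x Kx; rewrite /cj/=; have := n _ Kx; rewrite !group_normE. Qed.

Lemma sgp_nt K : sgp K -> K <> [set 1] -> exists2 x, K x & x <> 1.
Proof.
move=> sK K1; apply: contrapT => h; apply: K1; apply/seteqP; split=> x /=.
  by move=> Kx; apply: contrapT => x1; apply: h; exists x.
by move=> ->; apply: sgp1.
Qed.
Lemma sgp_triv K : sgp K -> (forall x, K x -> x = 1) -> K = [set 1].
Proof. by move=> sK h; apply/seteqP; split=> x /= => [/h|->] //; apply: sgp1. Qed.

End AbstractGroup.

Section Hom.
Variables G H : groupType.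
Variables (A : set G) (f : G -> H).
Hypotheses (sA : sgp A) (fM : forall x y, A x -> A y -> f (x * y) = f x * f y).

Lemma hom1 : f 1 = 1.
Proof. by apply: (@mulgI _ (f 1)); rewrite -fM ?mulg1//; exact: sgp1. Qed.

Lemma homV x : A x -> f x^-1 = (f x)^-1.
Proof.
move=> Ax; apply: (@mulgI _ (f x)); rewrite -fM ?mulgV//; last exact: sgpV.
exact: hom1.
Qed.

Lemma hom_inj x y : (forall x, A x -> f x = 1 -> x = 1) -> A x -> A y -> f x = f y -> x = y.
Proof.
move=> fI Ax Ay e; apply: (@mulIg _ y^-1); rewrite mulgV; have Ay' := sgpV sA Ay.
by apply: fI; [exact: sgpM|rewrite fM// homV// e mulgV].
Qed.

Lemma sgp_image : sgp (f @` A).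
Proof.
split; first by exists 1; [exact: sgp1|exact: hom1].
- by move=> _ _ [x Ax <-] [y Ay <-]; exists (x * y); [exact: sgpM|exact: fM].
- by move=> _ [x Ax <-]; exists x^-1; [exact: sgpV|exact: homV].
Qed.

Lemma sgp_preimage B : sgp B -> sgp (A `&` f @^-1` B).
Proof.
move=> sB; split; first by split; [exact: sgp1|rewrite /= hom1; exact: sgp1].
- by move=> x y [Ax Bx] [Ay By]; split; [|rewrite /= fM//]; exact: sgpM.
- by move=> x [Ax Bx]; split; [|rewrite /= homV//]; exact: sgpV.
Qed.

End Hom.

Section TopGroup.
Variable G : topGroupType.
Implicit Types (H K U V W : set G) (x y g : G).

Lemma continuous_word2 (a b c : G) : continuous (fun x : G => a * x * b * x^-1 * c).
Proof.
have cc (d : G) : continuous (fun _ : G => d) by move=> ?; exact: cvg_cst.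
have ci : continuous (fun x : G => x) by move=> ?; exact: cvg_id.
have cv : continuous (fun x : G => x^-1) by exact: invg_continuous.
by do 4 (apply: continuous_mulg; rewrite //).
Qed.

Lemma continuous_conj (a b : G) : continuous (fun x : G => a * x * b).
Proof.
have cc (d : G) : continuous (fun _ : G => d) by move=> ?; exact: cvg_cst.
have ci : continuous (fun x : G => x) by move=> ?; exact: cvg_id.
by do 2 (apply: continuous_mulg; rewrite //).
Qed.

Lemma nbhs_ml (a x : G) W : nbhs (a * x) W -> nbhs x [set y | W (a * y)].
Proof.
by move=> h; have := @continuous_conj a 1 x; rewrite /continuous_at mulg1 => /(_ _ h);
  rewrite /= nbhs_simpl /=; apply: filterS => y /=; rewrite mulg1.
Qed.
Lemma nbhs_cj (a b x : G) W : nbhs (a * x * b) W -> nbhs x [set y | W (a * y * b)].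
Proof. by move=> h; apply: (@continuous_conj a b x). Qed.
Lemma nbhs1V W : nbhs (1 : G) W -> nbhs (1 : G) [set y | W y^-1].
Proof. by move=> h; apply: (@invg_continuous G 1); rewrite /= invg1. Qed.
Lemma nbhs1_cj g W : nbhs (1 : G) W -> nbhs (1 : G) (cj g W).
Proof. by move=> h; apply: (@nbhs_cj g^-1 g 1); rewrite !group_normE. Qed.
Lemma nbhs1_comm' g W : nbhs (1 : G) W -> nbhs (1 : G) [set y | W (y * g * y^-1 * g^-1)].
Proof.
move=> h; have := @continuous_word2 1 g g^-1 1; rewrite /continuous_at !group_normE.
by move=> /(_ _ h); rewrite nbhs_simpl/=; apply: filterS => y/=; rewrite mul1g.
Qed.
Lemma nbhs1_div W : nbhs (1 : G) W ->
  exists2 W', nbhs (1 : G) W' & forall x y, W' x -> W' y -> W (x * y^-1).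
Proof.
move=> h; have c : continuous (fun x : G * G => x.1 * x.2^-1).
  apply: continuous_mulg; first by move=> x; exact: cvg_fst.
  by apply: continuous_invg => x; exact: cvg_snd.
have := c (1, 1) W; rewrite /= !group_normE => /(_ h) [[A B] [/= A1 B1] AB].
exists (A `&` B); first exact: filterI.
by move=> x y [Ax _] [_ By]; apply: (AB (x, y)).
Qed.

Lemma nbhs1_neq x : hausdorff_space G -> x <> 1 -> nbhs (1 : G) (~` [set x]).
Proof.
move=> hG x1; apply: open_nbhs_nbhs; split; last by move=> /esym.
by apply: closed_openC; apply/accessible_closed_set1/hausdorff_accessible.
Qed.

Lemma finite_near1 H : hausdorff_space G -> finite_set H -> nbhs (1 : G) [set x | H x -> x = 1].
Proof.
move=> hG fH; have cH : closed (H `\ 1).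
  exact: (accessible_finite_set_closed.1 (hausdorff_accessible hG) _ (finite_setD _ fH)).
apply: filterS (open_nbhs_nbhs (conj (closed_openC cH) _)) => [x nx Hx|[_ /(_ erefl)] //].
by apply: contrapT => x1; apply: nx.
Qed.

Lemma open_nbhsP W : (forall x, W x -> nbhs (1 : G) [set y | W (x * y)]) -> open W.
Proof.
move=> h; rewrite openE => x Wx; have := @nbhs_ml x^-1 x [set y | W (x * y)].
by rewrite mulVg => /(_ (h _ Wx)); apply: filterS => y /=; rewrite !group_normE.
Qed.
Lemma open1 W x : open W -> W x -> nbhs (1 : G) [set y | W (x * y)].
Proof. by move=> oW Wx; apply: nbhs_ml; rewrite mulg1; apply: open_nbhs_nbhs. Qed.

Lemma sgp_open H : sgp H -> nbhs (1 : G) H -> open H.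
Proof.
move=> sH nH; apply: open_nbhsP => x Hx; apply: filterS nH => y Hy.
exact: sgpM.
Qed.
Lemma sgp_open_closed H : sgp H -> nbhs (1 : G) H -> closed H.
Proof.
move=> sH nH; rewrite -openC; apply: open_nbhsP => x Hx.
by apply: filterS nH => y Hy /(sgpMr sH Hy).
Qed.

Lemma closed_nbhsP W x : closed W -> (forall V, nbhs (1 : G) V -> exists2 y, W (x * y) & V y) -> W x.
Proof.
move=> cW h; apply: cW => V Vx.
have [|y Wy Vy] := h [set y | V (x * y)]; first by apply: nbhs_ml; rewrite mulg1.
by exists (x * y).
Qed.

(** A limit point [x] of [H] is translated by a nearby [y] in [H] into [O], where closedness is
    known. *)
Lemma sgp_closed_loc H O : sgp H -> sgp O -> nbhs (1 : G) O -> closed (H `&` O) -> closed H.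
Proof.
move=> sH sO nO cHO x hx.
have [|y [Hy Oy]] := hx [set z | O (z^-1 * x)].
  have n1 := nbhs1V nO; have := @nbhs_ml x^-1 x [set y | O y^-1].
  by rewrite mulVg => /(_ n1); apply: filterS => z /=; rewrite !group_normE.
suff: (H `&` O) (y^-1 * x) by case=> + _; apply: sgpMl; [|exact: sgpV].
apply: (closed_nbhsP cHO) => V nV.
have [|z [Hz /= [Vz Oz]]] := hx [set z | V (x^-1 * z) /\ O (x^-1 * z)].
  by apply: filterI; apply: nbhs_ml; rewrite mulVg.
exists (x^-1 * z) => //; rewrite -mulgA mulVKg; split; first by apply: sgpM=> //; apply: sgpV.
by have := sgpM sO Oy Oz; rewrite !group_normE.
Qed.

Lemma closed_cj g K : closed K -> closed (cj g K).
Proof.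
move=> cK; apply: (@preimage_closed _ _ (fun x => g^-1 * x * g)) => //.
by move=> x _; apply: continuous_conj.
Qed.
Lemma compact_cj g K : compact K -> compact (cj g K).
Proof.
move=> cK; have -> : cj g K = (fun x => g * x * g^-1) @` K.
  apply/seteqP; split=> [x Kx|_ [x Kx <-]]; last by rewrite /cj/= !group_normE.
  by exists (g^-1 * x * g) => //; rewrite !group_normE.
by apply: continuous_compact => //; apply: continuous_subspaceT; apply: continuous_conj.
Qed.
Lemma compact_mulset H K : compact H -> compact K ->
  compact [set x | exists h k, [/\ H h, K k & x = h * k]].
Proof.
move=> cH cK.
have -> : [set x | exists h k, [/\ H h, K k & x = h * k]] = (fun p => p.1 * p.2) @` (H `*` K).
  apply/seteqP; split=> [x [h [k [Hh Kk ->]]]|_ [[h k] [Hh Kk] <-]]; first by exists (h, k).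
  by exists h, k.
apply: continuous_compact (compact_setX cH cK).
by apply: continuous_subspaceT; apply: mulg_continuous.
Qed.

(** A tube-lemma argument: continuity of conjugation at each [(u, 1)] becomes uniform along the
    compact [K]. *)
Lemma compact_nz K W : compact K -> nbhs (1 : G) W ->
  nbhs (1 : G) [set v | forall u, K u -> W (u * v * u^-1)].
Proof.
move=> /compact_near_coveringP cK nW.
apply: (cK _ (nbhs (1:G)) (fun v u => W (u * v * u^-1))) => u _.
have c : continuous (fun x : G * G => x.1 * x.2 * x.1^-1).
  apply: continuous_mulg; first by apply: mulg_continuous.
  by apply: continuous_invg => x; exact: cvg_fst.
by apply: (c (u, 1) W); rewrite /= !group_normE.
Qed.

(** Terms of arbitrarily large index lie near a cluster point, and two of them differ by little.
    Later uses rely on the order [n < m], which tells which term comes from further down a chain or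
    product. *)
Lemma compact_pigeonhole K V (x : nat -> G) : compact K -> (forall n, K (x n)) ->
  nbhs (1 : G) V -> exists n m, (n < m)%N /\ V ((x n)^-1 * x m).
Proof.
move=> cK Kx nV.
have [W nW WW] := nbhs1_div (nbhs1V nV).
have [|y [Ky cly]] := cK (x @ \oo) _; first by exists 0%N => // n _; exact: Kx.
pose N := [set z | W (z^-1 * y)].
have nN : nbhs y N.
  have := @nbhs_ml y^-1 y [set w | W w^-1]; rewrite mulVg => /(_ (nbhs1V nW)).
  by apply: filterS => z /=; rewrite !group_normE.
have ex k : exists2 n, (k <= n)%N & N (x n).
  have [|z [[n /= kn <-] Nz]] := cly [set x n | n in [set n | (k <= n)%N]] N _ nN.
    by exists k => // n /= kn; exists n.
  by exists n.
have [n _ Nn] := ex 0%N; have [m nm Nm] := ex n.+1.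
exists n, m; split=> //; have := WW _ _ Nm Nn.
by rewrite /= !group_normE.
Qed.

End TopGroup.

(** * Van Dantzig's theorem: compact open subgroups form a base at 1 *)

Section VanDantzig.
Variable G : topGroupType.
Hypothesis hG : hausdorff_space G.
Implicit Types (A B C K W : set G).

Lemma compact_avoid A B : compact A -> closed B -> A `&` B `<=` set0 ->
  nbhs (1 : G) [set v | forall a, A a -> ~ B (a * v)].
Proof.
move=> /compact_near_coveringP cA cB AB.
apply: (cA _ (nbhs (1:G)) (fun v a => ~ B (a * v))) => a Aa.
apply: (@mulg_continuous G (a, 1) (~` B)); rewrite /= mulg1.
by apply: open_nbhs_nbhs; split; [exact: closed_openC|move=> Ba; apply: (AB a)].
Qed.

Definition rel_clopen K C := [/\ C `<=` K, closed C & closed (K `\` C)].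

(** In a compact Hausdorff set this is the connected component. It is the bridge from total
    disconnectedness, a statement about components, to the existence of clopen sets. *)
Definition quasi_component K x := [set y | forall C, rel_clopen K C -> C x -> C y].

(** If every relatively clopen [C] around [x] met [R], the traces on [R] would form a proper filter,
    and its cluster point in [R] would lie in all the closed sets [C]. *)
Lemma quasi_component_avoid K x R : compact K -> K x -> compact R ->
  R `&` quasi_component K x `<=` set0 ->
  exists C, [/\ rel_clopen K C, C x & C `&` R `<=` set0].
Proof.
move=> cK Kx cR RQ; apply: contrapT => nex.
pose D := [set C | rel_clopen K C /\ C x].
have clK := compact_closed hG cK.
have ne C : D C -> C `&` R !=set0.
  move=> [rC Cx]; apply: contrapT => /set0P/negP; rewrite negbK => /eqP e.
  by apply: nex; exists C; rewrite e; split.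
have FF : ProperFilter (filter_from D (fun C => C `&` R)).
  apply: filter_from_proper => //; apply: filter_from_filter.
    by exists K; split=> //; split=> //; rewrite setDv; exact: closed0.
  move=> C1 C2 [[s1 c1 d1] x1] [[s2 c2 d2] x2]; exists (C1 `&` C2); last first.
    by move=> y [[? ?] ?]; split; split.
  split=> //; split; [by move=> y [/s1]|exact: closedI|].
  by rewrite setDIr; apply: closedU.
have [|p [Rp clp]] := cR _ FF.
  exists K; last by move=> y [].
  by split=> //; split=> //; rewrite setDv; exact: closed0.
apply: (RQ p); split=> // C rC Cx.
case: (rC) => sC cC _; apply: cC => V Vp.
have [|y [[Cy _] Vy]] := clp (C `&` R) V _ Vp; first by exists C.
by exists y.
Qed.

(** If [Q] split into disjoint closed [A] and [B] with [x] in [A], some relatively clopen [C] around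
    [x] would lie in disjoint open neighbourhoods of the two. Its part near [A] is again relatively
    clopen, so it contains [Q] and [B] is empty. *)
Lemma quasi_component_connected K x : compact K -> K x ->
  connected (quasi_component K x).
Proof.
move=> cK Kx; set Q := quasi_component K x.
have clK := compact_closed hG cK.
have QK : Q `<=` K.
  move=> y /(_ K); apply=> //; split=> //; rewrite setDv; exact: closed0.
have cQ : closed Q.
  have -> : Q = \bigcap_(C in [set C | rel_clopen K C /\ C x]) C.
    apply/seteqP; split=> y Qy; first by move=> C [rC Cx]; apply: Qy.
    by move=> C rC Cx; apply: Qy.
  by apply: closed_bigI => C [[]].
have key A B : closed A -> closed B -> A `|` B = Q -> A `&` B `<=` set0 ->
    A x -> B `<=` set0.
  move=> cA cB AB AB0 Ax.
  have AQ : A `<=` Q by rewrite -AB; left.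
  have BQ : B `<=` Q by rewrite -AB; right.
  have coA : compact A by apply: subclosed_compact cA cK _ => y /AQ/QK.
  (* The separating neighbourhoods come from the group: translates of one small [V] along [A] and
     along [B] are disjoint. *)
  have [V nV VV] := nbhs1_div (compact_avoid coA cB AB0).
  pose nb S := \bigcup_(a in S) [set y | V° (a^-1 * y)].
  have onb S : open (nb S).
    apply: bigcup_open => a _; apply: open_comp; last exact: open_interior.
    by move=> y _; have := @continuous_conj G a^-1 1 y; rewrite /continuous_at;
      under eq_fun do rewrite mulg1; rewrite mulg1.
  have snb S : S `<=` nb S.
    by move=> y Sy; exists y => //=; rewrite mulVg; exact: nbhs_singleton (nbhs_interior nV).
  have dis : nb A `&` nb B `<=` set0.
    move=> y [[a Aa /= /interior_subset va] [b Bb /= /interior_subset vb]].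
    by apply: (VV _ _ va vb a Aa); move: Bb; rewrite /= !group_normE.
  have cR : compact (K `\` (nb A `|` nb B)).
    apply: subclosed_compact cK _; last by move=> y [].
    by rewrite setDE; apply: closedI => //; apply: open_closedC; apply: openU.
  have [|C [[CK cC cKC] Cx CR]] := quasi_component_avoid cK Kx cR.
    by move=> z [[_ h] Qz]; apply: h; move: Qz; rewrite -/Q -AB => -[/snb|/snb]; [left|right].
  have Cnb y : C y -> nb A y \/ nb B y.
    by move=> Cy; apply: contrapT => h; apply: (CR y); split=> //; split=> //; apply: CK.
  have e1 : C `&` nb A = C `\` nb B.
    apply/seteqP; split=> y [Cy h]; split=> //; first by move=> h'; apply: (dis y).
    by case: (Cnb y Cy).
  have rC' : rel_clopen K (C `&` nb A).
    split; first by move=> y [/CK].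
      by rewrite e1 setDE; apply: closedI => //; apply: open_closedC.
    rewrite setDIr; apply: closedU => //.
    by rewrite setDE; apply: closedI => //; apply: open_closedC.
  move=> y By; have [|_ nAy] := BQ y By _ rC'; first by split=> //; apply: snb.
  by apply: (dis y); split=> //; apply: snb.
have Qx : Q x by [].
move=> B [b Bb] [O oO BO] [F cF BF].
have cB : closed B by rewrite BF; apply: closedI.
have cB' : closed (Q `\` B).
  rewrite (_ : Q `\` B = Q `\` O) ?setDE; first by apply: closedI => //; apply: open_closedC.
  by rewrite BO; apply/seteqP; split=> y [Qy h]; split=> //; [move=> Oy; apply: h|move=> [_ /h]].
have BQ : B `<=` Q by rewrite BO => y [].
have [Bx|nBx] := pselect (B x).
  apply/seteqP; split=> // y Qy; apply: contrapT => nBy.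
  apply: (key B (Q `\` B) _ _ _ _ _ y) => //; last by move=> z [? []].
  by rewrite setDUK.
suff : B `<=` set0 by move=> /(_ b Bb).
apply: (key (Q `\` B)) => //; first by rewrite setUC setDUK.
by move=> z [[]].
Qed.

Lemma compact_open_subgroup_base : locally_compact [set: G] ->
  totally_disconnected [set: G] -> forall W, nbhs (1 : G) W ->
  exists V, [/\ sgp V, nbhs (1 : G) V, compact V & V `<=` W].
Proof.
move=> lcG tdG W nW.
have [K nK [coK clK]] := lcG 1 I.
have {}nK : nbhs (1 : G) K by move: nK; rewrite withinET.
pose N := (W `&` K)°.
have N1 : N 1 by apply: nbhs_singleton; apply: nbhs_interior; apply: filterI.
have NK : N `<=` K by move=> y /interior_subset[].
have NW : N `<=` W by move=> y /interior_subset[].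
have oN : open N := @open_interior _ _.
have [||C [[CK cC cKC] C1 CR]] := @quasi_component_avoid K 1 (K `\` N) coK (NK _ N1).
- apply: subclosed_compact coK _; last by move=> y [].
  by rewrite setDE; apply: closedI => //; apply: open_closedC.
- have := tdG 1 I => e; move=> y [[_ h] Qy]; apply: h.
  have := @connected_component_max _ [set: G] (quasi_component K 1) 1 _ _
    (quasi_component_connected coK (NK _ N1)).
  by rewrite e => /(_ (fun _ _ => id) (fun _ _ => I) _ Qy) ->.
have CN : C `<=` N.
  by move=> y Cy; apply: contrapT => h; apply: (CR y); split=> //; split=> //; apply: CK.
have oC : open C.
  have -> : C = N `&` ~` (K `\` C).
    apply/seteqP; split=> y; first by move=> Cy; split; [exact: CN|case].
    by move=> [/NK Ky h]; apply: contrapT => nC; apply: h.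
  by apply: openI => //; apply: closed_openC.
have coC := subclosed_compact cC coK CK.
(* The right stabilizer of the clopen set [C]. It is open because [C] is compact and open, and it
   lies in [C] because [C] contains 1. *)
pose H := [set g | forall c, C c <-> C (c * g)].
have sH : sgp H.
  split; first by move=> c; rewrite mulg1.
  - move=> x y Hx Hy c; rewrite mulgA; have [a b] := Hx c; have [d e] := Hy (c * x).
    by split=> h; [exact: d (a h)|exact: b (e h)].
  - by move=> x Hx c; have := Hx (c * x^-1); rewrite !group_normE => -[h1 h2]; split; [exact: h2|exact: h1].
have nH : nbhs (1 : G) H.
  have n1 : nbhs (1 : G) [set v | forall a, C a -> C (a * v)].
    have nC := @compact_avoid C (~` C) coC (open_closedC oC).
    apply: filterS (nC _) => [v h a Ca|]; first exact: contrapT (h a Ca).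
    by rewrite setICr.
  apply: filterS (filterI n1 (nbhs1V n1)) => v [h1 h2] c; split=> [/h1//|Cv]; have := h2 _ Cv.
  by rewrite /= !group_normE.
exists H; split=> //.
  apply: subclosed_compact (sgp_open_closed sH nH) coK _ => g Hg.
  by apply: CK; have := (Hg 1).1 C1; rewrite mul1g.
by move=> g Hg; apply: NW; apply: CN; have := (Hg 1).1 C1; rewrite mul1g.
Qed.
End VanDantzig.

(** * Relative openness and local normality read off at 1 *)

Section OpenIn.
Variable G : topGroupType.
Implicit Types (A H K U V W : set G).

Lemma subgroupP A H : subgroup A H <-> sgp H /\ H `<=` A.
Proof. by split=> [[? ? ? ?]|[[? ? ?] ?]]; [split=> //; split|split]. Qed.

Lemma open_in_nbhs A U x : open_in A U -> U x ->
  nbhs (1 : G) [set y | A (x * y) -> U (x * y)].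
Proof.
move=> [UA /open_subspaceP [V oV VU]] Ux.
have Vx : V x by have : (U `&` A) x by [split=> //; exact: UA]; rewrite -VU => -[].
apply: filterS (open1 oV Vx) => y Vy Ay.
by have : (V `&` A) (x * y) by []; rewrite VU => -[].
Qed.

Lemma sgp_open_in A U : sgp A -> sgp U -> U `<=` A ->
  nbhs (1 : G) [set y | A y -> U y] -> open_in A U.
Proof.
move=> sA sU UA nU; split=> //; apply/open_subspaceP.
pose V := [set y | A y -> U y].
exists V°; first exact: open_interior.
apply/seteqP; split=> x [h Ax]; split=> //; first exact: (interior_subset h).
have := @nbhs_ml _ x^-1 x V; rewrite mulVg => /(_ nU); apply: filterS => z h' Az.
have /h' Uz : A (x^-1 * z) by apply: sgpM => //; apply: sgpV.
by have := sgpM sU h Uz; rewrite !group_normE.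
Qed.

Lemma open_subgroup_refl A : sgp A -> open_subgroup A A.
Proof.
move=> sA; split; first by apply/subgroupP; split.
by apply: sgp_open_in => //; apply: filterS filterT => x _.
Qed.

Lemma open_in_sgp A U : sgp A -> sgp U -> U `<=` A ->
  open_in A U <-> nbhs (1 : G) [set y | A y -> U y].
Proof.
move=> sA sU UA; split; last exact: sgp_open_in.
move=> /open_in_nbhs /(_ (sgp1 sU)); apply: filterS => y /=; by rewrite mul1g.
Qed.

Lemma closed_inP A U : closed A -> closed_in A U <-> U `<=` A /\ closed U.
Proof.
move=> cA; split=> -[UA cU]; split=> //; last exact: closed_subspaceW.
have /closed_subspaceP [V cV VU] := cU.
by have -> : U = V `&` A by [rewrite VU; apply/esym/setIidPl]; apply: closedI.
Qed.

Lemma openT_sgp U : open_subgroup [set: G] U <-> sgp U /\ nbhs (1 : G) U.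
Proof.
split=> [[/subgroupP[sU _] /(open_in_sgp (@sgpT G) sU (@subsetT _ _)) oU]|[sU nU]].
  by split=> //; apply: filterS oU => y h; exact: h.
split; first exact/subgroupP.
by apply: sgp_open_in => //; apply: filterS nU => y Uy _.
Qed.

(** The working form of [closed_locally_normal [set: G] K]; see [lnormTP]. *)
Definition lnorm K := [/\ sgp K, closed K & nbhs (1 : G) (nz K)].

Lemma normaliserE K : normaliser K = [set g | nz K g /\ nz K g^-1].
Proof.
apply/seteqP; split=> g; rewrite /normaliser/=.
  move=> e; split=> x Kx; first by rewrite -e; exists x.
  by move: Kx; rewrite -{1}e => -[y Ky <-]; rewrite !group_normE.
move=> [n1 n2]; apply/seteqP; split=> [_ [x Kx <-]|x Kx]; first exact: n1.
by exists (g^-1 * x * g); [have := n2 _ Kx|]; rewrite !group_normE.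
Qed.

Lemma normaliser_sgp K : sgp (normaliser K).
Proof.
rewrite normaliserE; split; first by split; rewrite ?invg1; apply: nz1.
- by move=> x y [? ?] [? ?]; split; rewrite ?invgM; apply: nzM.
- by move=> x [? ?]; split; rewrite ?invgK.
Qed.

Lemma lnormP A K : sgp A -> closed A ->
  closed_locally_normal A K <->
  [/\ sgp K, K `<=` A, closed K & nbhs (1 : G) [set y | A y -> nz K y]].
Proof.
move=> sA cA.
have sN : sgp (A `&` normaliser K) by apply: sgpI => //; exact: normaliser_sgp.
split.
  move=> [[/subgroupP[sK KA] /(closed_inP _ cA)[_ cK]] /(open_in_sgp sA sN (@subIsetl _ _ _)) n].
  by split=> //; apply: filterS n => y h /h[_]; rewrite normaliserE => -[].
move=> [sK KA cK n]; split; first by split; [exact/subgroupP|exact/closed_inP].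
apply: sgp_open_in => //.
apply: filterS (filterI n (nbhs1V n)) => y [h1 h2] Ay; split=> //.
by rewrite normaliserE; split; [exact: h1|apply: h2; exact: sgpV].
Qed.

Lemma lnormTP K : closed_locally_normal [set: G] K <-> lnorm K.
Proof.
split=> [/(lnormP _ (@sgpT G) closedT)[sK _ cK n]|[sK cK n]].
  by split=> //; apply: filterS n => y h; exact: h.
by apply/lnormP => //; split=> //; apply: filterS n => y ny _.
Qed.

End OpenIn.

Section HomOn.
Variables G H : topGroupType.
Implicit Types (A : set G) (B : set H) (f : G -> H).

Lemma hom_onP A B f : sgp A ->
  hom_on A B f <-> [/\ set_fun A B f, forall x y, A x -> A y -> f (x * y) = f x * f y
    & forall W, nbhs (1 : H) W -> nbhs (1 : G) [set x | A x -> W (f x)]].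
Proof.
move=> sA; split=> -[fAB fM].
  move=> /subspace_continuousP fc; split=> // W nW.
  have f1 := hom1 sA fM.
  by have := fc 1 (sgp1 sA) W; rewrite /from_subspace f1 => /(_ nW).
move=> fc; split=> //; apply/subspace_continuousP => x Ax W nW.
have /fc n1 : nbhs (1 : H) [set y | W (f x * y)] by apply: nbhs_ml; rewrite mulg1.
have := @nbhs_ml _ x^-1 x [set y | A y -> W (f x * f y)]; rewrite mulVg => /(_ n1).
apply: filterS => y /= h Ay; have Az : A (x^-1 * y) by apply: sgpM => //; apply: sgpV.
by have := h Az; rewrite -fM// mulVKg.
Qed.

End HomOn.

(** * Quasi-centralizers *)

Section Local.
Variable G : topGroupType.
Implicit Types (A H K L C R S U V W : set G) (x y g : G).

(* The quasi-centralizer of [K], i.e. the elements whose germ commutes with that of [K]: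
   it depends only on the local class of [K], so [perp (perp K)] is a canonical
   representative of that class; [reg] singles out these representatives. *)
Definition perp K := [set g | nbhs (1 : G) [set x | K x -> commute g x]].

Lemma perp_sgp K : sgp (perp K).
Proof.
split; first by apply: filterS filterT => x _ _; exact/commute_sym/commute1.
- move=> x y; apply: filterS2 => z h1 h2 Kz; apply: commute_sym; apply: commuteM; apply: commute_sym; auto.
- by move=> x; apply: filterS => z h Kz; apply/commute_sym/commuteV/commute_sym/h.
Qed.

Lemma perp_loc K K' : nbhs (1 : G) [set x | K' x -> K x] -> perp K `<=` perp K'.
Proof. by move=> n g; apply: filterS2 n => x h1 h2 /h1. Qed.
Lemma perpS K K' : K' `<=` K -> perp K `<=` perp K'.
Proof. by move=> s; apply: perp_loc; apply: filterS filterT => x _; apply: s. Qed.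

Lemma commute_cj (g x y : G) : commute x y -> commute (g * x * g^-1) (g * y * g^-1).
Proof. by rewrite /commute !group_normE => e; rewrite -(mulgA g x y) e mulgA. Qed.

Lemma perp_cj g K : perp (cj g K) = cj g (perp K).
Proof.
have key h L : perp (cj h L) `<=` cj h (perp L).
  move=> p /(nbhs1_cj h^-1); apply: filterS => x /= hx Lx.
  have c : commute p (h * x * h^-1).
    by move: hx; rewrite /cj/= !group_normE; apply.
  by have := commute_cj h^-1 c; rewrite !group_normE.
apply/seteqP; split; first exact: key.
move=> p; have := @key g^-1 (cj g K); rewrite cjK => h.
move=> /h hp; have : perp (cj g K) (g^-1^-1 * (g^-1 * p * g) * g^-1) := hp.
by rewrite !group_normE.
Qed.

Lemma perp_nz K g : nz K g -> nz K g^-1 -> nz (perp K) g.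
Proof. by move=> n1 n2; apply: cj_nz; rewrite -perp_cj nz_cj. Qed.

Lemma perp_perp_loc K : nbhs (1 : G) (nz K) -> nbhs (1 : G) (nz (perp K)).
Proof.
move=> n; apply: filterS (filterI n (nbhs1V n)) => g [].
exact: perp_nz.
Qed.

Definition dj R S := R `&` S `<=` [set 1].
Definition reg R := lnorm R /\ perp (perp R) `<=` R.

End Local.

(** * The Boolean algebra of locally normal subgroups *)

(** What (LD) says near 1: [L] is open in [K] and [C] is its complement. The last clause is
    continuity at 1 of the inverse of multiplication, so small elements have small factors. *)
Definition local_factor (G : topGroupType) (K L C : set G) :=
  [/\ [/\ sgp L, sgp C & L `<=` K], nbhs (1 : G) [set x | K x -> L x],
    closed C /\ L `&` C `<=` [set 1], forall l c, L l -> C c -> commute l c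
    & forall W, nbhs (1 : G) W ->
      nbhs (1 : G) [set x | exists l c, [/\ L l /\ W l, C c /\ W c & x = l * c]]].

Record ldgroup (G : topGroupType) : Prop := LDGroup {
  ld_hausdorff : hausdorff_space G;
  ld_base : forall W, nbhs (1 : G) W ->
    exists V, [/\ sgp V, nbhs (1 : G) V, compact V & V `<=` W];
  ld_factor : forall K : set G, lnorm K -> exists L C, local_factor K L C;
  ld_qz : forall x : G, nbhs (1 : G) [set g | commute x g] -> x = 1
}.

Lemma tdlc_ldgroup (G : topGroupType) : tdlc G -> property_LD G ->
  quasi_centre [set: G] = [set 1] -> ldgroup G.
Proof.
move=> [hG lG tG] LDG QZG; split=> //.
- by move=> W; apply: compact_open_subgroup_base.
- move=> K lK; have cK : closed_locally_normal [set: G] K by exact/lnormTP.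
  have [L [O [[/subgroupP[sL LK] oL] /openT_sgp[sO nO]]]] := LDG _ cK.
  have sK : sgp K by case: lK.
  have nL := (open_in_sgp sK sL LK).1 oL.
  have clO := sgp_open_closed sO nO.
  move=> [C [[/subgroupP[_ LO] _] [/subgroupP[sC CO] /(closed_inP _ clO)[_ clC]]]].
  move=> [[fS fM fC] [g [[gS gM gC] gf fg]]].
  have inj l c l' c' : L l -> C c -> L l' -> C c' -> l * c = l' * c' -> l = l' /\ c = c'.
    move=> Ll Cc Ll' Cc' e.
    have := gf (l, c) (conj Ll Cc); rewrite /= e -[l' * c']/((l', c').1 * (l', c').2).
    by rewrite gf// => -[-> ->].
  exists L, C; split=> //.
  + split=> // x [Lx Cx].
    have e : x * x^-1 = 1 * 1 by rewrite mulgV mulg1.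
    by have [-> _] := inj _ _ _ _ Lx (sgpV sC Cx) (sgp1 sL) (sgp1 sC) e.
  + move=> l c Ll Cc; have := fM (1, c) (l, 1) (conj (sgp1 sL) Cc) (conj Ll (sgp1 sC)).
    by rewrite /= !mul1g !mulg1 /commute => ->.
  + move=> W nW; have /subspace_continuousP gc := gC.
    have e1 : g 1 = (1, 1).
      have := gf (1, 1) (conj (sgp1 sL) (sgp1 sC)); by rewrite /= mulg1.
    have := gc 1 (sgp1 sO) (W `*` W); rewrite /from_subspace e1 => /(_ _).
    have nWW : nbhs (1 : G, 1 : G) (W `*` W) by exists (W, W).
    move=> /(_ nWW) n; apply: filterS (filterI nO n) => x [Ox /(_ Ox) [/= W1 W2]].
    exists (g x).1, (g x).2; have [/= h1 h2] := gS x Ox; split=> //.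
    by have := fg x Ox.
- move=> x nx; have : quasi_centre [set: G] x; last by rewrite QZG.
  split=> //; apply: sgp_open_in => //.
  + split; first by split=> //; apply/commute_sym/commute1.
    * move=> a b [_ /commute_sym ha] [_ /commute_sym hb]; split=> //.
      by apply: commute_sym; apply: commuteM.
    * by move=> a [_ /commute_sym ha]; split=> //; apply/commute_sym/commuteV.
  + by apply: filterS nx => y h _; split=> //; apply: commute_sym.
Qed.

Section LocallyNormal.
Variables (G : topGroupType) (HG : ldgroup G).
Implicit Types (A H K L C R S U V W N : set G) (x y g : G).
Let hG := ld_hausdorff HG.

Lemma closed_1 : closed [set (1 : G)].
Proof. exact/accessible_closed_set1/hausdorff_accessible. Qed.

Lemma lnorm_1 : lnorm [set (1 : G)].
Proof.
split; [exact: sgp_1|exact: closed_1|apply: filterS filterT => g _ x ->].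
by rewrite !group_normE.
Qed.

Lemma lnorm_open V : sgp V -> nbhs (1 : G) V -> lnorm V.
Proof.
move=> sV nV; split=> //; first exact: sgp_open_closed.
by apply: filterS nV => g Vg; apply: nz_sgp.
Qed.

Lemma lnormI R S : lnorm R -> lnorm S -> lnorm (R `&` S).
Proof.
move=> [sR cR nR] [sS cS nS]; split; [exact: sgpI|exact: closedI|].
by apply: filterS (filterI nR nS) => g; apply: nzI.
Qed.

Lemma lnorm_cj g K : lnorm K -> lnorm (cj g K).
Proof.
move=> [sK cK nK]; split; [exact: cj_sgp|exact: closed_cj|].
by apply: filterS (nbhs1_cj g nK) => h; apply: cj_nzE.
Qed.

Lemma nbhs_nzV K : nbhs (1 : G) (nz K) -> nbhs (1 : G) [set g | nz K g /\ nz K g^-1].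
Proof. by move=> n; exact: filterI n (nbhs1V n). Qed.

(** For [y] near 1 the commutator of [y] with [x] lies in [K] and near 1, hence is trivial. So [x]
    is quasi-central. *)
Lemma discrete_lnorm K : lnorm K -> nbhs (1 : G) [set x | K x -> x = 1] -> K `<=` [set 1].
Proof.
move=> [sK _ nK] n1 x Kx; apply: (ld_qz HG).
apply: filterS2 (nbhs1_comm' x n1) nK => y /= h ny.
have /h e : K (y * x * y^-1 * x^-1) by apply: sgpM => //; [exact: ny|exact: sgpV].
apply/commute_sym; apply: (@mulIg _ y^-1); apply: (@mulIg _ x^-1); by rewrite e !group_normE.
Qed.

(** An element of [L] and [perp K] commutes with both local factors [L] and [C], so it is
    quasi-central and trivial. Hence [perp K] agrees near 1 with the closed [C], and it is closed by
    [sgp_closed_loc]. *)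
Lemma perpI_triv K : lnorm K -> K `&` perp K `<=` [set 1] /\ lnorm (perp K).
Proof.
move=> lK; have [sK cK nK] := lK.
have [L [C [[sL sC LK] nL [cC LC] cLC nLC]]] := ld_factor HG lK.
have Cp : C `<=` perp K.
  by move=> c Cc; apply: filterS nL => x h /h Lx; apply/commute_sym/cLC.
have Lp : L `&` perp K `<=` [set 1].
  move=> l [Ll pl]; apply: (ld_qz HG).
  apply: filterS (nLC _ pl) => x [l' [c [[Ll' h] [Cc _] ->]]].
  by apply: commuteM; [apply: h; exact: LK|exact: cLC].
have sP := perp_sgp K.
have pC x l c : L l -> C c -> x = l * c -> perp K x -> C x.
  move=> Ll Cc e px; have l1 : l = 1; last by rewrite e l1 mul1g.
  by apply: Lp; split=> //; apply: (sgpMr sP (Cp _ Cc)); rewrite -e.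
have [V [sV nV _ Vs]] := ld_base HG (nLC _ filterT).
have lP : lnorm (perp K).
  split=> //; last exact: perp_perp_loc.
  apply: (sgp_closed_loc sP sV nV).
  have -> : perp K `&` V = C `&` V.
    apply/seteqP; split=> x [h Vx]; split=> //; last exact: Cp.
    by have [l [c [[Ll _] [Cc _] e]]] := Vs _ Vx; apply: pC Ll Cc e h.
  exact: closedI cC (sgp_open_closed sV nV).
split=> //; apply: discrete_lnorm; first exact: lnormI.
by apply: filterS nL => x h [/h Lx px]; apply: Lp.
Qed.

Lemma perp_dj K : lnorm K -> dj K (perp K). Proof. by case/perpI_triv. Qed.
Lemma lnorm_perp K : lnorm K -> lnorm (perp K). Proof. by case/perpI_triv. Qed.

(** The commutator lies in [K] because [g] normalises [K], and in [perp K] because [x] does too.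
    This is how commutation of germs becomes commutation of elements. *)
Lemma perp_commute K x g : lnorm K -> K x -> perp K g -> nz K g -> commute x g.
Proof.
move=> lK; have [sK _ _] := lK => Kx pg ng.
have e : g * x * g^-1 * x^-1 = 1.
  apply: (perp_dj lK); split; first by apply: sgpM => //; [exact: ng|exact: sgpV].
  have -> : g * x * g^-1 * x^-1 = g * (x * g^-1 * x^-1) by rewrite !group_normE.
  apply: sgpM => //; first exact: perp_sgp.
  apply: perp_nz; [| |apply: sgpV => //; exact: perp_sgp].
    exact: nz_sgp.
  by apply: nz_sgp => //; exact: sgpV.
by apply/commute_sym; apply: (@mulIg _ g^-1); apply: (@mulIg _ x^-1); rewrite e !group_normE.
Qed.

Lemma sub_perp_perp K : lnorm K -> K `<=` perp (perp K).
Proof.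
move=> lK x Kx; have [_ _ nK] := lK.
by apply: filterS nK => g ng pg; exact: perp_commute lK Kx pg ng.
Qed.

(** Near 1 an element is [l * c] with [c] in [perp K]; if it lies in [perp (perp K)] then so does
    [c], which is therefore 1. *)
Lemma perp_perp_near K : lnorm K -> nbhs (1 : G) [set x | perp (perp K) x -> K x].
Proof.
move=> lK; have [L [C [[sL sC LK] nL _ cLC nLC]]] := ld_factor HG lK.
apply: filterS (nLC _ filterT) => x [l [c [[Ll _] [Cc _] ->]]] px.
have Kl := LK _ Ll; have c1 : c = 1; last by rewrite c1 mulg1.
apply: (perp_dj (lnorm_perp lK)); split.
  by apply: filterS nL => y h /h Ly; apply/commute_sym/cLC.
by apply: (sgpMl (perp_sgp _) _ px); apply: sub_perp_perp.
Qed.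

Lemma perp_mul_near K W : lnorm K -> nbhs (1 : G) W ->
  nbhs (1 : G) [set x | exists k p, [/\ K k /\ W k, perp K p /\ W p & x = k * p]].
Proof.
move=> lK nW; have [L [C [[sL sC LK] nL _ cLC nLC]]] := ld_factor HG lK.
apply: filterS (nLC _ nW) => x [l [c [[Ll Wl] [Cc Wc] ->]]].
exists l, c; split=> //; split=> //; first exact: LK.
by apply: filterS nL => y h /h Ly; apply/commute_sym/cLC.
Qed.

Lemma perp3 K : lnorm K -> perp (perp (perp K)) `<=` perp K.
Proof. by move=> lK; apply: perpS; apply: sub_perp_perp. Qed.

Lemma reg_lnorm R : reg R -> lnorm R. Proof. by case. Qed.
Lemma regE R : reg R -> perp (perp R) = R.
Proof. by move=> [lR h]; apply/seteqP; split=> //; apply: sub_perp_perp. Qed.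
Lemma reg_perp K : lnorm K -> reg (perp K).
Proof. by move=> lK; split; [exact: lnorm_perp|exact: perp3]. Qed.
Lemma reg_pp K : lnorm K -> reg (perp (perp K)).
Proof. by move=> /lnorm_perp/reg_perp. Qed.
(** The family may be infinite, provided the intersection is still normalised near 1. This gives
    largest elements that avoid all conjugates of a given one. *)
Lemma reg_bigcap (I : Type) (D : set I) (R : I -> set G) :
  (forall i, D i -> reg (R i)) -> nbhs (1 : G) (nz (\bigcap_(i in D) R i)) ->
  reg (\bigcap_(i in D) R i).
Proof.
move=> rR n; split.
  split=> //; first by apply: sgp_bigcap => i /rR[[]].
  by apply: closed_bigI => i /rR[[]].
move=> x hx i Di; have [_] := rR _ Di; apply.
by apply: perpS x hx; apply: perpS => y; apply.
Qed.
Lemma regI R S : reg R -> reg S -> reg (R `&` S).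
Proof.
move=> [lR rR] [lS rS]; split; first exact: lnormI.
move=> x hx; split; [apply: rR|apply: rS]; apply: perpS x hx; apply: perpS.
  by move=> y [].
by move=> y [].
Qed.
Lemma reg_1 : reg [set (1 : G)].
Proof.
split; first exact: lnorm_1; move=> x px; apply: (ld_qz HG).
apply: filterS px => g; apply; apply: filterS filterT => y _ ->.
exact: commute1.
Qed.
Lemma reg_T : reg [set: G].
Proof. by split=> //; apply: lnorm_open => //; exact: filterT. Qed.
Lemma perp_1 : perp [set (1 : G)] = [set: G].
Proof.
apply/seteqP; split=> // g _; apply: filterS filterT => x _ ->.
exact: commute1.
Qed.
Lemma perp_T : perp [set: G] = [set 1].
Proof. by rewrite -perp_1 regE//; exact: reg_1. Qed.
Lemma reg_cj g R : reg R -> reg (cj g R).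
Proof.
move=> [lR rR]; split; first exact: lnorm_cj.
by rewrite !perp_cj; apply: cjS.
Qed.

Lemma dj_perp R S : lnorm R -> lnorm S -> dj R S -> S `<=` perp R.
Proof.
move=> lR lS RS; have [sR _ nR] := lR; have [sS _ nS] := lS.
have n : nbhs (1 : G) [set s | S s -> perp R s].
  apply: filterS nR => s ns Ss; apply: filterS nS => r nr Rr.
  have e : s * r * s^-1 * r^-1 = 1.
    apply: RS; split; first by apply: sgpM => //; [exact: ns|exact: sgpV].
    have -> : s * r * s^-1 * r^-1 = s * (r * s^-1 * r^-1) by rewrite !group_normE.
    by apply: sgpM => //; apply: nr; exact: sgpV.
  by apply: (@mulIg _ s^-1); apply: (@mulIg _ r^-1); rewrite e !group_normE.
(* The inclusion holds near 1 so far; passing through [perp (perp S)] extends it to all of [S]. *)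
move=> s Ss; apply: (perp3 lR); move: s {Ss} (sub_perp_perp lS Ss).
by apply: perpS; exact: perp_loc.
Qed.

Lemma djC R S : dj R S -> dj S R. Proof. by rewrite /dj setIC. Qed.
Lemma djS R R' S S' : R' `<=` R -> S' `<=` S -> dj R S -> dj R' S'.
Proof. by move=> r s h x [/r ? /s ?]; apply: h. Qed.
Lemma dj_sub R S : reg R -> lnorm S -> dj S (perp R) -> S `<=` R.
Proof.
move=> [lR rR] lS /djC d; apply: subset_trans rR; apply: dj_perp => //.
exact: lnorm_perp.
Qed.
Lemma sub_dj R S : lnorm R -> S `<=` perp R -> dj R S.
Proof. by move=> /perp_dj d s x [Rx /s px]; apply: d. Qed.

(** Near 1 every element is a product of one in [R], which normalises [N], and one in [perp R],
    which centralises it. So local normality can be tested inside [R]. *)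
Lemma lnorm_sub R N : lnorm R -> sgp N -> closed N -> N `<=` R ->
  nbhs (1 : G) [set r | R r -> nz N r] -> lnorm N.
Proof.
move=> lR sN cN NR nN; split=> //; have [_ _ nR] := lR.
apply: filterS (perp_mul_near lR (filterI nN nR)) => x [k [p [[Rk [nk _]] [pp [_ np]] ->]]].
apply: nzM; first exact: nk.
move=> y Ny; have e := perp_commute lR (NR _ Ny) pp np.
by rewrite -e mulgK.
Qed.

Lemma compact_open_lnormI R W : lnorm R -> nbhs (1 : G) W ->
  exists S, [/\ lnorm S, compact S, S `<=` R, S `<=` W & nbhs (1 : G) [set x | R x -> S x]].
Proof.
move=> lR nW; have [V [sV nV cV VW]] := ld_base HG nW; have [_ cR _] := lR.
exists (R `&` V); split.
- by apply: lnormI => //; apply: lnorm_open.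
- by rewrite setIC; apply: compact_closedI.
- by move=> x [].
- by move=> x [_ /VW].
- by apply: filterS nV => x Vx Rx.
Qed.

Lemma lnorm_nt R W : lnorm R -> R <> [set 1] -> nbhs (1 : G) W ->
  exists x, [/\ R x, W x & x <> 1].
Proof.
move=> lR R1 nW; apply: contrapT => h; apply: R1.
have [sR _ _] := lR; apply: sgp_triv => // ; apply: discrete_lnorm => //.
by apply: filterS nW => x Wx Rx; apply: contrapT => x1; apply: h; exists x.
Qed.

End LocallyNormal.

(** * Finiteness of invariant subalgebras *)

Section Atoms.
Variables (G : topGroupType) (HG : ldgroup G).
Implicit Types (A K L C R S T U V W N : set G) (x y g : G) (l : seq (set G)).

Definition co U := [/\ sgp U, nbhs (1 : G) U & compact U].

(** The intersection of all [U]-conjugates of a small open subgroup; it stays open because [U] is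
    compact. *)
Lemma normal_core U W : co U -> nbhs (1 : G) W ->
  exists V, [/\ co V, V `<=` U, V `<=` W & forall u, U u -> nz V u].
Proof.
move=> [sU nU cU] nW.
have [V0 [sV0 nV0 cV0 VW]] := ld_base HG (filterI nU nW).
pose V := \bigcap_(u in U) cj u^-1 V0.
have VE v : V v <-> forall u, U u -> V0 (u * v * u^-1).
  by split=> h u Uu; have := h u Uu; rewrite /cj/= invgK.
have V1 : V `<=` V0 by move=> v /VE /(_ 1 (sgp1 sU)); rewrite !group_normE.
have nV : nbhs (1 : G) V.
  by apply: filterS (compact_nz cU nV0) => v h; apply/VE.
exists V; split; [|by move=> x /V1/VW[]|by move=> x /V1/VW[]|].
  split=> //; first by apply: sgp_bigcap => u _; apply: cj_sgp.
  apply: subclosed_compact cV0 V1; apply: closed_bigI => u _.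
  by apply: closed_cj; exact: sgp_open_closed.
move=> u Uu v /VE h; apply/VE => u' Uu'; have := h _ (sgpM sU Uu' Uu).
by rewrite !group_normE.
Qed.

Definition invreg U := [set R | reg R /\ forall u, U u -> nz R u].

(* Choose [x i] in [R i] outside [V i], and let [N] be the intersection of the groups
   [(R i `&` V i) * perp (R i)]. (LD) applied to [N] and the pigeonhole principle applied
   to the partial products of the [x i] force some [x n] into [V n]. *)
Lemma no_infinite_independent U (R : nat -> set G) : co U ->
  (forall i, invreg U (R i)) -> (forall i, R i <> [set 1]) ->
  (forall i j, i <> j -> dj (R i) (R j)) -> False.
Proof.
move=> coU RU R1 Rdj; have [sU nU cU] := coU.
have rR i : reg (R i) by case: (RU i).
have lR i : lnorm (R i) := reg_lnorm (rR i).
have nR i u : U u -> nz (R i) u by case: (RU i) => _; apply.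
have Rp i j : i <> j -> R j `<=` perp (R i) by move=> ij; apply: dj_perp => //; exact: Rdj.
have /choice[xV xVP] i : exists p : G * set G, [/\ R i p.1, U p.1, ~ p.2 p.1 & [/\ co p.2, p.2 `<=` U &
    forall u, U u -> nz p.2 u]].
  have [x [Rx Ux x1]] := lnorm_nt HG (lR i) (R1 i) nU.
  have [V [coV VU Vx UV]] := normal_core coU (nbhs1_neq (ld_hausdorff HG) x1).
  by exists (x, V); split=> //= Vxx; apply: (Vx x Vxx).
pose x i := (xV i).1; pose V i := (xV i).2.
have Rx i : R i (x i) by case: (xVP i).
have Ux i : U (x i) by case: (xVP i).
have nVx i : ~ V i (x i) by case: (xVP i).
have coV i : co (V i) by case: (xVP i) => _ _ _ [].
have VU i : V i `<=` U by case: (xVP i) => _ _ _ [].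
have UV i u : U u -> nz (V i) u by case: (xVP i) => _ _ _ [_ _]; apply.
pose Ni i := R i `&` V i; pose Ci i := perp (R i) `&` U.
(* The component in [R i] is confined to [V i], which excludes [x i]; the complementary component is
   free within [U]. *)
pose NC i := [set y | exists n c, [/\ Ni i n, Ci i c & y = n * c]].
have comm i a c : R i a -> Ci i c -> commute a c.
  by move=> Ra [pc Uc]; exact: (perp_commute HG (lR i) Ra pc (nR _ _ Uc)).
have sN i : sgp (Ni i) by apply: sgpI; [case: (lR i)|case: (coV i)].
have sC i : sgp (Ci i) by apply: sgpI => //; exact: perp_sgp.
have NU i : Ni i `<=` U by move=> y [_ /VU].
have sNC i : sgp (NC i).
  split.
  - by exists 1, 1; split; [exact: (sgp1 (sN i))|exact: (sgp1 (sC i))|rewrite mulg1].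
  - move=> _ _ [n [c [Nn Cc ->]]] [n' [c' [Nn' Cc' ->]]].
    exists (n * n'), (c * c'); split; [exact: (sgpM (sN i))|exact: (sgpM (sC i))|].
    have [Rn' _] := Nn'.
    by rewrite -!mulgA; congr (_ * _); rewrite !mulgA (comm i n' c).
  - move=> _ [n [c [Nn Cc ->]]]; exists n^-1, c^-1; split; [exact: (sgpV (sN i))|exact: (sgpV (sC i))|].
    have [Rn _] := Nn; by rewrite (comm i n c)// invgM.
have cNC i : closed (NC i).
  apply: compact_closed; first exact: (ld_hausdorff HG).
  apply: compact_mulset.
    by rewrite /Ni setIC; apply: compact_closedI; [case: (coV i)|case: (lR i)].
  by rewrite /Ci setIC; apply: compact_closedI => //; have [_ ? _] := lnorm_perp HG (lR i).
have nNC i u : U u -> nz (NC i) u.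
  move=> Uu _ [n [c [[Rn Vn] [pc Uc] ->]]].
  exists (u * n * u^-1), (u * c * u^-1); split; rewrite ?group_normE//.
    by split; [exact: nR|exact: UV].
  split; last by apply: sgpM => //; [exact: sgpM|exact: sgpV].
  by apply: perp_nz => //; apply: nR => //; exact: sgpV.
pose N := \bigcap_i NC i.
have lN : lnorm N.
  split; [by apply: sgp_bigcap|by apply: closed_bigI|].
  by apply: filterS nU => u Uu; apply: nz_bigcap => i _; apply: nNC.
have NiN k : Ni k `<=` N.
  move=> y Ny i _; have [->|/eqP ki] := eqVneq i k.
    by exists y, 1; rewrite mulg1; split=> //; exact: (sgp1 (sC k)).
  exists 1, y; rewrite mul1g; split=> //; first exact: (sgp1 (sN i)).
  by split; [apply: (Rp i k) => //; case: Ny|exact: NU Ny].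
have [L [C [[sL sC' LN] nL _ cLC nLC]]] := ld_factor HG lN.
pose y := fix y n := if n is m.+1 then y m * x m else 1 : G.
have Uy n : U (y n) by elim: n => [|n IH] /=; [exact: sgp1|apply: sgpM].
have [n [m [nm [l [c [[Ll _] [Cc _] e]]]]]] := compact_pigeonhole cU Uy (nLC _ filterT).
(* [r] gathers the factors of index above [n], which all lie in [perp (R n)]. So the [R n]-component
   of the quotient of the two partial products is exactly [x n]. *)
have [r pr e'] : exists2 r, perp (R n) r & y m = y n * x n * r.
  elim: m nm {e} => // m IH; rewrite ltnS leq_eqVlt => /orP[/eqP <-|nm].
    by exists 1; [exact: (sgp1 (perp_sgp (R n)))|rewrite /= mulg1].
  have [r pr e'] := IH nm; exists (r * x m); last by rewrite /= e' mulgA.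
  apply: (sgpM (perp_sgp (R n)) pr).
  by apply: (Rp n m) => // mn; rewrite mn ltnn in nm.
move: e; rewrite e' !group_normE => e.
have [n' [m' [[Rn' Vn'] [pm' _] el]]] := LN _ Ll n I.
(* Near 1, [R n] lies in [N] and hence in [L], which commutes with [C]. *)
have pc : perp (R n) c.
  have [_ nV _] := coV n.
  apply: filterS2 nL nV => z h Vz Rz; apply/commute_sym/cLC => //.
  by apply: h; apply: (NiN n).
have sP := perp_sgp (R n).
have : n'^-1 * x n = 1.
  apply: (perp_dj HG (lR n)); split.
    by case: (lR n) => sR _ _; apply: sgpM => //; exact: sgpV.
  have -> : n'^-1 * x n = m' * c * r^-1.
    by apply: (@mulIg _ r); rewrite -mulgA e el !group_normE.
  by apply: (sgpM sP); [apply: (sgpM sP)|apply: (sgpV sP)].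
move=> /(congr1 (mul n')); rewrite !group_normE => e1.
by apply: (nVx n); rewrite e1.
Qed.

(** Serves both the algebra [invreg U] and its subalgebra [cl]. *)
Record sublat U (S : set (set G)) : Prop := SubLat {
  sl_inv : S `<=` invreg U;
  sl_I : forall R T, S R -> S T -> S (R `&` T);
  sl_perp : forall R, S R -> S (perp R) }.

Definition atom (S : set (set G)) A :=
  [/\ S A, A <> [set 1] & forall T, S T -> T `<=` A -> T <> [set 1] -> A `<=` T].

(** The second clause says that [R] is the join of [l], phrased by disjointness so that no join
    operation has to be introduced. *)
Definition decomposition (S : set (set G)) R l :=
  (forall A, A \in l -> atom S A /\ A `<=` R) /\
  (forall T, reg T -> (forall A, A \in l -> dj A T) -> dj R T).

(** An element without a decomposition properly contains another one. The successive differences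
    along such a descending chain would contradict [no_infinite_independent]. *)
Lemma atoms_exist U (S : set (set G)) R : co U -> sublat U S -> S R ->
  exists l, decomposition S R l.
Proof.
move=> coU [SU SI SP] SR0; apply: contrapT => nR0.
pose bad R := S R /\ ~ exists l, decomposition S R l.
have rS T : S T -> reg T by move=> /SU[].
have sS T : S T -> sgp T by move=> /rS[[]].
have step T : bad T -> exists T', [/\ bad T', T' `<=` T & T `&` perp T' <> [set 1]].
  move=> [ST nT].
  have T1 : T <> [set 1].
    by move=> e; apply: nT; exists [::]; split=> // X _ _; rewrite e => x [].
  have /existsNP[A /not_implyP[SA /not_implyP[AT /not_implyP[A1 nTA]]]] :
      ~ forall A, S A -> A `<=` T -> A <> [set 1] -> T `<=` A.
    move=> h; apply: nT; exists [:: T]; split=> [A|X _]; last by apply; rewrite mem_head.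
    by rewrite mem_seq1 => /eqP ->; split=> //; split.
  have SB : S (T `&` perp A) by apply: SI => //; apply: SP.
  have [bA|/not_andP[//|/contrapT[lA [lA1 lA2]]]] := pselect (bad A).
    exists A; split=> // e; apply: nTA; apply: (dj_sub HG (rS _ SA) (reg_lnorm (rS _ ST))).
    by move=> x; rewrite e.
  have [bB|/not_andP[//|/contrapT[lB [lB1 lB2]]]] := pselect (bad (T `&` perp A)).
    exists (T `&` perp A); split=> // e.
    have [x Ax x1] := sgp_nt (sS _ SA) A1; apply: x1.
    have : [set (1 : G)] x; last by [].
    rewrite -e; split; first exact: AT.
    apply: (dj_perp HG (reg_lnorm (rS _ SB)) (reg_lnorm (rS _ SA))) Ax.
    apply: djC; apply: (sub_dj HG (reg_lnorm (rS _ SA))); by move=> y [].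
  (* If both [A] and its complement in [T] were joins of atoms, [T] would be one as well. *)
  case: nT; exists (lA ++ lB); split=> [X|X rX h].
    rewrite mem_cat => /orP[/lA1[? h]|/lB1[? h]]; split=> // y /h; first exact: AT.
    by case.
  have d1 : dj A X by apply: lA2 => // Y hY; apply: h; rewrite mem_cat hY.
  have d2 : dj (T `&` perp A) X by apply: lB2 => // Y hY; apply: h; rewrite mem_cat hY orbT.
  move=> x [Tx Xx]; apply: d2; split=> //; split=> //.
  by apply: (dj_perp HG (reg_lnorm (rS _ SA)) (reg_lnorm rX)).
have /choice[f fP] T : exists T', bad T -> [/\ bad T', T' `<=` T & T `&` perp T' <> [set 1]].
  by have [/step[T' h]|nb] := pselect (bad T); [exists T'|exists T].
pose Q n := iter n f R.
have bQ n : bad (Q n) by elim: n => [//|n /fP[]].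
have Qs n : Q n.+1 `<=` Q n by have [] := fP _ (bQ n).
have Qle n m : (n <= m)%N -> Q m `<=` Q n.
  move=> nm; rewrite -(subnKC nm); elim: (m - n)%N => [|k IH]; first by rewrite addn0.
  by rewrite addnS; apply: subset_trans (Qs _) IH.
have SQ n : S (Q n) by case: (bQ n).
apply: (no_infinite_independent (R := fun n => Q n `&` perp (Q n.+1)) coU).
- by move=> i; apply: SU; apply: SI => //; apply: SP.
- by move=> i; have [] := fP _ (bQ i).
- have key i j : (i < j)%N -> dj (Q i `&` perp (Q i.+1)) (Q j `&` perp (Q j.+1)).
    move=> ij x [[_ px] [qx _]]; apply: (perp_dj HG (reg_lnorm (rS _ (SQ i.+1)))).
    by split=> //; apply: Qle ij _ qx.
  move=> i j /eqP; rewrite neq_ltn => /orP[/key//|/key/djC//].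
Qed.

Lemma sublat_invreg U : co U -> sublat U (invreg U).
Proof.
move=> [sU nU cU]; split=> //.
- move=> R T [rR nR] [rT nT]; split; first exact: regI.
  by move=> u Uu; apply: nzI; split; [apply: nR|apply: nT].
- move=> R [rR nR]; split; first exact: reg_perp (reg_lnorm rR).
  by move=> u Uu; apply: perp_nz; [apply: nR|apply: nR; apply: sgpV].
Qed.

Lemma atom_dj_eq U (S : set (set G)) A B : sublat U S -> atom S A -> atom S B ->
  ~ dj A B -> A = B.
Proof.
move=> [SU SI SP] [SA A1 hA] [SB B1 hB] nd.
have AB1 : A `&` B <> [set 1] by move=> e; apply: nd; rewrite /dj e.
apply/seteqP; split.
  by apply: subset_trans (hA _ (SI _ _ SA SB) _ AB1) _ => x [].
by apply: subset_trans (hB _ (SI _ _ SA SB) _ AB1) _ => x [].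
Qed.

End Atoms.

(** * Local isomorphisms and linked subgroups *)

Section CompactIso.
Implicit Types (G H K : topGroupType).

(* Continuity at the identity suffices, and compactness makes [f] open onto its image. *)
Definition ciso G H (A : set G) (B : set H) (f : G -> H) :=
  [/\ compact A, f @` A = B, forall x y, A x -> A y -> f (x * y) = f x * f y,
      forall x, A x -> f x = 1 -> x = 1
    & forall W, nbhs (1 : H) W -> nbhs (1 : G) [set x | A x -> W (f x)]].

Lemma ciso_f1 G H (A : set G) (B : set H) f : sgp A -> ciso A B f -> f 1 = 1.
Proof.
by move=> sA [_ _ fM _ _]; exact: hom1 sA fM.
Qed.
Lemma ciso_sgp G H (A : set G) (B : set H) f : sgp A -> ciso A B f -> sgp B.
Proof. by move=> sA [_ <- fM _ _]; exact: sgp_image. Qed.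

Lemma ciso_within G H (A : set G) (B : set H) f : sgp A -> ciso A B f ->
  {within A, continuous f}.
Proof.
move=> sA [cA fA fM fI fC].
have h : hom_on A B f by apply/hom_onP => //; split=> // x Ax; rewrite -fA; exists x.
by case: h.
Qed.

Lemma ciso_compact G H (A : set G) (B : set H) f : sgp A -> ciso A B f -> compact B.
Proof.
move=> sA cf; have := ciso_within sA cf; case: cf => cA <- _ _ _ fc.
exact: continuous_compact.
Qed.

(** The part of [A] outside the interior of [W] is compact, so its image is closed; by injectivity
    it misses 1. *)
Lemma ciso_open G H (A : set G) (B : set H) f W : hausdorff_space H -> sgp A -> ciso A B f ->
  nbhs (1 : G) W -> nbhs (1 : H) [set z | B z -> exists x, [/\ A x, W x & f x = z]].
Proof.
move=> hH sA cf nW; have fw := ciso_within sA cf; have [cA fA fM fI fC] := cf.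
have cD : compact (A `\` W°).
  by rewrite setDE; apply: compact_closedI => //; apply: open_closedC; exact: open_interior.
have cfD : closed (f @` (A `\` W°)).
  apply: compact_closed => //; apply: continuous_compact => //.
  by apply: continuous_subspaceW fw => x [].
have n1 : (~` (f @` (A `\` W°))) 1.
  move=> [x [Ax nx] /(fI _ Ax) x1]; apply: nx; rewrite x1.
  exact: nbhs_singleton (nbhs_interior nW).
apply: filterS (open_nbhs_nbhs (conj (closed_openC cfD) n1)) => z nz.
rewrite -fA => -[x Ax xz]; exists x; split=> //.
by apply: contrapT => nWx; apply: nz; exists x => //; split=> // /interior_subset.
Qed.

Lemma hom_inverse G H (A : set G) (B : set H) f : sgp A ->
  (forall x y, A x -> A y -> f (x * y) = f x * f y) -> (forall x, A x -> f x = 1 -> x = 1) ->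
  f @` A = B ->
  exists g, [/\ forall z, B z -> A (g z) /\ f (g z) = z, forall x, A x -> g (f x) = x &
    forall x y, B x -> B y -> g (x * y) = g x * g y].
Proof.
move=> sA fM fI fA; have /choice[g gP] z : exists x, B z -> A x /\ f x = z.
  have [|nB] := pselect (B z); last by exists 1.
  by rewrite -fA => -[x Ax <-]; exists x.
have gf x : A x -> g (f x) = x.
  by move=> Ax; have [|Ag e] := gP (f x); [rewrite -fA; exists x|apply: (hom_inj sA fM fI)].
exists g; split=> // x y Bx By; have [Ax ex] := gP _ Bx; have [Ay ey] := gP _ By.
by rewrite -{1}ex -{1}ey -fM// gf//; exact: sgpM.
Qed.

Lemma ciso_inv G H (A : set G) (B : set H) f : hausdorff_space H -> sgp A -> ciso A B f ->
  exists g, ciso B A g /\ (forall x, A x -> g (f x) = x).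
Proof.
move=> hH sA cf; have [cA fA fM fI fC] := cf.
have [g [gP gf gM]] := hom_inverse sA fM fI fA.
exists g; split=> //; split=> //.
- exact: ciso_compact cf.
- apply/seteqP; split=> [_ [z /gP[Ag _] <-] //|x Ax].
  by exists (f x); [rewrite -fA; exists x|exact: gf].
- by move=> x Bx g1; have [_ <-] := gP _ Bx; rewrite g1; exact: ciso_f1 cf.
- move=> W nW; apply: filterS (ciso_open hH sA cf nW) => z h /h [x [Ax Wx <-]].
  by rewrite /= gf.
Qed.

Lemma ciso_comp G H K (A : set G) (B : set H) (C : set K) f g :
  ciso A B f -> ciso B C g -> ciso A C (g \o f).
Proof.
move=> [cA fA fM fI fC] [cB gB gM gI gC].
have fB x : A x -> B (f x) by move=> Ax; rewrite -fA; exists x.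
split=> //.
- by rewrite -gB -fA image_comp.
- by move=> x y Ax Ay; rewrite /= fM// gM//; apply: fB.
- by move=> x Ax /gI => /(_ (fB _ Ax)); apply: fI.
- move=> W /gC /fC; apply: filterS => x h Ax; apply: h => //; exact: fB.
Qed.

Lemma ciso_restrict G H (A A' : set G) (B : set H) f : hausdorff_space G ->
  closed A' -> A' `<=` A -> ciso A B f -> ciso A' (f @` A') f.
Proof.
move=> hG cA' s [cA fA fM fI fC]; split=> //.
- exact: subclosed_compact cA s.
- by move=> x y /s Ax /s Ay; apply: fM.
- by move=> x /s; apply: fI.
- by move=> W /fC; apply: filterS => x h /s.
Qed.

End CompactIso.

Section Linked.
Variables (G : topGroupType) (HG : ldgroup G).
Implicit Types (A K R S T U V W N : set G) (x y g : G).
Let hG := ld_hausdorff HG.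

Definition linked R S := exists S1 S2 f,
  [/\ lnorm S1 /\ S1 `<=` R, lnorm S2 /\ S2 `<=` S, S1 <> [set 1] & ciso S1 S2 f].

Lemma linkedS R R' S S' : R `<=` R' -> S `<=` S' -> linked R S -> linked R' S'.
Proof.
move=> r s [S1 [S2 [f [[l1 s1] [l2 s2] n1 cf]]]]; exists S1, S2, f; split=> //.
- by split=> //; apply: subset_trans s1 r.
- by split=> //; apply: subset_trans s2 s.
Qed.

Lemma linked_sym R S : linked R S -> linked S R.
Proof.
move=> [S1 [S2 [f [[l1 s1] [l2 s2] n1 cf]]]].
have sS1 : sgp S1 by case: l1.
have [g [cg gf]] := ciso_inv hG sS1 cf.
exists S2, S1, g; split=> // S21; apply: n1; apply: sgp_triv => // x Sx.
have [_ fS _ fI _] := cf; apply: fI => //.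
by have : S2 (f x) by [rewrite -fS; exists x]; rewrite S21.
Qed.

(** By [lnorm_sub] only small elements of [S1] have to normalise the preimage, and their images are
    small enough to normalise [T]. *)
Lemma lnorm_preimage S1 S2 f T : lnorm S1 -> ciso S1 S2 f -> lnorm T -> T `<=` S2 ->
  lnorm (S1 `&` f @^-1` T) /\ ciso (S1 `&` f @^-1` T) T f.
Proof.
move=> lS cf lT TS; have [sS cS nS] := lS; have [sT cT nT] := lT.
have [g [cg gf]] := ciso_inv hG sS cf.
have [cA fA fM fI fC] := cf.
set N := S1 `&` _.
have sN : sgp N by exact: sgp_preimage.
have eN : g @` T = N.
  apply/seteqP; split=> [_ [z Tz <-]|x [Sx Tx]]; last by exists (f x) => //; exact: gf.
  have : S2 z by exact: TS.
  by rewrite -fA => -[x Sx xz]; rewrite -xz gf//; split=> //=; rewrite xz.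
have cN : closed N.
  rewrite -eN; apply: compact_closed => //.
  by apply: (@ciso_compact _ _ T _ g) => //; exact: ciso_restrict cg.
have eT : f @` N = T.
  apply/seteqP; split=> [_ [x [_ Tx] <-] //|z Tz]; exists (g z); first by rewrite -eN; exists z.
  have : S2 z by exact: TS.
  by rewrite -fA => -[x Sx <-]; rewrite gf.
have NS : N `<=` S1 by move=> x [].
have cN' : ciso N T f by have := ciso_restrict hG cN NS cf; rewrite eT.
split=> //; apply: (lnorm_sub HG lS) => //.
apply: filterS (fC _ nT) => r h Sr x [Sx Tx]; have Sr' := sgpV sS Sr.
have Sxr : S1 (r * x) by exact: sgpM.
split; first exact: sgpM.
by rewrite /= fM// fM// (homV sS fM)//; apply: h.
Qed.

Lemma linked_meet R S S1 S2 f T : lnorm S1 -> S1 `<=` R -> lnorm S2 -> S2 `<=` S ->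
  ciso S1 S2 f -> lnorm T -> ~ dj S2 T -> linked R (S `&` T).
Proof.
move=> l1 s1 l2 s2 cf lT nd.
have lT2 := lnormI l2 lT.
have [lN cN] := lnorm_preimage l1 cf lT2 (@subIsetl _ _ _).
exists (S1 `&` f @^-1` (S2 `&` T)), (S2 `&` T), f; split=> //.
- by split=> // x [/s1].
- by split=> // x [/s2].
- move=> e; apply: nd => y hy; have [_ eT _ _ _] := cN.
  move: hy; rewrite -eT e => -[x -> <-].
  by rewrite /= (ciso_f1 _ cf)//; case: l1.
Qed.

(* A local isomorphism cannot carry a nontrivial piece of [R] out of [R]: this makes
   [R] characteristic in every locally normal subgroup containing it. *)
Definition cl R := reg R /\ ~ linked R (perp R).

Lemma cl_perp R : cl R -> cl (perp R).
Proof.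
move=> [rR h]; split; first exact: reg_perp (reg_lnorm rR).
by rewrite (regE HG rR) => /linked_sym.
Qed.

Lemma dj_join R T S : lnorm R -> lnorm T -> lnorm S -> S `<=` perp (R `&` T) -> 
  reg R -> reg T -> dj S (perp R) -> dj S (perp T) -> S `<=` [set 1].
Proof.
move=> lR lT lS h rR rT d1 d2 x Sx.
apply: (perp_dj HG (lnormI lR lT)); split; last exact: h.
by split; [exact: (dj_sub HG rR lS d1)|exact: (dj_sub HG rT lS d2)].
Qed.

(** The image of a link out of the meet has a nontrivial part in [perp R] or in [perp T], since
    otherwise it would lie in the meet itself. Either case is excluded by hypothesis. *)
Lemma cl_I R T : cl R -> cl T -> cl (R `&` T).
Proof.
move=> [rR hR] [rT hT]; split; first exact: regI.
move=> [S1 [S2 [f [[l1 s1] [l2 s2] n1 cf]]]].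
have lR := reg_lnorm rR; have lT := reg_lnorm rT.
have [d1|nd] := pselect (dj S2 (perp R)); last first.
  apply: hR; apply: linkedS (linked_meet l1 s1 l2 s2 cf (lnorm_perp HG lR) nd); first by move=> x [].
  by move=> x [].
have [d2|nd] := pselect (dj S2 (perp T)); last first.
  apply: hT; apply: linkedS (linked_meet l1 s1 l2 s2 cf (lnorm_perp HG lT) nd); first by move=> x [].
  by move=> x [].
have S21 := dj_join lR lT l2 s2 rR rT d1 d2.
apply: n1; have [sS _ _] := l1; apply: sgp_triv => // x Sx.
have [_ fS _ fI _] := cf; apply: fI => //.
by apply: S21; rewrite -fS; exists x.
Qed.

Lemma ciso_cj g (A : set G) : compact A -> ciso A (cj g A) (fun x => g * x * g^-1).
Proof.
move=> cA; split=> //.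
- apply/seteqP; split=> [_ [x Ax <-]|x Ax]; first by rewrite /cj/= !group_normE.
  by exists (g^-1 * x * g) => //; rewrite !group_normE.
- by move=> x y _ _; rewrite !group_normE.
- move=> x _ e; apply: (@mulgI _ g); apply: (@mulIg _ g^-1); rewrite e !group_normE//.
- move=> W nW; apply: filterS (nbhs1_cj g^-1 nW) => x; rewrite /cj/= !group_normE => h _//.
Qed.

(** Conjugation by any [g], near 1 or not, is a local isomorphism. If it moved [R], the part of
    [g R g^-1] in [perp R] would be linked to a part of [R]. *)
Lemma cl_nz R g : cl R -> nz R g.
Proof.
move=> [rR hR]; apply: contrapT => ng.
have lR := reg_lnorm rR.
have nd : ~ dj (cj g R) (perp R).
  move=> d; apply: ng => x Rx; apply: (dj_sub HG rR (lnorm_cj g lR) d).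
  by rewrite /cj/= !group_normE.
have [S [lS cS SR _ nS]] := compact_open_lnormI HG (lnormI (lnorm_cj g lR) (lnorm_perp HG lR)) filterT.
apply: hR; exists (cj g^-1 S), S, (fun x => g * x * g^-1); split.
- split; first exact: lnorm_cj.
  by move=> x /SR [+ _]; rewrite /cj/= !group_normE.
- by split=> // x /SR[].
- move=> e; apply: nd; apply: (discrete_lnorm HG).
    exact: lnormI (lnorm_cj g lR) (lnorm_perp HG lR).
  apply: filterS nS => x h /h; rewrite -[S](cjVK g) e cj_set1//.
- by have := ciso_cj g (@compact_cj _ g^-1 S cS); rewrite cjVK.
Qed.

Lemma cl_T : cl [set: G].
Proof.
split; first exact: reg_T.
move=> [S1 [S2 [f [[l1 s1] [l2 s2] n1 cf]]]]; apply: n1.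
have [sS _ _] := l1; apply: sgp_triv => // x Sx.
have [_ fS _ fI _] := cf; apply: fI => //.
have : S2 (f x) by rewrite -fS; exists x.
by move=> /s2; rewrite (perp_T HG).
Qed.

Lemma sublat_cl U : co U -> sublat U cl.
Proof.
move=> coU; split.
- by move=> R cR; split; [case: cR|move=> u _; exact: cl_nz].
- exact: cl_I.
- exact: cl_perp.
Qed.

End Linked.

(** * Local powers *)

Section Boxes.
Variables (I : finType).
Implicit Types (G H : topGroupType).

(** The counterpart of [box] over an arbitrary finite index type, so that sums and tagged sums can
    index powers. *)
Definition boxI G (M : I -> set G) : set {ptws I -> G} := [set f | forall i, M i (f i)].

Lemma ptws_mulE G (f g : {ptws I -> G}) i : (f * g) i = f i * g i. Proof. by []. Qed.
Lemma ptws_invE G (f : {ptws I -> G}) i : f^-1 i = (f i)^-1. Proof. by []. Qed.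
Lemma ptwsP G (f g : {ptws I -> G}) : (forall i, f i = g i) -> f = g.
Proof. by move=> h; apply/funext. Qed.

Lemma sgp_boxI G (M : I -> set G) : (forall i, sgp (M i)) -> sgp (boxI M).
Proof.
move=> sM; split; first by move=> i; exact: sgp1.
- by move=> x y hx hy i; apply: (sgpM (sM i)).
- by move=> x hx i; apply: (sgpV (sM i)).
Qed.

Lemma ptws_nbhs1P G (W : set {ptws I -> G}) : nbhs (1 : {ptws I -> G}) W <->
  exists2 V, nbhs (1 : G) V & boxI (fun=> V) `<=` W.
Proof.
split=> [nW|[V nV VW]]; last first.
  apply: (filterS VW); rewrite /boxI.
  have : forall i : I, \forall f \near (1 : {ptws I -> G}), V (f i).
    by move=> i; apply: (@proj_continuous I (fun=> G) i (1 : {ptws I -> G})).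
  exact: (@filter_forall _ I (fun i => [set f : {ptws I -> G} | V (f i)]) (nbhs (1 : {ptws I -> G})) _).
pose F := filter_from (nbhs (1 : G)) (fun V => boxI (fun=> V)).
suff : F --> (1 : {ptws I -> G}) by move=> /(_ _ nW) [V nV VW]; exists V.
have FF : Filter F.
  apply: filter_from_filter; first by exists setT; exact: filterT.
  move=> V V' nV nV'; exists (V `&` V'); first exact: filterI.
  by move=> f h; split=> i; case: (h i).
apply/cvg_sup => i A [_ [[B Bop <-] Bfx sBA]].
exists B; first exact: open_nbhs_nbhs.
by move=> f h; apply: sBA; exact: h.
Qed.

Lemma nbhs_boxI G (V : set G) : nbhs (1 : G) V ->
  nbhs (1 : {ptws I -> G}) (boxI (fun=> V)).
Proof. by move=> nV; apply/ptws_nbhs1P; exists V. Qed.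

Lemma closed_boxI G (M : I -> set G) : (forall i, closed (M i)) -> closed (boxI M).
Proof.
move=> cM; have -> : boxI M = \bigcap_i ((@proj I (fun=> G) i) @^-1` M i).
  by apply/seteqP; split=> f h; [move=> i _; apply: h|move=> i; apply: (h i Logic.I)].
apply: closed_bigI => i _; apply: preimage_closed => [x _|]; last exact: cM.
exact: proj_continuous.
Qed.

Lemma compact_boxI G (M : I -> set G) : (forall i, compact (M i)) -> compact (boxI M).
Proof. exact: tychonoff. Qed.

End Boxes.

Section LocalEmb.
Implicit Types (G H K : topGroupType).

(** An isomorphism of [Y] onto an open subgroup of [B], with all topology stated at 1. In contrast
    to [ciso], openness is part of the data, since [Y] need not be compact. *)
Definition lemb G H (Y : set G) (f : G -> H) (B : set H) :=
  [/\ forall x y, Y x -> Y y -> f (x * y) = f x * f y,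
      forall x, Y x -> B (f x), forall x, Y x -> f x = 1 -> x = 1,
      forall W, nbhs (1 : H) W -> nbhs (1 : G) [set x | Y x -> W (f x)]
    & forall W, nbhs (1 : G) W ->
        nbhs (1 : H) [set z | B z -> exists x, [/\ Y x, W x & f x = z]]].

Lemma lemb_shrink G H (Y Y' : set G) (f : G -> H) B : lemb Y f B -> Y' `<=` Y ->
  nbhs (1 : G) [set x | Y x -> Y' x] -> lemb Y' f B.
Proof.
move=> [fM fB fI fC fO] s n; split.
- by move=> x y /s ? /s ?; apply: fM.
- by move=> x /s; apply: fB.
- by move=> x /s; apply: fI.
- by move=> W /fC; apply: filterS => x h /s.
- move=> W nW; apply: filterS (fO _ (filterI nW n)) => z h /h [x [Yx [Wx hx] <-]].
  by exists x; split=> //; exact: hx.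
Qed.

Lemma lemb_codom G H (Y : set G) (f : G -> H) (B B' : set H) : lemb Y f B ->
  (forall x, Y x -> B' (f x)) -> nbhs (1 : H) [set z | B' z -> B z] -> lemb Y f B'.
Proof.
move=> [fM fB fI fC fO] s n; split=> // W nW.
by apply: filterS2 (fO _ nW) n => z h h' /h' /h.
Qed.

Lemma lemb_comp G H K (Y : set G) (A : set H) (B : set K) f g :
  lemb Y f A -> lemb A g B -> lemb Y (g \o f) B.
Proof.
move=> [fM fB fI fC fO] [gM gB gI gC gO]; split.
- by move=> x y Yx Yy; rewrite /= fM// gM//; apply: fB.
- by move=> x /fB /gB.
- by move=> x Yx /gI => /(_ (fB _ Yx)); apply: fI.
- by move=> W /gC /fC; apply: filterS => x h Yx; apply: h => //; exact: fB.
- move=> W /fO /gO; apply: filterS => z h /h [y [Ay Wy <-]].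
  by have [x [Yx Wx <-]] := Wy Ay; exists x.
Qed.

Lemma lemb_id G (A B : set G) : A `<=` B -> nbhs (1 : G) [set x | B x -> A x] ->
  lemb A id B.
Proof.
move=> AB n; split=> //; first by move=> W; apply: filterS => x Wx _.
by move=> W nW; apply: filterS2 nW n => x Wx h /h Ax; exists x.
Qed.

Lemma ciso_lemb G H (A : set G) (B : set H) f : hausdorff_space H -> sgp A ->
  ciso A B f -> lemb A f B.
Proof.
move=> hH sA cf; have fO := ciso_open hH sA cf; case: (cf) => cA fA fM fI fC; split=> //.
by move=> x Ax; rewrite -fA; exists x.
Qed.

Lemma lemb_box (I : finType) G H (Y : set G) (f : G -> H) B : lemb Y f B ->
  lemb (boxI (fun _ : I => Y)) (fun y : {ptws I -> G} => (fun i => f (y i)) : {ptws I -> H})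
    (boxI (fun _ : I => B)).
Proof.
move=> [fM fB fI fC fO]; split.
- by move=> x y Yx Yy; apply: ptwsP => i; rewrite ptws_mulE fM.
- by move=> x Yx i; apply: fB.
- move=> x Yx e; apply: ptwsP => i; apply: fI; first exact: Yx.
  by have := congr1 (fun g : {ptws I -> H} => g i) e.
- move=> W /ptws_nbhs1P[V nV VW]; apply/ptws_nbhs1P; exists [set x | Y x -> V (f x)].
    exact: fC.
  by move=> x h Yx; apply: VW => i; exact: h.
- move=> W /ptws_nbhs1P[V nV VW]; apply/ptws_nbhs1P.
  exists [set z | B z -> exists x, [/\ Y x, V x & f x = z]]; first exact: fO.
  move=> z h Bz; have /choice[x xP] i := h i (Bz i).
  exists (x : {ptws I -> G}); split; [by move=> i; case: (xP i)| |].
    by apply: VW => i; case: (xP i).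
  by apply: ptwsP => i; case: (xP i).
Qed.

End LocalEmb.

Section Powers.
Variables (G : topGroupType) (HG : ldgroup G).
Implicit Types (H : topGroupType) (eps R S V W : set G).

(* [A] is locally isomorphic to a finite power of [eps]. *)
Definition pw eps (I : finType) H (A : set H) :=
  exists V (f : {ptws I -> G} -> H),
    [/\ sgp V, nbhs (1 : G) V & lemb (boxI (fun _ : I => eps `&` V)) f A].

Lemma nbhs_box_shrink (I : finType) eps V V' : nbhs (1 : G) V' ->
  nbhs (1 : {ptws I -> G})
    [set x | boxI (fun _ : I => eps `&` V) x -> boxI (fun _ : I => eps `&` V') x].
Proof.
move=> nV'; apply/ptws_nbhs1P; exists V' => // x h1 h2 i; split; last exact: h1.
by case: (h2 i).
Qed.

Lemma lemb_box_shrink (I : finType) eps V V' H f (A : set H) : nbhs (1 : G) V' ->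
  V' `<=` V -> lemb (boxI (fun _ : I => eps `&` V)) f A ->
  lemb (boxI (fun _ : I => eps `&` V')) f A.
Proof.
move=> nV' s h; apply: lemb_shrink h _ _.
- by move=> x hx i; case: (hx i) => ? /s.
- exact: nbhs_box_shrink.
Qed.

Lemma pw_small eps (I : finType) H (A : set H) (Q : set H) W : pw eps I A ->
  nbhs (1 : H) Q -> nbhs (1 : G) W ->
  exists V (f : {ptws I -> G} -> H), [/\ co V, V `<=` W,
    lemb (boxI (fun _ : I => eps `&` V)) f A &
    forall x, boxI (fun _ : I => eps `&` V) x -> Q (f x)].
Proof.
move=> [V [f [sV nV hf]]] nQ nW; have [fM fB fI fC fO] := hf.
have /ptws_nbhs1P [V1 nV1 V1Q] := fC _ nQ.
have [V' [sV' nV' cV' Vs]] := ld_base HG (filterI (filterI nV nV1) nW).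
exists V', f; split=> //; first by move=> x /Vs[].
  by apply: lemb_box_shrink hf => // x /Vs[[]].
move=> x hx; apply: V1Q => i; first by case: (hx i) => _ /Vs[[]].
by case: (hx i) => e /Vs[[]].
Qed.

Lemma pw_comp eps (I : finType) H (K : topGroupType) (A A' : set H) (B : set K) (g : H -> K) : pw eps I A ->
  nbhs (1 : H) [set z | A z -> A' z] -> nbhs (1 : H) [set z | A' z -> A z] ->
  lemb A' g B -> pw eps I B.
Proof.
move=> pA n1 n2 hg; have [V [f [[sV nV _] _ hf fQ]]] := pw_small pA n1 filterT.
exists V, (g \o f); split=> //; apply: (lemb_comp _ hg).
apply: (lemb_codom hf _ n2) => x hx; apply: fQ => //.
by case: hf => _ fB _ _ _; apply: fB.
Qed.

Lemma pw_near eps (I : finType) H (A A' : set H) : pw eps I A ->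
  nbhs (1 : H) [set z | A z -> A' z] -> nbhs (1 : H) [set z | A' z -> A z] ->
  pw eps I A'.
Proof.
move=> pA n1 n2; apply: pw_comp pA n1 n2 (lemb_id _ _) => //.
by apply: filterS filterT => x _.
Qed.

Lemma pw_void eps H (A : set H) : nbhs (1 : H) [set z | A z -> z = 1] -> A 1 ->
  pw eps void A.
Proof.
move=> n A1; exists setT, (fun=> 1); split=> //; first exact: filterT.
split=> //; first by move=> x y _ _; rewrite mulg1.
- by move=> x _ _; apply: ptwsP; case.
- by move=> W /nbhs_singleton W1; apply: filterS filterT => x _ _.
- move=> W nW; apply: filterS n => z h /h ->; exists 1; split=> //.
  exact: nbhs_singleton.
Qed.

Lemma pw_unit eps : pw eps unit eps.
Proof.
exists setT, (fun y => y tt); split=> //; first exact: filterT.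
split=> //.
- by move=> x hx; case: (hx tt).
- by move=> x _ e; apply: ptwsP; case.
- move=> W nW; apply: filterS (nbhs_boxI _ nW) => x h _; exact: h.
- move=> W /ptws_nbhs1P[V nV VW]; apply: filterS nV => z Vz ez.
  by exists ((fun=> z) : {ptws unit -> G}); split=> //; apply: VW.
Qed.

Lemma pw_join eps (I J : finType) R S T : lnorm S -> lnorm T -> dj S T ->
  S `<=` R -> T `<=` R -> sgp R ->
  (forall W, nbhs (1 : G) W -> nbhs (1 : G)
     [set x | R x -> exists s t, [/\ S s /\ W s, T t /\ W t & x = s * t]]) ->
  pw eps I S -> pw eps J T -> pw eps (I + J)%type R.
Proof.
move=> lS lT dST SR TR sR nR pS pT; have [sS _ nS] := lS; have [sT _ nT] := lT.
have [V1 [f [[sV1 nV1 _] _ hf fQ]]] := pw_small pS filterT filterT.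
(* The values of [g] are made to normalise [S], so that [perp_commute] makes them commute with the
   values of [f]. *)
have [V [g [[sV nV _] VV1 hg gQ]]] := pw_small pT nS nV1.
have {}hf := lemb_box_shrink nV VV1 hf.
have [fM fB fI fC fO] := hf; have [gM gB gI gC gO] := hg.
pose l (y : {ptws (I + J)%type -> G}) : {ptws I -> G} := fun i => y (inl i).
pose r (y : {ptws (I + J)%type -> G}) : {ptws J -> G} := fun i => y (inr i).
pose BI := boxI (fun _ : I => eps `&` V); pose BJ := boxI (fun _ : J => eps `&` V).
have lB y : boxI (fun=> eps `&` V) y -> BI (l y) by move=> h i; apply: h.
have rB y : boxI (fun=> eps `&` V) y -> BJ (r y) by move=> h i; apply: h.
have ST := dj_perp HG lS lT dST.
have comm x z : BI x -> BJ z -> commute (f x) (g z).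
  by move=> Bx Bz; apply: (perp_commute HG lS (fB _ Bx) (ST _ (gB _ Bz))); exact: gQ.
exists V, (fun y => f (l y) * g (r y)); split=> //; split.
- move=> x y hx hy; have -> : l (x * y) = l x * l y by [].
  have -> : r (x * y) = r x * r y by [].
  rewrite fM ?gM; [|exact: rB|exact: rB|exact: lB|exact: lB].
  rewrite -!mulgA; congr (_ * _); rewrite !mulgA; congr (_ * _).
  by apply: comm; [exact: lB|exact: rB].
- by move=> x hx; apply: (sgpM sR); [apply/SR/fB/lB|apply/TR/gB/rB].
- move=> x hx e.
  have e1 : f (l x) = (g (r x))^-1 by apply: (@mulIg _ (g (r x))); rewrite e mulVg.
  have f1 : f (l x) = 1.
    by apply: dST; split; [exact/fB/lB|rewrite e1; exact/(sgpV sT)/gB/rB].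
  have g1 : g (r x) = 1 by move: e; rewrite f1 mul1g.
  have l1 := fI _ (lB _ hx) f1; have r1 := gI _ (rB _ hx) g1.
  apply: ptwsP => -[i|j].
    by have := congr1 (fun h : {ptws I -> G} => h i) l1.
  by have := congr1 (fun h : {ptws J -> G} => h j) r1.
- move=> W nW; have [W' nW' WW'] := nbhs1_div nW.
  have /ptws_nbhs1P [A nA Af] := fC _ nW'.
  have /ptws_nbhs1P [B nB Bg] := gC _ (nbhs1V nW').
  apply/ptws_nbhs1P; exists (A `&` B); first exact: filterI.
  move=> x h hx; rewrite -[g _]invgK; apply: WW'.
    by apply: Af; [move=> i; case: (h (inl i))|exact: lB].
  by apply: Bg; [move=> i; case: (h (inr i))|exact: rB].
- move=> W /ptws_nbhs1P[W' nW' WW'].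
  have n1 := fO _ (nbhs_boxI _ nW'); have n2 := gO _ (nbhs_boxI _ nW').
  apply: filterS (nR _ (filterI n1 n2)) => z h /h [s [t [[Ss [hs _]] [Tt [_ ht]] ->]]].
  have [x [Bx Wx <-]] := hs Ss; have [y [By Wy <-]] := ht Tt.
  exists ((fun k => match k with inl i => x i | inr j => y j end) : {ptws (I + J)%type -> G}).
  by split=> //; [case=> i; [exact: Bx|exact: By]|apply: WW'; case=> i; [exact: Wx|exact: Wy]].
Qed.

Definition pow eps H (A : set H) := exists I : finType, pw eps I A.

(** Induction on the atoms: locally [R] is the product of the first atom [A] and the meet of [R]
    with [perp A], which is the join of the others. *)
Lemma pow_join_list eps (S : set (set G)) U R l : co U -> sublat U S -> uniq l ->
  (forall A, A \in l -> [/\ atom S A, A `<=` R & pow eps A]) -> reg R ->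
  (forall T, reg T -> (forall A, A \in l -> dj A T) -> dj R T) -> pow eps R.
Proof.
move=> coU sl; elim: l R => [|A l IH] R.
  move=> _ _ rR h; exists void; have [sR _ _] := reg_lnorm rR.
  apply: pw_void; last exact: sgp1.
  apply: filterS filterT => z _ Rz; have := h R rR; apply => //.
move=> /= /andP[Al ul] lA rR cov.
have [atA AR [I pA]] := lA A (mem_head _ _).
have lAl B : B \in l -> B \in A :: l by rewrite inE orbC => ->.
have rA : reg A by have [SA _ _] := atA; have [] := sl_inv sl SA.
have lnA := reg_lnorm rA.
have rA' := reg_perp HG lnA.
have rR' : reg (R `&` perp A) by apply: regI.
have dA B : B \in l -> dj A B.
  move=> Bl; apply: contrapT => nd; have [atB _ _] := lA B (lAl _ Bl).
  by move: Al; rewrite (atom_dj_eq sl atA atB nd) Bl.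
have rB B : B \in l -> reg B.
  by move=> Bl; have [[SB _ _] _ _] := lA B (lAl _ Bl); have [] := sl_inv sl SB.
have [||J pJ] := IH (R `&` perp A) ul _ rR'.
- move=> B Bl; have [atB BR pB] := lA B (lAl _ Bl); split=> // x Bx; split; first exact: BR.
  exact: (dj_perp HG lnA (reg_lnorm (rB _ Bl)) (dA _ Bl)).
- move=> T rT dT x [[Rx px] Tx]; apply: (cov (T `&` perp A)); last by split.
    exact: regI.
  move=> B; rewrite inE => /orP[/eqP -> y [Ay [_ py]]|Bl]; first by apply: (perp_dj HG lnA).
  by move=> y [By [Ty _]]; apply: (dT _ Bl).
exists (I + J)%type.
apply: (pw_join lnA (reg_lnorm rR') _ AR _ _ _ pA pJ).
- by move=> y [Ay [_ py]]; apply: (perp_dj HG lnA).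
- by move=> y [].
- by case: rR => -[].
- move=> W nW; apply: filterS (perp_mul_near HG lnA nW) => x [a [p [[Aa Wa] [pp Wp] e]]] Rx.
  exists a, p; split=> //; split=> //; split=> //.
  have sR : sgp R by case: rR => -[].
  by apply: (sgpMl sR (AR _ Aa)); rewrite -e.
Qed.

End Powers.

Lemma closed_preimage (G H : topologicalType) (A : set G) (B : set H) (f : G -> H) :
  {within A, continuous f} -> closed A -> closed B -> closed (A `&` f @^-1` B).
Proof.
move=> fc cA cB.
have h : closed (f @^-1` B : set (subspace A)).
  by apply: (@preimage_closed (subspace A) H) => // x _; exact: fc.
have [C cC e] := (closed_subspaceP _ _).1 h.
by rewrite setIC -e; exact: closedI.
Qed.

Section Single.
Variable I : finType.
Implicit Types (G H : topGroupType).

Definition single G (i : I) (x : G) : {ptws I -> G} := fun j => if j == i then x else 1.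

Lemma single_box G (A : I -> set G) i x : (forall j, A j 1) -> A i x -> boxI A (single i x).
Proof. by move=> A1 Ax j; rewrite /single; case: eqP => [->|]. Qed.
Lemma singleM G i (x y : G) : single i (x * y) = single i x * single i y.
Proof. by apply: ptwsP => j; rewrite ptws_mulE /single; case: ifP; rewrite ?mulg1. Qed.
Lemma single1 G i : single i (1 : G) = 1.
Proof. by apply: ptwsP => j; rewrite /single; case: ifP. Qed.
Lemma singleV G i (x : G) : single i x^-1 = (single i x)^-1.
Proof. by apply: (@mulgI _ (single i x)); rewrite mulgV -singleM mulgV single1. Qed.
Lemma single_i G i (x : G) : single i x i = x.
Proof. by rewrite /single eqxx. Qed.
Lemma single_near G i (W : set {ptws I -> G}) : nbhs (1 : {ptws I -> G}) W ->
  nbhs (1 : G) [set x | W (single i x)].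
Proof.
move=> /ptws_nbhs1P[V nV VW]; have V1 := nbhs_singleton nV.
by apply: filterS nV => x Vx; apply: VW; apply: single_box.
Qed.
Lemma single_conj G i (f : {ptws I -> G}) x : f * single i x * f^-1 = single i (f i * x * (f i)^-1).
Proof.
apply: ptwsP => j; rewrite !ptws_mulE ptws_invE /single; case: eqP => [->|_] //.
by rewrite mulg1 mulgV.
Qed.

Lemma single_prod G (K : set {ptws I -> G}) f : sgp K ->
  (forall i, K (single i (f i))) -> K f.
Proof.
move=> sK h.
pose z (l : seq I) : {ptws I -> G} := fun i => if i \in l then f i else 1.
have hz l : uniq l -> K (z l).
  elim: l => [_|i l IH /= /andP[il ul]].
    have -> : z [::] = 1 by apply: ptwsP => i.
    exact: (sgp1 sK).
  have -> : z (i :: l) = single i (f i) * z l.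
    apply: ptwsP => j; rewrite ptws_mulE /z /single inE; case: eqP => [->|_] /=.
      by rewrite (negbTE il) mulg1.
    by rewrite mul1g.
  exact: (sgpM sK (h i) (IH ul)).
have -> : f = z (enum I) by apply: ptwsP => i; rewrite /z mem_enum.
exact/hz/enum_uniq.
Qed.

End Single.

(** * Tilings of an atom *)

Lemma filter_seq (T : Type) (X : eqType) (F : set_system T) (P : X -> set T) (l : seq X) :
  Filter F -> (forall A, A \in l -> F (P A)) -> F [set g | forall A, A \in l -> P A g].
Proof.
move=> FF; elim: l => [|A l IH] h; first by apply: filterS filterT => g _ A.
have h1 := h A (mem_head _ _).
have h2 : F [set g | forall A, A \in l -> P A g].
  by apply: IH => B Bl; apply: h; rewrite inE Bl orbT.
by apply: filterS2 h1 h2 => g gA gl B; rewrite inE => /orP[/eqP -> //|/gl].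
Qed.

Section Tiling.
Variables (G : topGroupType) (HG : ldgroup G).
Implicit Types (A B K R S T U V W N D E : set G) (x y g u : G) (l : seq (set G)).
Let hG := ld_hausdorff HG.

(** The two links compose on the part where [S2] and [P1] meet; pulling it back along both gives
    locally normal ends. *)
Lemma linked_trans R S1 S2 f P1 P2 (g : G -> G) Q : lnorm S1 -> S1 `<=` R -> lnorm S2 -> ciso S1 S2 f ->
  lnorm P1 -> lnorm P2 -> P2 `<=` Q -> ciso P1 P2 g -> ~ dj S2 P1 -> linked R Q.
Proof.
move=> l1 s1 l2 cf lP1 lP2 s2 cg nd.
have lX := lnormI l2 lP1.
have [lN cN] := lnorm_preimage HG l1 cf lX (@subIsetl _ _ _).
have sP1 : sgp P1 by case: lP1.
have [h [ch hg]] := ciso_inv hG sP1 cg.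
have [lN' cN'] := lnorm_preimage HG lP2 ch lX (@subIsetr _ _ _).
have sN' : sgp (P2 `&` h @^-1` (S2 `&` P1)) by case: lN'.
have [k [ck _]] := ciso_inv hG sN' cN'.
exists (S1 `&` f @^-1` (S2 `&` P1)), (P2 `&` h @^-1` (S2 `&` P1)), (k \o f); split.
- by split=> // x [/s1].
- by split=> // x [/s2].
- move=> e; apply: nd => y hy; have [_ eT _ _ _] := cN.
  move: hy; rewrite -eT e => -[x -> <-].
  by rewrite /= (ciso_f1 _ cf)//; case: l1.
- exact: ciso_comp cN ck.
Qed.

Lemma linked_refl R : lnorm R -> R <> [set 1] -> linked R R.
Proof.
move=> lR R1; have [S [lS cS SR _ nS]] := compact_open_lnormI HG lR filterT.
exists S, S, id; split=> //.
  move=> e; apply: R1; have [sR _ _] := lR; apply: sgp_triv => // x Rx.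
  apply: (discrete_lnorm HG lR) => //; apply: filterS nS => z h /h; by rewrite e.
split=> //; first by rewrite image_id.
by move=> W; apply: filterS => x Wx _.
Qed.

Section Conj.
Variables (U V : set G).
Hypotheses (coU : co U) (coV : co V) (VU : V `<=` U) (nV : forall u, U u -> nz V u).

Lemma invreg_cj u R : U u -> invreg V R -> invreg V (cj u R).
Proof.
move=> Uu [rR nR]; split; first exact: reg_cj.
have [sU _ _] := coU.
move=> v Vv; apply: cj_nzE; apply: nR.
by have := nV (sgpV sU Uu) Vv; rewrite invgK.
Qed.

Lemma atom_cj u A : U u -> atom (invreg V) A -> atom (invreg V) (cj u A).
Proof.
move=> Uu [iA A1 hA]; have [sU _ _] := coU; have Uu' := sgpV sU Uu; split.
- exact: invreg_cj.
- by move=> e; apply: A1; rewrite -(cjK u A) e cj_set1.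
- move=> T iT TA T1; rewrite -(cjVK u T); apply: cjS; apply: hA.
  + exact: invreg_cj.
  + by rewrite -(cjK u A); apply: cjS.
  + by move=> e; apply: T1; rewrite -(cjVK u T) e cj_set1.
Qed.

(* The largest part of [D] disjoint from all [U]-conjugates of [A]; it is
   [U]-invariant, so it is trivial when [D] is an atom that [A] meets. *)
Definition away D A := D `&` \bigcap_(u in U) perp (cj u A).

Lemma invreg_away D A : invreg U D -> lnorm A -> invreg U (away D A).
Proof.
move=> [rD nD] lA; have [sU nU _] := coU.
have nB u : U u -> nz (\bigcap_(u in U) perp (cj u A)) u.
  move=> Uu x hx v Vv; have Uv : U (u^-1 * v) by apply: sgpM => //; exact: sgpV.
  have := hx _ Uv; rewrite cjM perp_cj /cj/= !group_normE.
  by [].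
split; last by move=> u Uu; apply: nzI; split; [exact: nD|exact: nB].
apply: regI => //; apply: reg_bigcap.
  by move=> u _; apply: (reg_perp HG); apply: lnorm_cj.
by apply: filterS nU => u; exact: nB.
Qed.

Lemma away_atom D A T : atom (invreg U) D -> lnorm A -> A `<=` D -> A <> [set 1] ->
  lnorm T -> T `<=` D -> (forall u, U u -> dj (cj u A) T) -> T `<=` [set 1].
Proof.
move=> [iD D1 hD] lA AD A1 lT TD h x Tx; apply: contrapT => x1.
have [sU _ _] := coU.
have [|y Ay y1] := sgp_nt _ A1; first by case: lA.
have iX := invreg_away iD lA.
have X1 : away D A <> [set 1].
  move=> e; apply: x1; have : away D A x; last by rewrite e.
  split; first exact: TD.
  move=> u Uu; exact: (dj_perp HG (lnorm_cj u lA) lT (h _ Uu)).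
have DX := hD _ iX (@subIsetl _ _ _) X1.
apply: y1; apply: (perp_dj HG lA); split=> //.
by have [_ /(_ 1 (sgp1 sU))] := DX _ (AD _ Ay); rewrite cj1.
Qed.

(** By [away_atom] some [U]-conjugate of [A] meets [B]; as [V] is normal in [U] it is again a
    [V]-atom, and atoms that meet coincide. *)
Lemma atoms_conj D A B : atom (invreg U) D -> atom (invreg V) A -> atom (invreg V) B ->
  A `<=` D -> B `<=` D -> exists2 u, U u & B = cj u A.
Proof.
move=> aD aA aB AD BD; apply: contrapT => nex.
have [[rA _] A1 _] := aA; have [[rB _] B1 _] := aB.
apply: B1; apply: sgp_triv; first by case: rB => -[].
apply: (away_atom aD (reg_lnorm rA) AD A1 (reg_lnorm rB) BD) => u Uu.
apply: contrapT => nd; apply: nex; exists u => //.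
by apply/esym; apply: (atom_dj_eq (sublat_invreg HG coV) _ aB nd); apply: atom_cj.
Qed.

(** An element of [U] either stabilizes [E], and then fixes [K], or moves [E] to a disjoint atom. So
    every conjugate of [K] is disjoint from the complement of [K] in [E], which must then be
    trivial. *)
Lemma atom_irreducible D E K : atom (invreg U) D -> atom (invreg V) E -> E `<=` D ->
  lnorm K -> K `<=` E -> K <> [set 1] ->
  (forall u, U u -> cj u E = E -> nz K u) -> nbhs (1 : G) [set x | E x -> K x].
Proof.
move=> aD aE ED lK KE K1 nK; have [[rE _] E1 _] := aE; have [sU _ _] := coU.
have lE := reg_lnorm rE.
have EK : E `<=` perp (perp K).
  apply: (dj_sub HG (reg_pp HG lK) lE).
  have -> : perp (perp (perp K)) = perp K by rewrite (regE HG (reg_perp HG lK)).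
  have lT := lnormI lE (lnorm_perp HG lK).
  apply: (away_atom aD lK _ K1 lT) => //.
  - by move=> x /KE/ED.
  - by move=> x [/ED].
  - move=> u Uu; have [e|ne] := pselect (cj u E = E).
      have eu : cj u^-1 E = E by rewrite -{1}e cjK.
      have -> : cj u K = K by apply: nz_cj; apply: nK => //; exact: sgpV.
      by move=> x [Kx [_ px]]; apply: (perp_dj HG lK).
    apply: (djS (@cjS _ u _ _ KE) (@subIsetl _ _ _)).
    apply: contrapT => nd; apply: ne.
    by apply: (atom_dj_eq (sublat_invreg HG coV) _ aE nd); exact: atom_cj.
by apply: filterS (perp_perp_near HG lK) => x h /EK.
Qed.

End Conj.

Lemma invreg_sub U V : V `<=` U -> invreg U `<=` invreg V.
Proof. by move=> VU R [rR nR]; split=> // v /VU; exact: nR. Qed.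

Lemma cover_meet (S : set (set G)) R l T : (forall A, S A -> reg A) ->
  decomposition S R l -> lnorm T -> T `<=` R -> T <> [set 1] ->
  exists2 A, A \in l & ~ dj T A.
Proof.
move=> rS [lA cov] lT TR T1; apply: contrapT => nex.
apply: T1; have [sT _ _] := lT; apply: sgp_triv => // x Tx.
apply: (cov _ (reg_pp HG lT)); last by split; [exact: TR|exact: sub_perp_perp].
move=> A Al; have [[SA _ _] _] := lA _ Al.
have lnA := reg_lnorm (rS _ SA).
apply: sub_dj => //; rewrite -[perp A](regE HG (reg_perp HG lnA)).
do 2 apply: perpS; apply: dj_perp => //; apply: djC.
by apply: contrapT => nd; apply: nex; exists A.
Qed.

(** Inside a [U]-atom any two nontrivial parts meet after conjugation, so a link into [B] and a link
    out of [B] always compose. *)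
Lemma link_meet U B S1 S2 f P1 P2 (g : G -> G) R Q : co U -> atom (invreg U) B ->
  lnorm S1 -> S1 `<=` R -> lnorm S2 -> S2 `<=` B -> S2 <> [set 1] -> ciso S1 S2 f ->
  lnorm P1 -> P1 `<=` B -> P1 <> [set 1] -> lnorm P2 -> P2 `<=` Q -> ciso P1 P2 g ->
  linked R Q.
Proof.
move=> coU aB l1 s1 l2 s2 n2 cf l3 s3 n3 l4 s4 cg.
have [u Uu nd] : exists2 u, U u & ~ dj (cj u S2) P1.
  apply: contrapT => nex; apply: n3; apply: sgp_triv; first by case: l3.
  apply: (away_atom coU aB l2 s2 n2 l3 s3) => u Uu.
  by apply: contrapT => nd; apply: nex; exists u.
have sS1 : sgp S1 by case: l1.
have cS2 := ciso_compact sS1 cf.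
exact: linked_trans l1 s1 (lnorm_cj u l2) (ciso_comp cf (ciso_cj u cS2)) l3 l4 s4 cg nd.
Qed.

Lemma ciso_nt S1 S2 (f : G -> G) : sgp S1 -> ciso S1 S2 f -> S1 <> [set 1] -> S2 <> [set 1].
Proof.
move=> s1 [_ fS _ fI _] n1 e; apply: n1; apply: sgp_triv => // x Sx; apply: fI => //.
by have : S2 (f x) by [rewrite -fS; exists x]; rewrite e.
Qed.

(** Remove from [R] all atoms not linked to [A]. If the rest [O] were linked to its complement, a
    link would lead from an atom linked to [A] to one that is not, and [link_meet] would compose it
    with the link from [A]. So [O] is in [cl], and by minimality it is all of [R]. *)
Lemma clatom_linked U R l A B : co U -> atom (@cl G) R -> decomposition (invreg U) R l ->
  A \in l -> B \in l -> linked A B.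
Proof.
move=> coU [cR R1 hR] dec Al Bl; apply: contrapT => nAB.
have [lA cov] := dec.
have slU := sublat_invreg HG coU.
have [sU nU _] := coU.
have rS C : invreg U C -> reg C by case.
have rl C : C \in l -> reg C by move=> /lA[[[]]].
pose D := [set C | C \in l /\ ~ linked A C].
pose O := R `&` \bigcap_(C in D) perp C.
have [rR hRR] := cR; have lR := reg_lnorm rR.
have rO : reg O.
  apply: regI => //; apply: reg_bigcap.
    by move=> C [/rl rC _]; apply: (reg_perp HG (reg_lnorm rC)).
  apply: filterS nU => u Uu; apply: nz_bigcap => C [Cl _].
  have [[iC _ _] _] := lA _ Cl; have [_ h] := sl_perp slU iC; exact: h.
have lO := reg_lnorm rO.
have nt C : C \in l -> C <> [set 1] by move=> /lA[[]].
have AO : A `<=` O.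
  have [aA AR] := lA _ Al.
  move=> x Ax; split; first exact: AR.
  move=> C [Cl nC]; have [aC CR] := lA _ Cl.
  apply: (dj_perp HG (reg_lnorm (rl _ Cl)) (reg_lnorm (rl _ Al))) Ax.
  apply: contrapT => nd; apply: nC; rewrite (atom_dj_eq slU aC aA nd).
  by apply: linked_refl; [exact: reg_lnorm (rl _ Al)|exact: nt].
have clO : cl O.
  split=> // -[S1 [S2 [f [[l1 s1] [l2 s2] n1 cf]]]].
  have sS1 : sgp S1 by case: l1.
  have n2 := ciso_nt sS1 cf n1.
  have [d|nd] := pselect (dj S2 (perp R)); last first.
    apply: hRR; apply: linkedS (linked_meet HG l1 s1 l2 s2 cf (lnorm_perp HG lR) nd).
      by move=> x [].
    by move=> x [].
  have S2R := dj_sub HG rR l2 d.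
  have [C DC nd] : exists2 C, D C & ~ dj S2 C.
    apply: contrapT => nex; apply: n2; apply: sgp_triv; first by case: l2.
    move=> x Sx; apply: (perp_dj HG lO); split; last exact: s2.
    split; first exact: S2R.
    move=> C DC; have [Cl _] := DC.
    apply: (dj_perp HG (reg_lnorm (rl _ Cl)) l2) Sx.
    by apply: djC; apply: contrapT => nd; apply: nex; exists C.
  have [Cl nC] := DC; have lC := reg_lnorm (rl _ Cl).
  (* [linked_meet] cuts down the target only; reversing the link before the next cut treats the
     source in the same way. *)
  have [T2 [T1 [h [[lT2 sT2] [lT1 sT1] nT2 ch]]]] :=
    linked_sym HG (linked_meet HG l1 s1 l2 s2 cf lC nd).
  have sgT2 : sgp T2 by case: lT2.
  have nT1 := ciso_nt sgT2 ch nT2.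
  have [B' B'l nd'] : exists2 B', B' \in l & ~ dj T1 B'.
    by apply: (cover_meet rS dec lT1 _ nT1) => x /sT1[].
  have lB' := reg_lnorm (rl _ B'l).
  have [P1 [P2 [k [[lP1 sP1] [lP2 sP2] nP1 ck]]]] :=
    linked_sym HG (linked_meet HG lT2 sT2 lT1 sT1 ch lB' nd').
  (* Otherwise [O] lies in [perp B'], while the nontrivial [P1] lies in both [O] and [B']. *)
  have LAB : linked A B'.
    apply: contrapT => nL; have sgP1 : sgp P1 by case: lP1.
    apply: nP1; apply: sgp_triv => // x Px.
    have [[_ hp] B'x] := sP1 _ Px.
    by apply: (perp_dj HG lB'); split=> //; apply: hp.
  have [Q1 [Q2 [m [[lQ1 sQ1] [lQ2 sQ2] nQ1 cm]]]] := LAB.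
  have sgQ1 : sgp Q1 by case: lQ1.
  have [aB' _] := lA _ B'l.
  apply: nC; apply: (link_meet coU aB' lQ1 sQ1 lQ2 sQ2 (ciso_nt sgQ1 cm nQ1) cm lP1 _ nP1 lP2 _ ck).
    by move=> x /sP1[].
  by move=> x /sP2[].
have [x Ax x1] : exists2 x, A x & x <> 1 by apply: sgp_nt (nt _ Al); case: (rl _ Al) => -[].
have O1 : O <> [set 1] by move=> e; apply: x1; have := AO _ Ax; rewrite e.
have RO := hR _ clO (@subIsetl _ _ _) O1.
have [y By y1] : exists2 x, B x & x <> 1 by apply: sgp_nt (nt _ Bl); case: (rl _ Bl) => -[].
apply: y1; apply: (perp_dj HG (reg_lnorm (rl _ Bl))); split=> //.
have [_ BR] := lA _ Bl; have [_] := RO _ (BR _ By); by apply.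
Qed.

End Tiling.

Section TilingTheorem.
Variables (G : topGroupType) (HG : ldgroup G).
Implicit Types (A B C K R S T U V W N D E : set G) (x y g u : G) (l F : seq (set G)).
Let hG := ld_hausdorff HG.

Lemma pow_near E A B : pow E A -> nbhs (1 : G) [set z | A z -> B z] ->
  nbhs (1 : G) [set z | B z -> A z] -> pow E B.
Proof. by move=> [I pA] n1 n2; exists I; apply: pw_near pA n1 n2. Qed.

Lemma pow_ciso E A B f : sgp A -> ciso A B f -> pow E A -> pow E B.
Proof.
move=> sA cf [I pA]; exists I.
by apply: (pw_comp HG pA _ _ (ciso_lemb hG sA cf)); apply: filterS filterT => x _.
Qed.

Lemma pow_cj E A u : lnorm A -> pow E A -> pow E (cj u A).
Proof.
move=> lA pA; have [S [lS cS SA _ nS]] := compact_open_lnormI HG lA filterT.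
have sS : sgp S by case: lS.
have pS : pow E S by apply: pow_near pA nS _; apply: filterS filterT => x _; exact: SA.
apply: pow_near (pow_ciso sS (ciso_cj u cS) pS) _ _.
  by apply: filterS filterT => x _; exact: cjS.
by apply: filterS (nbhs1_cj u nS) => x h; exact: h.
Qed.

Lemma pow_decomposition E R l U (S : set (set G)) : co U -> sublat U S -> reg R -> decomposition S R l ->
  (forall A, A \in l -> pow E A) -> pow E R.
Proof.
move=> coU slU rR [lA cov] pA.
apply: (pow_join_list HG coU slU (undup_uniq l)) => // [A|T rT h].
  by rewrite mem_undup => Al; have [? ?] := lA _ Al; split=> //; exact: pA.
by apply: cov => // A Al; apply: h; rewrite mem_undup.
Qed.

Lemma decomposition_nonempty (S : set (set G)) R l : reg R -> R <> [set 1] ->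
  decomposition S R l -> exists A, A \in l.
Proof.
move=> rR R1; case: l => [|A l] [_ cov]; last by exists A; exact: mem_head.
case: R1; apply: sgp_triv; first by case: rR => -[].
by move=> x Rx; apply: (cov R).
Qed.

Lemma pp_nt K : lnorm K -> K <> [set 1] -> perp (perp K) <> [set 1].
Proof.
move=> lK K1 e; apply: K1; apply: sgp_triv; first by case: lK.
by move=> x /(sub_perp_perp HG lK); rewrite e.
Qed.

Lemma pp_sub K R : K `<=` R -> reg R -> perp (perp K) `<=` R.
Proof. by move=> KR [_ rR]; apply: subset_trans rR; do 2 apply: perpS. Qed.

Lemma exists_atom U R : co U -> invreg U R -> R <> [set 1] ->
  exists2 A, atom (invreg U) A & A `<=` R.
Proof.
move=> coU iR R1; have [l dec] := atoms_exist HG coU (sublat_invreg HG coU) iR.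
have [rR _] := iR; have [A Al] := decomposition_nonempty rR R1 dec.
by have [? ?] := dec.1 A Al; exists A.
Qed.

Lemma invreg_pp U K : co U -> lnorm K -> (forall u, U u -> nz K u) -> invreg U (perp (perp K)).
Proof.
move=> [sU _ _] lK nK; split; first exact: reg_pp.
have sV u : U u -> U u^-1 by exact: sgpV.
by move=> u Uu; do 2 (apply: perp_nz; rewrite ?invgK); apply: nK => //; exact: sV.
Qed.

Definition irreducible_under U E := forall K, lnorm K -> K `<=` E -> K <> [set 1] ->
  (forall u, U u -> cj u E = E -> nz K u) -> nbhs (1 : G) [set x | E x -> K x].

(** In each [U]-atom [A] all [V]-atoms are conjugate to one tile [eta A], and the link from [D] to
    [A] contains a copy [P A] of that tile inside [D]. All the copies lie in the single atom [D], so
    a finer tile [E] of [D] measures them together. *)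
Lemma tiling R F : atom (@cl G) R -> (forall A, A \in F -> reg A /\ A `<=` R) ->
  exists U E, [/\ co U /\ reg E, E <> [set 1] /\ E `<=` R, pow E R,
    forall A, A \in F -> pow E A & irreducible_under U E].
Proof.
move=> aR FR; have [cR R1 hR] := aR; have [rR _] := cR.
have [U [sU nU cU _]] := ld_base HG filterT.
have coU : co U by [].
have iR : invreg U R by split=> // u _; exact: (cl_nz HG).
have slU := sublat_invreg HG coU.
have [l dec] := atoms_exist HG coU slU iR.
have [D Dl] := decomposition_nonempty rR R1 dec.
have [lA cov] := dec.
have [aD DR] := lA _ Dl; have [[rD _] D1 _] := aD.
have rl A : A \in l -> reg A by move=> /lA[[[]]].
have /choice[p pP] A : exists p : (set G * set G) * (G -> G), A \in l ->
    [/\ lnorm p.1.1 /\ p.1.1 `<=` D, lnorm p.1.2 /\ p.1.2 `<=` A, p.1.1 <> [set 1]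
      & ciso p.1.1 p.1.2 p.2].
  have [Al|nAl] := boolP (A \in l); last by exists ((D, D), id).
  have [S [S' [f h]]] := clatom_linked HG coU aR dec Dl Al.
  by exists ((S, S'), f).
pose S A := (p A).1.1; pose S' A := (p A).1.2; pose f A := (p A).2.
have lS A : A \in l -> lnorm (S A) by move=> /pP[[]].
have SD A : A \in l -> S A `<=` D by move=> /pP[[]].
have lS' A : A \in l -> lnorm (S' A) by move=> /pP[_ []].
have SA A : A \in l -> S' A `<=` A by move=> /pP[_ []].
have nS A : A \in l -> S A <> [set 1] by move=> /pP[].
have cS A : A \in l -> ciso (S A) (S' A) (f A) by move=> /pP[].
have nS' A : A \in l -> S' A <> [set 1].
  by move=> Al; have [sS _ _] := lS _ Al; exact: ciso_nt sS (cS _ Al) (nS _ Al).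
(* [V] must normalise the ends of the links, so that tiles can be chosen inside them, and the
   members of [F], so that they are unions of tiles up to local equivalence. *)
have nW : nbhs (1 : G) ([set g | forall A, A \in l -> nz (S' A) g] `&`
    [set g | forall A, A \in F -> nz A g]).
  apply: filterI; apply: filter_seq.
    by move=> A /lS'[].
  by move=> A /FR[[[]]].
have [V [coV VU VW nV]] := normal_core HG coU nW.
have /choice[eta etaP] A : exists B, A \in l -> atom (invreg V) B /\ B `<=` perp (perp (S' A)).
  have [Al|nAl] := boolP (A \in l); last by exists set0.
  have iS : invreg V (perp (perp (S' A))).
    by apply: invreg_pp => //; [exact: lS'|move=> v /VW[h _]; exact: h].
  have [B aB BS] := exists_atom coV iS (pp_nt (lS' _ Al) (nS' _ Al)).
  by exists B.
have eA A : A \in l -> eta A `<=` A.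
  by move=> Al; have [_ h] := etaP _ Al; apply: subset_trans h (pp_sub (SA _ Al) (rl _ Al)).
have re A : A \in l -> reg (eta A) by move=> /etaP[[[]]].
have leT A : A \in l -> lnorm (eta A `&` S' A).
  by move=> Al; apply: lnormI; [exact: reg_lnorm (re _ Al)|exact: lS'].
pose P A := S A `&` f A @^-1` (eta A `&` S' A).
have PP A : A \in l -> lnorm (P A) /\ ciso (P A) (eta A `&` S' A) (f A).
  by move=> Al; apply: (lnorm_preimage HG (lS _ Al) (cS _ Al) (leT _ Al)) => x [].
have nW2 : nbhs (1 : G) [set g | forall A, A \in l -> nz (P A) g].
  by apply: filter_seq => A /PP[[]].
(* A second core is required because the sets [P A] depend on [V]; they have to be invariant before
   they can be decomposed into conjugates of [E]. *)
have [V' [coV' VU' VW' nV']] := normal_core HG coU nW2.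
have [E aE ED] : exists2 E, atom (invreg V') E & E `<=` D.
  by apply: exists_atom => //; apply: (invreg_sub VU'); case: aD.
have [[rE _] E1 _] := aE; have lE := reg_lnorm rE.
have powP A : A \in l -> pow E (perp (perp (P A))).
  move=> Al; have [lP _] := PP _ Al.
  have PD : P A `<=` D by move=> x [/(SD _ Al)].
  have iP : invreg V' (perp (perp (P A))).
    by apply: invreg_pp => // u /VW' h; exact: h.
  have [m decm] := atoms_exist HG coV' (sublat_invreg HG coV') iP.
  apply: (pow_decomposition coV' (sublat_invreg HG coV') iP.1 decm) => B Bm.
  have [aB BP] := decm.1 _ Bm.
  have [u Uu ->] := atoms_conj HG coU coV' nV' aD aE aB ED (subset_trans BP (pp_sub PD rD)).
  by apply: pow_cj => //; exists unit; exact: pw_unit.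
have poweta A : A \in l -> pow E (eta A).
  move=> Al; have [lP cP] := PP _ Al; have [sP _ _] := lP.
  have h1 : pow E (P A).
    apply: pow_near (powP _ Al) (perp_perp_near HG lP) _.
    by apply: filterS filterT => x _; exact: sub_perp_perp.
  apply: pow_near (pow_ciso sP cP h1) _ _; first by apply: filterS filterT => x _ [].
  apply: filterS (perp_perp_near HG (lS' _ Al)) => x h ex; split=> //; apply: h.
  by have [_] := etaP _ Al; apply.
(* A [V]-atom below [R] lies in a single [U]-atom [A] and is therefore a [U]-conjugate of
   [eta A]. *)
have powV C : invreg V C -> C `<=` R -> pow E C.
  move=> iC CR; have [m decm] := atoms_exist HG coV (sublat_invreg HG coV) iC.
  apply: (pow_decomposition coV (sublat_invreg HG coV) iC.1 decm) => B Bm.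
  have [aB BC] := decm.1 _ Bm; have [[rB nB] B1 hB] := aB.
  have rI A : invreg U A -> reg A by case.
  have [A Al nd] := cover_meet HG rI dec (reg_lnorm rB) (subset_trans BC CR) B1.
  have [aA _] := lA _ Al.
  have iAB : invreg V (B `&` A).
    apply: (sl_I (sublat_invreg HG coV)) => //; apply: (invreg_sub VU); by case: aA.
  have BA : B `<=` A.
    apply: subset_trans (hB _ iAB (@subIsetl _ _ _) _) (@subIsetr _ _ _).
    by move=> e; apply: nd => x; rewrite e.
  have [ae _] := etaP _ Al.
  have [u Uu ->] := atoms_conj HG coU coV nV aA ae aB (eA _ Al) BA.
  by apply: pow_cj; [exact: reg_lnorm (re _ Al)|exact: poweta].
exists U, E; split=> //.
- by split=> //; exact: subset_trans ED DR.
- by apply: powV => //; exact: (invreg_sub VU).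
- move=> A AF; have [rA AR] := FR _ AF; apply: powV => //; split=> // v /VW[_ h]; exact: h.
- by move=> K lK KE K1 nK; exact: (atom_irreducible HG coU coV' nV' aD aE ED lK KE K1 nK).
Qed.

End TilingTheorem.

Section TopIso.
Variables (G H : topGroupType).
Implicit Types (A : set G) (B : set H) (f : G -> H).

Lemma lemb_top_iso A B f : sgp A -> sgp B -> lemb A f B ->
  (forall z, B z -> exists2 x, A x & f x = z) -> top_iso A B f.
Proof.
move=> sA sB [fM fB fI fC fO] fS.
have fA : f @` A = B.
  by apply/seteqP; split=> [_ [x /fB ? <-] //|z /fS[x Ax <-]]; exists x.
have [g [gP gf gM]] := hom_inverse sA fM fI fA.
split; first by apply/hom_onP.
exists g; split=> // [|z /gP[]//].
apply/hom_onP => //; split=> // [z /gP[]//|].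
by move=> W /fO; apply: filterS => z h /h [x [Ax Wx <-]]; rewrite /= gf.
Qed.

Lemma top_iso_lemb A B f : sgp A -> sgp B -> top_iso A B f ->
  lemb A f B /\ forall z, B z -> exists2 x, A x & f x = z.
Proof.
move=> sA sB [/(hom_onP _ _ sA)[fB fM fC] [g [/(hom_onP _ _ sB)[gA gM gC] gf fg]]].
split; last by move=> z Bz; exists (g z); [exact: gA|exact: fg].
split=> //.
- move=> x Ax e; rewrite -(gf _ Ax) e.
  exact: hom1 sB gM.
- by move=> W /gC; apply: filterS => z h Bz; exists (g z); split; [exact: gA|exact: h|exact: fg].
Qed.

End TopIso.

(** * The local product decomposition along the atoms of [cl] *)

Section Product.
Variables (G : topGroupType) (HG : ldgroup G).
Implicit Types (A B K R S T U V W : set G) (x y g u : G) (l : seq (set G)).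
Let hG := ld_hausdorff HG.

Lemma cl_atoms : exists l, [/\ uniq l, forall A, A \in l -> atom (@cl G) A
  & forall T, reg T -> (forall A, A \in l -> dj A T) -> T = [set 1]].
Proof.
have [U [sU nU cU _]] := ld_base HG filterT.
have coU : co U by [].
have [l [lA cov]] := atoms_exist HG coU (sublat_cl HG coU) (cl_T HG).
exists (undup l); split; first exact: undup_uniq.
  by move=> A; rewrite mem_undup => /lA[].
move=> T rT h; apply: sgp_triv; first by case: rT => -[].
by move=> x Tx; apply: (cov T) => // A Al; apply: h; rewrite mem_undup.
Qed.

(** The factors are indexed by [nat] so that the induction on [l] can shift them by one. *)
Lemma prod_near l R U (S : set (set G)) W : co U -> sublat U S -> uniq l -> reg R ->
  (forall A, A \in l -> atom S A /\ A `<=` R) ->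
  (forall T, reg T -> (forall A, A \in l -> dj A T) -> dj R T) ->
  nbhs (1 : G) W ->
  nbhs (1 : G) [set x | R x -> exists f : nat -> G,
    (forall i, (i < size l)%N -> nth set0 l i (f i) /\ W (f i)) /\
    x = \prod_(i < size l) f i].
Proof.
move=> coU sl + + + + nW; elim: l R => [|A l IH] R.
  move=> _ rR _ h; apply: filterS filterT => z _ Rz; exists (fun=> 1); split=> //.
  by rewrite big_ord0; apply: (h R).
move=> /= /andP[Al ul] rR lA cov.
have lA' B : B \in l -> atom S B /\ B `<=` R by move=> Bl; apply: lA; rewrite inE Bl orbT.
have [atA AR] := lA A (mem_head _ _).
have rA : reg A by have [SA _ _] := atA; have [] := sl_inv sl SA.
have lnA := reg_lnorm rA.
have rR' : reg (R `&` perp A) by apply: regI => //; exact: (reg_perp HG).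
have dA B : B \in l -> dj A B.
  move=> Bl; apply: contrapT => nd; have [atB _] := lA' B Bl.
  by move: Al; rewrite (atom_dj_eq sl atA atB nd) Bl.
have rB B : B \in l -> reg B.
  by move=> Bl; have [[SB _ _] _] := lA' B Bl; have [] := sl_inv sl SB.
have n : nbhs (1 : G) [set x | (R `&` perp A) x -> exists f : nat -> G,
    (forall i, (i < size l)%N -> nth set0 l i (f i) /\ W (f i)) /\
    x = \prod_(i < size l) f i].
  apply: IH => //.
  - move=> B Bl; have [atB BR] := lA' B Bl; split=> // x Bx; split; first exact: BR.
    exact: (dj_perp HG lnA (reg_lnorm (rB _ Bl)) (dA _ Bl)).
  - move=> T rT dT x [[Rx px] Tx]; apply: (cov (T `&` perp A)); last by split.
      by apply: regI => //; exact: (reg_perp HG).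
    move=> B; rewrite inE => /orP[/eqP -> y [Ay [_ py]]|Bl]; first by apply: (perp_dj HG lnA).
    by move=> y [By [Ty _]]; apply: (dT _ Bl).
apply: filterS (perp_mul_near HG lnA (filterI nW n)) => x [a [p [[Aa [Wa _]] [pp [_ hp]] e]]] Rx.
have sR : sgp R by case: rR => -[].
have Rp : R p by apply: (sgpMl sR (AR _ Aa)); rewrite -e.
have [f [fP ef]] := hp (conj Rp pp).
exists (fun i => if i is k.+1 then f k else a); split.
  by case=> [//|i]; exact: fP.
by rewrite big_ord_recl /= e ef.
Qed.

Lemma prodM_commute (X : eqType) (r : seq X) (F F' : X -> G) : uniq r ->
  (forall i j, i != j -> commute (F i) (F' j)) ->
  \prod_(i <- r) (F i * F' i) = \prod_(i <- r) F i * \prod_(i <- r) F' i.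
Proof.
move=> + FF; elim: r => [|i r IH] /=; first by rewrite !big_nil mulg1.
move=> /andP[ir ur]; rewrite !big_cons IH// -!mulgA; congr (_ * _); rewrite !mulgA; congr (_ * _).
rewrite big_seq; apply: commute_prod => j jr; apply/commute_sym/FF.
by apply: contraNneq ir => <-.
Qed.

Definition prodI n (f : 'I_n -> G) := \prod_(i < n) f i.

Section Family.
Variables (n : nat) (M : 'I_n -> set G).
Hypotheses (sM : forall i, sgp (M i))
  (comm : forall i j x y, i != j -> M i x -> M j y -> commute x y).

Lemma prodI_mul (f g : {ptws 'I_n -> G}) : boxI M f -> boxI M g -> prodI (fun i => f i * g i) = prodI f * prodI g.
Proof.
move=> Mf Mg; apply: prodM_commute; first exact: index_enum_uniq.
by move=> i j ij; apply: (comm ij).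
Qed.

Lemma prodI_split (f : {ptws 'I_n -> G}) i : boxI M f ->
  prodI f = f i * prodI (fun j => if j == i then 1 else f j).
Proof.
move=> Mf.
have <- : prodI (fun j => if j == i then f j else 1) = f i.
  by rewrite /prodI -big_mkcond big_pred1_eq.
rewrite -prodI_mul.
- by apply: eq_bigr => j _; case: ifP; rewrite ?mulg1 ?mul1g.
- by move=> j; case: ifP => _; [exact: Mf|exact: sgp1].
- by move=> j; case: ifP => _; [exact: sgp1|exact: Mf].
Qed.

Lemma prodI_in (K : set G) (f : 'I_n -> G) : sgp K -> (forall i, K (f i)) -> K (prodI f).
Proof. by move=> sK h; apply: big_ind => //; [exact: sgp1|move=> x y; exact: sgpM]. Qed.

Lemma prodI_V (f : {ptws 'I_n -> G}) : boxI M f -> (prodI f)^-1 = prodI (fun i => (f i)^-1).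
Proof.
move=> Mf; apply: (@mulgI _ (prodI f)); rewrite mulgV -prodI_mul//.
  by rewrite /prodI big1// => i _; rewrite mulgV.
by move=> i; apply: (sgpV (sM i)); exact: Mf.
Qed.

End Family.

Lemma cl_family : exists n (M : 'I_n -> set G),
  [/\ forall i, atom (@cl G) (M i), forall i j, i != j -> dj (M i) (M j),
    forall W, nbhs (1 : G) W -> nbhs (1 : G) [set x | exists2 f : 'I_n -> G,
      (forall i, M i (f i) /\ W (f i)) & x = prodI f]
  & forall T, reg T -> (forall i, dj (M i) T) -> T = [set 1]].
Proof.
have [l [ul lA cov]] := cl_atoms.
have [U [sU nU cU _]] := ld_base HG filterT.
have coU : co U by [].
exists (size l), (fun i => nth set0 l i).
have inl (i : 'I_(size l)) : nth set0 l i \in l by apply: mem_nth.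
split.
- by move=> i; exact: lA.
- move=> i j ij; apply: contrapT => nd.
  have e := atom_dj_eq (sublat_cl HG coU) (lA _ (inl i)) (lA _ (inl j)) nd.
  move/eqP: e; rewrite nth_uniq// => /eqP e; by move: ij; rewrite (val_inj e) eqxx.
- move=> W nW; have := @prod_near l [set: G] U (@cl G) W coU (sublat_cl HG coU) ul (@reg_T G) _ _ nW.
  have h1 A : A \in l -> atom (@cl G) A /\ A `<=` [set: G] by move=> /lA.
  have h2 T : reg T -> (forall A, A \in l -> dj A T) -> dj setT T.
    by move=> rT h x [_]; rewrite (cov T rT h).
  move=> /(_ h1 h2); apply: filterS => x /(_ Logic.I) [f [fP ->]].
  by exists (fun i => f i) => // i; exact: fP.
- move=> T rT h; apply: cov => // A Al.
  have il : (index A l < size l)%N by rewrite index_mem.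
  by have := h (Ordinal il); rewrite /= nth_index.
Qed.

End Product.

(** * Characteristic factors *)

Section FiniteIndex.
Variable G : topGroupType.
Implicit Types (A N : set G).

Lemma coset_eq N x y : sgp N -> N (x^-1 * y) -> [set x * z | z in N] = [set y * z | z in N].
Proof.
move=> sN Nxy; apply/seteqP; split=> [_ [z Nz <-]|_ [z Nz <-]].
  exists ((x^-1 * y)^-1 * z); first by apply: sgpM => //; exact: sgpV.
  by rewrite !group_normE.
by exists (x^-1 * y * z); [exact: sgpM|rewrite !group_normE].
Qed.

Lemma finite_index_near A N : sgp N -> closed N -> N `<=` A -> finite_index A N ->
  nbhs (1 : G) [set x | A x -> N x].
Proof.
move=> sN cN NA fin.
pose C := [set [set g * x | x in N] | g in A] `\` [set N].
pose D := \bigcup_(c in C) c.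
have clD : closed D.
  apply: closed_bigcup; first exact: finite_setD.
  move=> c [[a Aa <-] _].
  have -> : [set a * x | x in N] = [set y | N (a^-1 * y * 1)].
    apply/seteqP; split=> [_ [x Nx <-]|y /=]; first by rewrite /= !group_normE.
    by rewrite mulg1 => Ny; exists (a^-1 * y) => //; rewrite !group_normE.
  by apply: preimage_closed cN => x _; exact: continuous_conj.
have N1 : N = [set 1 * x | x in N].
  apply/seteqP; split=> [x Nx|_ [x Nx <-]]; last by rewrite mul1g.
  by exists x => //; rewrite mul1g.
have nD : (~` D) 1.
  move=> [c [[a Aa <-] na]] [x Nx e]; apply: na.
  have h : N (a^-1 * 1) by rewrite -e !group_normE.
  by rewrite /= (coset_eq sN h) -N1.
apply: filterS (open_nbhs_nbhs (conj (closed_openC clD) nD)) => x nx Ax.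
apply: contrapT => nN; apply: nx; exists [set x * z | z in N]; last by exists 1; rewrite ?mulg1//; exact: sgp1.
split; first by exists x.
by move=> e; apply: nN; rewrite -e; exists 1; rewrite ?mulg1//; exact: sgp1.
Qed.

Lemma near_finite_index A N : compact A -> sgp N -> N `<=` A ->
  nbhs (1 : G) [set x | A x -> N x] -> sgp A -> finite_index A N.
Proof.
move=> cA sN NA n sA; apply: contrapT => /infiniteP/pcard_leP[f].
have /choice[x xP] k : exists a, A a /\ [set a * z | z in N] = f k.
  have : [set [set g * x | x in N] | g in A] (f k) by apply: funS.
  by move=> [a Aa e]; exists a.
have [k [m [km h]]] := compact_pigeonhole cA (fun k => (xP k).1) n.
have Ax j : A (x j) by case: (xP j).
have /h hN : A ((x k)^-1 * x m) by apply: sgpM => //; exact: sgpV.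
have e : f k = f m by rewrite -(xP k).2 -(xP m).2; exact: coset_eq.
have : k = m by apply: (@inj _ _ _ f) => //; rewrite inE.
by move=> e'; rewrite e' ltnn in km.
Qed.

End FiniteIndex.

Section Clauses.
Variables (G : topGroupType) (HG : ldgroup G).
Implicit Types (A B K R S T U V W N J : set G) (x y u : G).
Let hG := ld_hausdorff HG.

Lemma cl_commute R S x y : cl R -> cl S -> dj R S -> R x -> S y -> commute x y.
Proof.
move=> cR cS d Rx Sy; have lR := reg_lnorm cR.1; have lS := reg_lnorm cS.1.
exact: (perp_commute HG lR Rx (dj_perp HG lR lS d Sy) (cl_nz HG y cR)).
Qed.

Lemma internal_product_cl n (M : 'I_n -> set G) :
  (forall i, cl (M i)) -> (forall i j, i != j -> dj (M i) (M j)) ->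
  (forall W, nbhs (1 : G) W -> nbhs (1 : G) [set x | exists2 f : 'I_n -> G,
      (forall i, M i (f i) /\ W (f i)) & x = prodI f]) ->
  exists P, [/\ sgp P, nbhs (1 : G) P, internal_product M P
    & forall x, P x <-> exists2 f : {ptws 'I_n -> G}, boxI M f & x = prodI f].
Proof.
move=> cM dM nM.
have sM i : sgp (M i) by case: (cM i) => -[[]].
have comm i j x y : i != j -> M i x -> M j y -> commute x y.
  by move=> /dM; apply: cl_commute.
pose P := [set x | exists2 f : {ptws 'I_n -> G}, boxI M f & x = prodI f].
have fin (f : 'I_n -> G) : (forall i, M i (f i)) -> P (prodI f) by move=> h; exists f.
have sP : sgp P.
  split; first by exists 1; [move=> i; exact: sgp1|rewrite /prodI big1].
  - move=> _ _ [f Mf ->] [g Mg ->]; rewrite -(prodI_mul comm)//.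
    by apply: fin => i; apply: (sgpM (sM i)); [exact: Mf|exact: Mg].
  - move=> _ [f Mf ->]; rewrite (prodI_V sM comm)//.
    by apply: fin => i; apply: (sgpV (sM i)); exact: Mf.
have nP : nbhs (1 : G) P.
  by apply: filterS (nM _ filterT) => _ [f h ->]; apply: fin => i; case: (h i).
exists P; split=> //; split.
  move=> i; apply/subgroupP; split=> // x Mx.
  have -> : x = prodI (fun j => if j == i then x else 1).
    by rewrite /prodI -big_mkcond big_pred1_eq.
  by apply: fin => j; case: eqP => [->|_] //; exact: sgp1.
apply: lemb_top_iso => //; first exact: sgp_boxI; last by move=> _ [f Mf ->]; exists f.
split=> //.
- by move=> f g Mf Mg; exact: (prodI_mul comm).
(* If the product is 1, [f i] is the inverse of the product of the other factors, which lies in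
   [perp (M i)]. *)
- move=> f Mf e; apply: ptwsP => i; have lM := reg_lnorm (cM i).1.
  move: e; rewrite -/(prodI f) (prodI_split sM comm i Mf); set r := prodI _ => e.
  have pr : perp (M i) r.
    apply: prodI_in; first exact: perp_sgp.
    move=> j; case: eqP => [_|/eqP ji]; first exact: (sgp1 (perp_sgp (M i))).
    apply: (dj_perp HG lM (reg_lnorm (cM j).1) _ (Mf j)).
    by apply: dM; rewrite eq_sym.
  apply: (perp_dj HG lM); split; first exact: Mf.
  have -> : f i = r^-1 by apply: (@mulIg _ r); rewrite mulVg.
  by apply: sgpV => //; exact: perp_sgp.
- move=> W nW; have [V [sV nV _ VW]] := ld_base HG nW.
  apply: filterS (nbhs_boxI 'I_n nV) => f h _; apply: VW; exact: prodI_in.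
- move=> W /ptws_nbhs1P[W' nW' WW'].
  apply: filterS (nM _ nW') => _ [f h ->] _; exists f.
  by split=> //; [move=> i; case: (h i)|apply: WW' => i; case: (h i)].
Qed.

(** A small compact open part of [X] is mapped by [f] onto a locally normal subgroup. If this met
    [perp T] nontrivially, [R] would be linked to [perp T]. *)
Lemma ciso_near R K (f : G -> G) X T : lnorm K -> hom_on K K f ->
  (exists g, hom_on K K g /\ (forall x, K x -> g (f x) = x) /\ (forall x, K x -> f (g x) = x)) ->
  lnorm X -> X `<=` K -> X `<=` R -> reg T -> ~ linked R (perp T) ->
  nbhs (1 : G) [set x | X x -> T (f x)].
Proof.
move=> lK; have [sK _ _] := lK.
move=> /(hom_onP _ _ sK)[fK fM fC] [g [/(hom_onP _ _ sK)[gK gM gC] [gf fg]]] lX XK XR rT nl.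
have [S [lS cS SX _ nS]] := compact_open_lnormI HG lX filterT.
have SK : S `<=` K by exact: subset_trans SX XK.
have [sS _ nzS] := lS.
have f1 := hom1 sK fM.
have cf : ciso S (f @` S) f.
  split=> //.
  - by move=> x y /SK Kx /SK Ky; exact: fM.
  - by move=> x /SK Kx e; rewrite -(gf _ Kx) e; have := gf _ (sgp1 sK); rewrite f1.
  - by move=> W /fC; apply: filterS => x h /SK.
have lfS : lnorm (f @` S).
  apply: (lnorm_sub HG lK); [exact: ciso_sgp cf| |by move=> _ [x /SK Kx <-]; exact: fK|].
    by apply: compact_closed => //; exact: ciso_compact cf.
  apply: filterS (gC _ nzS) => r h Kr _ [s Ss <-].
  have Ks := SK _ Ss; have Kg := gK _ Kr.
  exists (g r * s * (g r)^-1); first exact: h.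
  rewrite fM ?fM// ?fg// ?(homV sK fM)// ?fg//; [exact: sgpM|exact: sgpV].
have [d|nd] := pselect (dj (f @` S) (perp T)).
  apply: filterS nS => x h /h Sx; apply: (dj_sub HG rT lfS d); by exists x.
have SR : S `<=` R by exact: subset_trans SX XR.
case: nl; apply: linkedS (linked_meet HG lS SR lfS (@subset_refl _ _) cf (lnorm_perp HG (reg_lnorm rT)) nd) => //.
Qed.

(** [ciso_near] controls germs only. To place [f x] itself in [R], it is shown to commute with
    [perp R] near 1: as [perp R] is also in [cl], [g] maps it into itself near 1, so [x] commutes
    with the result, and [f] carries this back. *)
Lemma cl_invariant R K f g : cl R -> lnorm K -> R `<=` K -> hom_on K K f -> hom_on K K g ->
  (forall x, K x -> g (f x) = x) -> (forall x, K x -> f (g x) = x) -> forall x, R x -> R (f x).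
Proof.
move=> cR lK RK hf hg gf fg x Rx.
have [rR nR] := cR; have lR := reg_lnorm rR; have lP := lnorm_perp HG lR.
have [sK _ nK] := lK.
have Kx := RK _ Rx.
have [fK fM fC] := (hom_onP _ _ sK).1 hf; have [gK gM gC] := (hom_onP _ _ sK).1 hg.
pose T := perp R `&` K; have lT : lnorm T by exact: lnormI.
have nT : nbhs (1 : G) [set z | T z -> perp R (g z)].
  apply: (@ciso_near (perp R) K g T (perp R)) => //.
  - by exists f.
  - by move=> z [].
  - by move=> z [].
  - exact: reg_perp.
  - by rewrite (regE HG rR) => /(linked_sym HG).
rewrite -(regE HG rR).
have px : perp (perp R) x by exact: sub_perp_perp.
have n1 : nbhs (1 : G) [set z | T z -> commute (f x) z].
  apply: filterS2 nT (gC _ px) => z h1 h2 Tz; have [_ Kz] := Tz.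
  have c : commute x (g z) by apply: h2 => //; exact: h1.
  by rewrite -(fg _ Kz) /commute -!fM ?c//; exact: gK.
have Kfx : K (f x) by exact: fK.
(* An element of [perp R] near 1 may leave [K]; its factor in [perp K] commutes with [f x] by
   [perp_commute]. *)
apply: filterS (perp_mul_near HG lK (filterI n1 nK)) => _ [k [c [[Kk [hk _]] [pc [_ nc]] ->]]] pp.
have pRc : perp R c by move: c pc {nc pp}; exact: perpS.
have Rk : perp R k by apply: (sgpMr (perp_sgp R) pRc).
apply: commuteM; first by apply: hk.
exact: perp_commute lK Kfx pc nc.
Qed.

Lemma cl_characteristic R K : cl R -> lnorm K -> R `<=` K -> characteristic K R.
Proof.
move=> cR lK RK; split; first by apply/subgroupP; split=> //; case: cR => -[[]].
move=> f [hf [g [hg gf fg]]]; apply/seteqP; split=> [_ [x Rx <-]|x Rx].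
  exact: cl_invariant cR lK RK hf hg gf fg _ Rx.
exists (g x); last by rewrite fg//; exact: RK.
exact: cl_invariant cR lK RK hg hf fg gf _ Rx.
Qed.

(** Locally equivalent groups have the same double [perp], which places [J] in [R]. A nontrivial
    closed normal [N] of [R] is locally normal, hence not discrete, so it meets [J] in a nontrivial
    normal subgroup, of finite index and therefore open. *)
Lemma just_infinite_clause R J : cl R -> lnorm J -> just_infinite J -> locally_equivalent J R ->
  J `<=` R /\ forall N, normal_subgroup R N -> closed_in R N -> N <> [set 1] -> open_in R N.
Proof.
move=> [rR _] lJ [_ jiJ] [o1 o2]; have lR := reg_lnorm rR.
have [sJ cJ nJ] := lJ; have [sR cR nR] := lR; have sJR := sgpI sJ sR.
have n1 : nbhs (1 : G) [set x | J x -> R x].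
  by apply: filterS ((open_in_sgp sJ sJR (@subIsetl _ _ _)).1 o1) => x h /h[].
have n2 : nbhs (1 : G) [set x | R x -> J x].
  by apply: filterS ((open_in_sgp sR sJR (@subIsetr _ _ _)).1 o2) => x h /h[].
have JR : J `<=` R.
  move=> x Jx; rewrite -(regE HG rR); apply: perp_loc (sub_perp_perp HG lJ Jx).
  by apply: filterS nR => z _; apply: perp_loc.
split=> // N [/subgroupP[sN NR] nN] /(closed_inP _ cR)[_ cN] N1.
have nN' x : R x -> nz N x by move=> /nN; rewrite normaliserE => -[].
have lN : lnorm N.
  by apply: (lnorm_sub HG lR) => //; apply: filterS filterT => r _; exact: nN'.
have fi : finite_index J (N `&` J).
  apply: jiJ.
  - split; first by apply/subgroupP; split=> [|x []//]; exact: sgpI.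
    move=> x Jx; rewrite normaliserE; have Jx' := sgpV sJ Jx.
    by split; apply: nzI; split; [apply: nN'; exact: JR|exact: nz_sgp|apply: nN'; exact: JR|exact: nz_sgp].
  - by apply/closed_inP => //; split=> [x []//|]; exact: closedI.
  - have [x [Nx Jx x1]] := lnorm_nt HG lN N1 n2.
    by move=> e; apply: x1; have : (N `&` J) x by [split=> //; apply: Jx; exact: NR]; rewrite e.
apply: sgp_open_in => //.
have n3 := finite_index_near (sgpI sN sJ) (closedI cN cJ) (@subIsetr _ _ _) fi.
by apply: filterS2 n2 n3 => x h2 h3 /h2/h3[].
Qed.

End Clauses.

(** * Groups of germs *)

Section Germs.
Variables (G : topGroupType) (HG : ldgroup G).
Implicit Types (A B K R S T U V W N J D : set G) (x y u : G).
Let hG := ld_hausdorff HG.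
Hypothesis germG : equals_germ_group [set: G].

Lemma germ_eq A p q : germ A p = germ A q -> local_automorphisms A q -> same_germ A p q.
Proof.
move=> e lq; have : germ A q q; last by rewrite -e => -[].
split=> //; have [o1 _ _] := lq; exists (pm_dom q); split=> //.
Qed.

Lemma extend_by_identity R A B phi : cl R -> sgp A -> A `<=` R ->
  nbhs (1 : G) [set x | R x -> A x] -> sgp B -> B `<=` R ->
  nbhs (1 : G) [set x | R x -> B x] -> lemb A phi B ->
  (forall z, B z -> exists2 x, A x & phi x = z) ->
  exists g, R g /\ nbhs (1 : G) [set x | R x -> A x /\ phi x = g * x * g^-1].
Proof.
move=> cR sA AR nA sB BR nB [fM fB fI fC fO] fS.
have cP := cl_perp HG cR; have [rR _] := cR; have lR := reg_lnorm rR.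
have sP := perp_sgp R.
have comm x y : R x -> perp R y -> commute x y.
  by apply: (cl_commute HG cR cP); exact: perp_dj.
have uniq a c a' c' : R a -> R a' -> perp R c -> perp R c' -> a * c = a' * c' -> a = a' /\ c = c'.
  have [sR _ _] := lR; move=> Ra Ra' Pc Pc' e.
  have e1 : a'^-1 * a = c' * c^-1.
    by apply: (@mulIg _ c); rewrite -mulgA e !group_normE.
  have e2 : a'^-1 * a = 1.
    apply: (perp_dj HG lR); split; first by apply: sgpM => //; exact: sgpV.
    by rewrite e1; apply: sgpM => //; exact: sgpV.
  have ea : a = a' by apply: (@mulgI _ a'^-1); rewrite e2 mulVg.
  by split=> //; move: e; rewrite ea => /mulgI.
pose ext K := [set x | exists a c, [/\ K a, perp R c & x = a * c]].
have sgE K : sgp K -> K `<=` R -> sgp (ext K).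
  move=> sK KR; split; first by exists 1, 1; split; [exact: sgp1|exact: (sgp1 sP)|rewrite mulg1].
  - move=> _ _ [a [c [Ka Pc ->]]] [a' [c' [Ka' Pc' ->]]].
    exists (a * a'), (c * c'); split; [exact: sgpM|exact: sgpM|].
    by rewrite -!mulgA; congr (_ * _); rewrite !mulgA (comm a' c)//; exact: KR.
  - move=> _ [a [c [Ka Pc ->]]]; exists a^-1, c^-1; split; [exact: sgpV|exact: sgpV|].
    by rewrite comm ?invgM//; exact: KR.
have nE K : nbhs (1 : G) [set x | R x -> K x] -> nbhs (1 : G) (ext K).
  move=> nK; apply: filterS (perp_mul_near HG lR nK) => _ [a [c [[Ra ha] [Pc _] ->]]].
  by exists a, c; split=> //; exact: ha.
(* By [uniq] the factorization is unique, so choosing one defines the extension; off [ext A] the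
   pair [(1, 1)] is a dummy value. *)
have /choice[p pP] x : exists p : G * G, ext A x -> [/\ A p.1, perp R p.2 & x = p.1 * p.2].
  have [[a [c [Aa Pc e]]]|nx] := pselect (ext A x); last by exists (1, 1).
  by exists (a, c).
pose F x := phi (p x).1 * (p x).2.
have FE a c : A a -> perp R c -> F (a * c) = phi a * c.
  move=> Aa Pc; have [|Ap Pp e] := pP (a * c); first by exists a, c.
  by have [e1 e2] := uniq _ _ _ _ (AR _ Aa) (AR _ Ap) Pc Pp e; rewrite /F -e1 -e2.
have phi1 : phi 1 = 1 by apply: (@mulgI _ (phi 1)); rewrite -fM ?mulg1//; exact: sgp1.
have lF : lemb (ext A) F (ext B).
  split.
  - move=> _ _ [a [c [Ka Pc ->]]] [a' [c' [Ka' Pc' ->]]].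
    have -> : a * c * (a' * c') = (a * a') * (c * c').
      by rewrite -!mulgA; congr (_ * _); rewrite !mulgA (comm a' c)//; exact: AR.
    have -> : F (a * a' * (c * c')) = phi (a * a') * (c * c') by apply: FE; exact: sgpM.
    rewrite !FE//.
    rewrite fM// -!mulgA; congr (_ * _); rewrite !mulgA (comm (phi a') c)//.
    by apply: BR; exact: fB.
  - move=> _ [a [c [Ka Pc ->]]]; rewrite FE//; exists (phi a), c; split=> //; exact: fB.
  - move=> _ [a [c [Ka Pc ->]]]; rewrite FE// => e.
    have R1 : R 1 by case: lR => -[].
    have e' : phi a * c = 1 * 1 by rewrite mulg1.
    have [e1 ->] := uniq _ _ _ _ (BR _ (fB _ Ka)) R1 Pc (sgp1 sP) e'.
    by rewrite (fI _ Ka e1) mulg1.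
  - move=> W nW; have [V [sV nV _ VW]] := ld_base HG nW.
    apply: filterS (perp_mul_near HG lR (filterI (filterI nA (fC _ nV)) nV)).
    move=> _ [a [c [[Ra [[hA hf] _]] [Pc [_ Vc]] ->]]] _.
    have Aa := hA Ra; rewrite /= FE//; apply: VW; apply: sgpM => //; exact: hf.
  - move=> W nW; have [V [sV nV _ VW]] := ld_base HG nW.
    apply: filterS (perp_mul_near HG lR (filterI (filterI nB (fO _ nV)) nV)).
    move=> _ [b [c [[Rb [[hB hf] _]] [Pc [_ Vc]] ->]]] _.
    have [a [Aa Va <-]] := hf (hB Rb).
    exists (a * c); split; [by exists a, c|by apply: VW; exact: sgpM|exact: FE].
have isoF : top_iso (ext A) (ext B) F.
  apply: lemb_top_iso lF _; [exact: sgE|exact: sgE|].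
  move=> _ [b [c [/fS[a Aa <-] Pc ->]]]; exists (a * c); first by exists a, c.
  exact: FE.
pose q := PartialMap (ext A) (ext B) F.
have lq : local_automorphisms [set: G] q.
  by split=> //; apply/openT_sgp; split; [exact: sgE|exact: nE|exact: sgE|exact: nE].
have : germ_group [set: G] (germ [set: G] q) by exists q.
case: germG => _ <- [g _ /germ_eq /(_ lq) [O [/openT_sgp[sO nO] _ OE OF]]].
(* The extension is the identity on [perp R], so [g] centralises [perp R] near 1 and lies in
   [perp (perp R)], which is [R]. *)
have Rg : R g.
  rewrite -(regE HG rR); apply: filterS nO => c Oc Pc.
  have A1 : A 1 by exact: sgp1.
  have := OF _ Oc; rewrite /= -{2}[c]mul1g FE// phi1 mul1g => e.
  by rewrite /commute -{2}e !group_normE.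
exists g; split=> //; apply: filterS2 nO nA => x Ox hA Rx; have Ax := hA Rx.
split=> //; have := OF _ Ox; rewrite /= -{2}[x]mulg1 FE// ?mulg1//.
exact: sgp1.
Qed.

Lemma cl_conj_lemb R g : cl R -> lemb R (fun x => g * x * g^-1) R.
Proof.
move=> cR; split.
- by move=> x y _ _; rewrite !group_normE.
- by move=> x Rx; exact: (cl_nz HG).
- by move=> x _ e; apply: (@mulgI _ g); apply: (@mulIg _ g^-1); rewrite e !group_normE.
- move=> W nW; apply: filterS (nbhs1_cj g^-1 nW) => x; rewrite /cj/= !group_normE => h _; exact: h.
- move=> W nW; apply: filterS (nbhs1_cj g nW) => x; rewrite /cj/= => h Rx.
  exists (g^-1 * x * g); split=> //; last by rewrite !group_normE.
  by have := cl_nz HG g^-1 cR Rx; rewrite invgK.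
Qed.

Lemma cl_conj_surj R g : cl R -> forall z, R z -> exists2 x, R x & g * x * g^-1 = z.
Proof.
move=> cR z Rz; exists (g^-1 * z * g); last by rewrite !group_normE.
by have := cl_nz HG g^-1 cR Rz; rewrite invgK.
Qed.

(** Near 1, conjugation by [g] acts on each [M i] like conjugation by some [h i] in [M i]. The
    quotient of [g] by the product of the [h i] then centralises a neighbourhood of 1, so it is
    trivial. *)
Lemma germ_product n (M : 'I_n -> set G) :
  (forall i, cl (M i)) -> (forall i j, i != j -> dj (M i) (M j)) ->
  (forall W, nbhs (1 : G) W -> nbhs (1 : G) [set x | exists2 f : 'I_n -> G,
      (forall i, M i (f i) /\ W (f i)) & x = prodI f]) ->
  forall g, exists2 f : {ptws 'I_n -> G}, boxI M f & g = prodI f.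
Proof.
move=> cM dM nM g.
have sM i : sgp (M i) by case: (cM i) => -[[]].
have comm i j x y : i != j -> M i x -> M j y -> commute x y.
  by move=> /dM; apply: cl_commute.
have /choice[h hP] i : exists t, M i t /\ nbhs (1 : G)
    [set x | M i x -> g * x * g^-1 = t * x * t^-1].
  have nn : nbhs (1 : G) [set x | M i x -> M i x] by apply: filterS filterT => x _.
  have [t [Mt nt]] := extend_by_identity (cM i) (sM i) (@subset_refl _ _) nn (sM i) (@subset_refl _ _) nn
     (cl_conj_lemb g (cM i)) (cl_conj_surj g (cM i)).
  by exists t; split=> //; apply: filterS nt => x ht Mx; case: (ht Mx).
have Mh : boxI M h by move=> i; case: (hP i).
exists h => //.
suff : (prodI h)^-1 * g = 1.
  by move=> e; apply: (@mulgI _ (prodI h)^-1); rewrite e mulVg.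
apply: (ld_qz HG).
have nI : nbhs (1 : G) [set x | forall i, M i x -> g * x * g^-1 = h i * x * (h i)^-1].
  by apply: filter_forall => i; case: (hP i).
apply: filterS (nM _ nI) => _ [f fP ->]; apply: commute_prod => i _.
have [Mf /(_ i Mf) e] := fP i.
have lM := reg_lnorm (cM i).1.
pose r := prodI (fun j => if j == i then 1 else h j).
have eh : prodI h = h i * r := prodI_split sM comm i Mh.
have pr : perp (M i) r.
  apply: prodI_in; first exact: perp_sgp.
  move=> j; case: ifP => [_|/negbT ji]; first exact: (sgp1 (perp_sgp (M i))).
  apply: (dj_perp HG lM (reg_lnorm (cM j).1) _ (Mh j)).
  by apply: dM; rewrite eq_sym.
have c : commute (f i) r := perp_commute HG lM Mf pr (cl_nz HG r (cM i)).
have e2 : g * f i * g^-1 = prodI h * f i * (prodI h)^-1.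
  by rewrite e eh -!mulgA; congr (_ * _); rewrite invgM !mulgA -c !group_normE.
rewrite /commute; apply: (@mulgI _ (prodI h)); rewrite !mulgA mulgV mul1g.
by apply: (@mulIg _ g^-1); rewrite e2 !group_normE.
Qed.

Lemma germ_factor R : cl R -> equals_germ_group R.
Proof.
move=> cR; have [rR _] := cR; have lR := reg_lnorm rR; have [sR clR nR] := lR.
split.
  apply/seteqP; split=> [x [Rx oC]|_ ->]; last first.
    split; first exact: sgp1.
    have -> : R `&` [set g | commute g 1] = R.
      by apply/seteqP; split=> [x []//|x Rx]; split=> //; exact: commute1.
    by case: (open_subgroup_refl sR).
  apply: (perp_dj HG lR); split=> //.
  have /(open_in_nbhs oC) : (R `&` [set g | commute g x]) 1.
    by split; [exact: sgp1|exact/commute_sym/commute1].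
  by apply: filterS => y; rewrite /= mul1g => h /h[_ /commute_sym].
have oR := open_subgroup_refl sR.
have lc g : R g -> local_automorphisms R (PartialMap R R (fun x => g * x * g^-1)).
  by move=> Rg; split=> //; exact: lemb_top_iso (cl_conj_lemb g cR) (cl_conj_surj g cR).
apply/seteqP; split=> [_ [g Rg <-]|_ [p lp <-]].
  by exists (PartialMap R R (fun x => g * x * g^-1)) => //; exact: lc.
have [[/subgroupP[sA AR] oA] [/subgroupP[sB BR] oB] iso] := lp.
have [le lS] := top_iso_lemb sA sB iso.
have nA := (open_in_sgp sR sA AR).1 oA; have nB := (open_in_sgp sR sB BR).1 oB.
have [g [Rg ng]] := extend_by_identity cR sA AR nA sB BR nB le lS.
exists g => //.
have [V [sV nV _ VW]] := ld_base HG ng.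
have same : same_germ R (PartialMap R R (fun x => g * x * g^-1)) p.
  exists (R `&` V); split=> //=.
  - split; first by apply/subgroupP; split=> [|x []//]; exact: sgpI.
    apply: (sgp_open_in sR (sgpI sR sV) (@subIsetl _ _ _)).
    by apply: filterS nV => x Vx Rx.
  - by move=> x [Rx /VW h]; case: (h Rx).
  - by move=> x [Rx /VW h]; case: (h Rx).
have tr q1 q2 q3 : same_germ R q1 q2 -> same_germ R q1 q3 -> same_germ R q2 q3.
  move=> [O1 [[/subgroupP[s1 t1] o1] d1 d2 e1]] [O2 [[/subgroupP[s2 t2] o2] d3 d4 e2]].
  exists (O1 `&` O2); split.
  - split; first by apply/subgroupP; split=> [|x [/t1]//]; exact: sgpI.
    have m1 := (open_in_sgp sR s1 t1).1 o1; have m2 := (open_in_sgp sR s2 t2).1 o2.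
    apply: (sgp_open_in sR (sgpI s1 s2) (subset_trans (@subIsetl _ _ _) t1)).
    by apply: filterS2 m1 m2 => x h1 h2 Rx; split; auto.
  - by move=> x [/d2].
  - by move=> x [_ /d4].
  - by move=> x [h1 h2]; rewrite -e1// e2.
have same' : same_germ R p (PartialMap R R (fun x => g * x * g^-1)).
  by have [O [a b c d]] := same; exists O; split=> // x /d.
by apply/seteqP; split=> q [lq sq]; split=> //; [exact: tr same sq|exact: tr same' sq].
Qed.

(** Conjugation by [j] in [J], read in [R] through [f], is a local automorphism and so is induced by
    a unique [th j] in [R]. The map [th] is a homomorphism inverting [f] on its image, hence
    continuous, and its image is the required compact open subgroup. Being a quotient of [J], it
    inherits just infiniteness. *)
Lemma just_infinite_envelope R (J : topGroupType) (O : set G) (f : G -> J) :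
  cl R -> R <> [set 1] -> compact [set: J] -> just_infinite [set: J] ->
  sgp O -> O `<=` R -> nbhs (1 : G) [set x | R x -> O x] -> lemb O f setT ->
  exists U, compact_open_subgroup R U /\ just_infinite U.
Proof.
move=> cR R1 cJ [infJ jiJ] sO OR nO [fM _ fI fC fO]; have [rR _] := cR.
have lR := reg_lnorm rR; have [sR clR _] := lR.
have fV x : O x -> f x^-1 = (f x)^-1 by exact: homV.
have finj x y : O x -> O y -> f x = f y -> x = y by exact: hom_inj.
have f1 := hom1 sO fM.
(* [rel t j]: near 1, [f] carries conjugation by [t] to conjugation by [j]. *)
pose rel (t : G) (j : J) := nbhs (1 : G)
  [set x | R x -> [/\ O x, O (t * x * t^-1) & f (t * x * t^-1) = j * f x * j^-1]].
have relO x : O x -> rel x (f x).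
  move=> Ox; apply: filterS nO => y hy Ry; have Oy := hy Ry; have Ox' := sgpV sO Ox.
  have Oxy := sgpM sO Ox Oy.
  by split=> //; [exact: sgpM|rewrite !fM// fV].
have rel_uniq t t' j : R t -> R t' -> rel t j -> rel t' j -> t = t'.
  move=> Rt Rt' h h'; suff : t'^-1 * t = 1.
    by move=> e; apply: (@mulgI _ t'^-1); rewrite e mulVg.
  apply: (perp_dj HG lR); split; first by apply: sgpM => //; exact: sgpV.
  apply: filterS2 h h' => x hx hx' Rx; have [_ O1 e1] := hx Rx; have [_ O2 e2] := hx' Rx.
  have e : t * x * t^-1 = t' * x * t'^-1 by apply: finj => //; rewrite e1 e2.
  rewrite /commute; apply: (@mulgI _ t'); apply: (@mulIg _ t^-1).
  by rewrite !group_normE e.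
have relM t j t' j' : R t' -> rel t j -> rel t' j' -> rel (t * t') (j * j').
  move=> Rt' h h'; apply: filterS2 (nbhs1_cj t'^-1 h) h' => x.
  rewrite /cj/= invgK => hx hx' Rx; have [O1 O2 e2] := hx' Rx.
  have Rx' : R (t' * x * t'^-1) by exact: OR.
  have := hx Rx'; rewrite !group_normE => -[_ O3 e3]; split=> //.
  by rewrite e3 e2 !group_normE.
have relex j : exists t, R t /\ rel t j.
  pose img := f @` O.
  have [g [gP gf gM]] := hom_inverse sO fM fI (erefl img).
  have sI : sgp img by exact: sgp_image.
  have nI : nbhs (1 : J) img.
    by apply: filterS (fO _ filterT) => z /(_ Logic.I) [x [Ox _ <-]]; exists x.
  (* The part of [O] on which conjugation by [j] stays in the image of [f]; it is the domain of the
     local automorphism [phi j]. *)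
  pose A (j : J) := O `&` f @^-1` cj j^-1 img.
  have AE k x : O x -> img (k * f x * k^-1) -> A k x by rewrite /A/cj/= invgK.
  have sA k : sgp (A k) by apply: sgp_preimage => //; exact: cj_sgp.
  have nA k : nbhs (1 : G) [set x | R x -> A k x].
    apply: filterS2 nO (fC _ (nbhs1_cj k^-1 nI)) => x hO hf Rx; have Ox := hO Rx.
    by split=> //; exact: hf.
  pose phi k x := g (k * f x * k^-1).
  have phiP k x : A k x -> O (phi k x) /\ f (phi k x) = k * f x * k^-1.
    by move=> [Ox]; rewrite /cj/= invgK => ix; apply: gP.
  have phiA k x : A k x -> A k^-1 (phi k x).
    move=> Ax; have [Op e] := phiP _ _ Ax; apply: AE => //; rewrite e !group_normE.
    by exists x => //; case: Ax.
  have phiK k x : A k x -> phi k^-1 (phi k x) = x.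
    move=> Ax; have [Op e] := phiP _ _ Ax; rewrite /phi -/(phi k x) e !group_normE.
    by apply: gf; case: Ax.
  have phiC k W : nbhs (1 : G) W -> nbhs (1 : G) [set x | A k x -> W (phi k x)].
    move=> nW; have := fC _ (nbhs1_cj k^-1 (fO _ nW)).
    apply: filterS => x hx Ax; have [Ox ix] := Ax; have := hx Ox; rewrite /cj/= invgK.
    by move=> /(_ Logic.I) [y [Oy Wy e]]; rewrite /phi -e gf.
  have phiV z : A j^-1 z -> A j (phi j^-1 z) /\ phi j (phi j^-1 z) = z.
    by move=> Az; have := phiA _ _ Az; have := phiK _ _ Az; rewrite invgK.
  have lp : lemb (A j) (phi j) (A j^-1).
    split.
    - move=> x y Ax Ay; have [Ox ex] := phiP _ _ Ax; have [Oy ey] := phiP _ _ Ay.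
      have Axy := sgpM (sA j) Ax Ay; have [Oxy exy] := phiP _ _ Axy.
      apply: finj => //; first exact: sgpM.
      have [O1 _] := Ax; have [O2 _] := Ay.
      by rewrite exy (fM (phi j x))// ex ey fM// !group_normE.
    - exact: phiA.
    - move=> x Ax e; rewrite -(phiK _ _ Ax) e /phi f1 mulg1 mulgV -f1.
      by apply: gf; exact: sgp1.
    - exact: phiC.
    - move=> W nW; apply: filterS (phiC j^-1 _ nW) => z hz Az; have [Ap e] := phiV _ Az.
      by exists (phi j^-1 z); split=> //; exact: hz.
  have AR k : A k `<=` R by move=> x [/OR].
  have sp z : A j^-1 z -> exists2 x, A j x & phi j x = z.
    by move=> /phiV[Ap e]; exists (phi j^-1 z).
  have [t [Rt nt]] := extend_by_identity cR (sA j) (AR j) (nA j) (sA _) (AR _) (nA _) lp sp.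
  exists t; split=> //; apply: filterS nt => x ht Rx; have [Ax e] := ht Rx.
  by have [Op ep] := phiP _ _ Ax; rewrite -e; split=> //; case: Ax.
have /choice[th thP] := relex.
have thM (x y : J) : th (x * y) = th x * th y.
  have [R1' h1] := thP x; have [R2' h2] := thP y; have [R3' h3] := thP (x * y).
  by apply: (rel_uniq _ _ (x * y)) => //; [exact: sgpM|exact: relM].
have thf x : O x -> th (f x) = x.
  move=> Ox; have [R1' h1] := thP (f x).
  by apply: (rel_uniq _ _ (f x)) => //; [exact: OR|exact: relO].
have thC W : nbhs (1 : G) W -> nbhs (1 : J) [set j | W (th j)].
  by move=> nW; apply: filterS (fO _ nW) => j /(_ Logic.I) [x [Ox Wx <-]]; rewrite /= thf.
pose U := [set th j | j in [set: J]].
have thT : hom_on [set: J] U th.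
  apply/hom_onP => //; split=> // [j _|W /thC]; first by exists j.
  by apply: filterS => j h _.
have cU : compact U by apply: continuous_compact => //; case: thT.
have sU : sgp U by apply: sgp_image.
have UR : U `<=` R by move=> _ [j _ <-]; case: (thP j).
have OU : O `<=` U by move=> x Ox; exists (f x) => //; exact: thf.
exists U; split.
  split=> //; split; first exact/subgroupP.
  by apply: sgp_open_in => //; apply: filterS nO => x h /h/OU.
split.
  move=> finU; apply: R1; apply: sgp_triv => // x Rx.
  apply: (discrete_lnorm HG lR) => //.
  by apply: filterS2 nO (finite_near1 hG finU) => z h1 h2 /h1/OU/h2.
move=> N [/subgroupP[sN NU] nN] /(closed_inP _ (compact_closed hG cU))[_ cN] N1.
pose N' := th @^-1` N.
have sN' : sgp N' by rewrite -[N']setTI; apply: sgp_preimage.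
have cN' : closed N'.
  have thc : continuous th by apply/continuous_subspace_setT; case: thT.
  by apply: preimage_closed => [j _|]; [exact: thc|exact: cN].
have fi : finite_index [set: J] N'.
  apply: jiJ.
  - split; first exact/subgroupP.
    have nz' (y : J) : nz N' y.
      move=> x Nx; rewrite /N'/= !thM (homV (sgpT J))//.
      have : normaliser N (th y) by apply: nN; exists y.
      by rewrite normaliserE => -[h _]; exact: h.
    by move=> x _; rewrite normaliserE.
  - exact/closed_inP.
  - have [_ [[j _ <-] Nj] x1] : exists2 x, (U x /\ N x) & x <> 1.
      by have [x Nx x1] := sgp_nt sN N1; exists x => //; split=> //; exact: NU.
    by move=> e; apply: x1; have : N' j by []; rewrite e => ->; exact: hom1 (sgpT J) _.
have n1 := finite_index_near sN' cN' (@subsetT _ _) fi.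
apply: near_finite_index => //.
have n2 : nbhs (1 : J) N' by apply: filterS n1 => j h; exact: h.
apply: filterS2 nO (fC _ n2) => x h1 h2 /UR/h1 Ox.
by have := h2 Ox; rewrite /N'/= thf.
Qed.

End Germs.

(** * The just infinite wreath product *)

(** All base subgroups are normal in the whole group. This makes the operations continuous at once,
    and it is available since the group built below is profinite. *)
Record filtered_group := FilteredGroup {
  fg_sort :> groupType;
  fg_base : set (set fg_sort);
  fg_base_nonempty : exists N, fg_base N;
  fg_base_directed : forall N N', fg_base N -> fg_base N' ->
    exists2 N'', fg_base N'' & N'' `<=` N `&` N';
  fg_base_sgp : forall N, fg_base N -> sgp N;
  fg_base_normal : forall N x, fg_base N -> nz N x
}.

(** A copy of the carrier that retains the filtration, so that the topology can be inferred from the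
    type. *)
Definition fgtop (X : filtered_group) : Type := fg_sort X.
HB.instance Definition _ X := Group.on (fgtop X).

Section FilteredGroupTopology.
Variable X : filtered_group.

Definition fg_nbhs (x : fgtop X) : set_system (fgtop X) :=
  [set A | exists2 N, @fg_base X N & forall y, N y -> A (x * y)].

Fact fg_nbhs_filter x : ProperFilter (fg_nbhs x).
Proof.
split.
  move=> [N bN h]; exact: h (sgp1 (fg_base_sgp bN)).
split.
- by have [N bN] := fg_base_nonempty X; exists N.
- move=> A B [N bN NA] [N' bN' NB]; have [N'' b s] := fg_base_directed bN bN'.
  by exists N'' => // y /s[h1 h2]; split; [exact: NA|exact: NB].
- by move=> A B AB [N bN NA]; exists N => // y /NA /AB.
Qed.

Fact fg_nbhs_singleton (x : fgtop X) A : fg_nbhs x A -> A x.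
Proof. by move=> [N bN /(_ 1 (sgp1 (fg_base_sgp bN)))]; rewrite mulg1. Qed.

Fact fg_nbhs_nbhs (x : fgtop X) A : fg_nbhs x A -> fg_nbhs x (fg_nbhs^~ A).
Proof.
move=> [N bN NA]; exists N => // y Ny; exists N => // z Nz.
by rewrite -mulgA; apply: NA; apply: (sgpM (fg_base_sgp bN)).
Qed.

HB.instance Definition _ := hasNbhs.Build (fgtop X) fg_nbhs.
HB.instance Definition _ := Nbhs_isNbhsTopological.Build (fgtop X)
  fg_nbhs_filter fg_nbhs_singleton fg_nbhs_nbhs.

Fact fg_mulg_continuous : continuous (fun x : fgtop X * fgtop X => x.1 * x.2).
Proof.
move=> [x y] A [N bN NA] /=.
exists ([set x * n | n in N], [set y * n | n in N]).
  by split; exists N => // n Nn; exists n.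
move=> [_ _] [/= [n Nn <-] [m Nm <-]] /=.
have -> : x * n * (y * m) = x * y * (y^-1 * n * y * m) by rewrite !group_normE.
apply: NA; apply: (sgpM (fg_base_sgp bN)) => //.
by have := @fg_base_normal X N y^-1 bN n Nn; rewrite invgK.
Qed.

Fact fg_invg_continuous : continuous (fun x : fgtop X => x^-1).
Proof.
move=> x A [N bN NA]; exists N => // n Nn /=.
have -> : (x * n)^-1 = x^-1 * (x * n^-1 * x^-1) by rewrite !group_normE.
by apply: NA; exact: (@fg_base_normal X N x bN n^-1 (sgpV (fg_base_sgp bN) Nn)).
Qed.

HB.instance Definition _ := Group_Topological_isTopGroup.Build (fgtop X)
  fg_mulg_continuous fg_invg_continuous.

Lemma fg_nbhs1P (A : set (fgtop X)) : nbhs (1 : fgtop X) A <-> exists2 N, fg_base N & N `<=` A.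
Proof.
by split=> -[N bN NA]; exists N => // y /NA; rewrite mul1g.
Qed.

Hypothesis sep : forall x : fgtop X, (forall N, @fg_base X N -> N x) -> x = 1.

Lemma fg_zero_dimensional : zero_dimensional (fgtop X).
Proof.
move=> x y xy.
have [N /not_implyP[bN nN]] : exists N, ~ (@fg_base X N -> N (x^-1 * y)).
  apply/existsNP => h; move/eqP: xy; apply.
  by apply: (@mulgI _ x^-1); rewrite mulVg (sep h).
have sN := fg_base_sgp bN.
have nbN : nbhs (1 : fgtop X) N by apply/fg_nbhs1P; exists N.
exists [set z : fgtop X | N (x^-1 * z * 1)]; split; last first.
- by rewrite /= mulg1.
- by rewrite /= mulg1 mulVg; exact: sgp1.
split.
  apply: open_comp; last exact: sgp_open.
  by move=> z _; exact: (@continuous_conj (fgtop X)).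
apply: preimage_closed; last exact: sgp_open_closed.
by move=> z _; exact: (@continuous_conj (fgtop X)).
Qed.

Lemma fg_totally_disconnected : totally_disconnected [set: fgtop X].
Proof. exact/zero_dimension_totally_disconnected/fg_zero_dimensional. Qed.

Lemma fg_hausdorff : hausdorff_space (fgtop X).
Proof.
move=> x y cl; apply: contrapT => /eqP /fg_zero_dimensional [U [[oU cU] Ux Uy]].
have [|z [Uz nUz]] := cl U (~` U) (open_nbhs_nbhs (conj oU Ux)).
  by apply: open_nbhs_nbhs; split => //; exact: closed_openC.
by [].
Qed.

End FilteredGroupTopology.

Record wreath_data (G : topGroupType) := WreathData {
  wW : set G;
  wY : set G;
  wW_sgp : sgp wW;
  wY_sgp : sgp wY;
  wW_nz : forall w, wW w -> nz wY w
}.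

Section Wreath.
Variables (G : topGroupType) (I : finType) (d : wreath_data G).
Local Notation W := (wW d).
Local Notation Y := (wY d).
Implicit Types (s t : {perm I}) (u v : I -> G).

(** Replacing elements outside [Y] by 1 makes a map on [I * G] depend only on its restriction to
    [I * Y]. *)
Definition wclip (y : G) : G := if pselect (Y y) then y else 1.

Lemma wclipE y : Y y -> wclip y = y.
Proof. by rewrite /wclip; case: pselect. Qed.
Lemma wclipY y : Y (wclip y).
Proof. by rewrite /wclip; case: pselect => //= h; exact: sgp1 (wY_sgp d). Qed.

(* Permutations of [I * Y] induced by the wreath product of [W] by [Sym I];
   outside [I * Y] the value is the one at [(i, 1)]. *)
Definition wmap s u : I * G -> I * G :=
  fun p => (s p.1, u p.1 * wclip p.2 * (u p.1)^-1).

(** Permutations multiply from left to right, hence [t * s] for [s] after [t]. *)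
Lemma wmap_comp s u t v : (forall i, W (v i)) ->
  wmap s u \o wmap t v = wmap (t * s) (fun i => u (t i) * v i).
Proof.
move=> Wv; apply/funext => -[i y]; rewrite /wmap /= permM; congr pair.
rewrite wclipE; first by rewrite !group_normE.
by apply: (wW_nz (Wv i)); exact: wclipY.
Qed.

Definition wset : set (I * G -> I * G) :=
  [set th | exists s u, (forall i, W (u i)) /\ th = wmap s u].

(** Elements are maps and not pairs [(s, u)]: this divides out the elements of [W] acting trivially
    on [Y] with no quotient group, and associativity is that of composition. *)
Definition wtype := {th : I * G -> I * G | th \in wset}.
HB.instance Definition _ := Choice.on wtype.

Fact wmap_in s u : (forall i, W (u i)) -> wmap s u \in wset.
Proof. by move=> Wu; apply/mem_set; exists s, u. Qed.

Definition wel s u : wtype :=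
  if pselect (forall i, W (u i)) is left Wu then exist (fun th => th \in wset) (wmap s u) (wmap_in s Wu)
  else exist (fun th => th \in wset) (wmap 1 (fun=> 1)) (wmap_in 1 (fun=> sgp1 (wW_sgp d))).

Lemma welE s u : (forall i, W (u i)) -> sval (wel s u) = wmap s u.
Proof. by rewrite /wel; case: pselect. Qed.

Lemma welP (x : wtype) : exists s u, (forall i, W (u i)) /\ x = wel s u.
Proof.
case: x => th h; have /set_mem [s [u [Wu e]]] := h; exists s, u; split=> //.
by apply: val_inj; rewrite /= welE.
Qed.

Fact wmul_in (x y : wtype) : sval x \o sval y \in wset.
Proof.
have [s [u [Wu ->]]] := welP x; have [t [v [Wv ->]]] := welP y.
rewrite !welE// wmap_comp//; apply: wmap_in => i.
by apply: (sgpM (wW_sgp d)); [exact: Wu|exact: Wv].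
Qed.
Definition wmul (x y : wtype) : wtype :=
  exist (fun th => th \in wset) (sval x \o sval y) (wmul_in x y).
Definition wone : wtype := wel 1 (fun=> 1).

Lemma wel_mul s u t v : (forall i, W (u i)) -> (forall i, W (v i)) ->
  wmul (wel s u) (wel t v) = wel (t * s) (fun i => u (t i) * v i).
Proof.
move=> Wu Wv; apply: val_inj; rewrite /= !welE ?wmap_comp// => i.
by apply: (sgpM (wW_sgp d)); [exact: Wu|exact: Wv].
Qed.

Fact welP_pair (x : wtype) : exists p : {perm I} * (I -> G),
  (forall i, W (p.2 i)) /\ x = wel p.1 p.2.
Proof. by have [s [u h]] := welP x; exists (s, u). Qed.

Definition winv (x : wtype) : wtype :=
  let p := sval (cid (welP_pair x)) in
  wel (p.1^-1)%g (fun i => (p.2 ((p.1^-1)%g i))^-1).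

Lemma winvP (x : wtype) : exists s u, [/\ forall i, W (u i), x = wel s u &
  winv x = wel (s^-1)%g (fun i => (u ((s^-1)%g i))^-1)].
Proof. by rewrite /winv; case: cid => -[s u] /= [Wu e]; exists s, u. Qed.

Let W1 : forall i : I, W ((fun=> 1) i). Proof. by move=> i; exact: sgp1 (wW_sgp d). Qed.

Fact wmulA : associative wmul.
Proof. by move=> x y z; apply: val_inj. Qed.
Fact wmul1 : left_id wone wmul.
Proof.
move=> x; have [s [u [Wu ->]]] := welP x; rewrite wel_mul// mulg1; congr wel.
by apply/funext => i; rewrite mul1g.
Qed.
Fact wmulr1 : right_id wone wmul.
Proof.
move=> x; have [s [u [Wu ->]]] := welP x; rewrite wel_mul// mul1g; congr wel.
by apply/funext => i; rewrite perm1 mulg1.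
Qed.
Fact wmulV : left_inverse wone winv wmul.
Proof.
move=> x; have [s [u [Wu -> ->]]] := winvP x; rewrite wel_mul//; last first.
  by move=> i; apply: (sgpV (wW_sgp d)).
rewrite mulgV; congr wel.
by apply/funext => i; rewrite permK mulVg.
Qed.
Fact wmulrV : right_inverse wone winv wmul.
Proof.
move=> x; have [s [u [Wu -> ->]]] := winvP x; rewrite wel_mul//; last first.
  by move=> i; apply: (sgpV (wW_sgp d)).
rewrite mulVg; congr wel.
by apply/funext => i; rewrite mulgV.
Qed.

HB.instance Definition _ := isGroup.Build wtype wmulA wmul1 wmulr1 wmulV wmulrV.

Lemma welM s u t v : (forall i, W (u i)) -> (forall i, W (v i)) ->
  wel s u * wel t v = wel (t * s) (fun i => u (t i) * v i).
Proof. exact: wel_mul. Qed.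
Lemma wel1 : wel 1 (fun=> 1) = 1. Proof. by []. Qed.

Definition wF (V : set G) : set wtype :=
  [set x | exists2 y, (forall i, Y (y i) /\ V (y i) /\ W (y i)) & x = wel 1 y].

(** The neighbourhoods of 1 in the base group of the wreath product. [V] is normalised by [W], so
    they are normal in the whole group. *)
Definition wbase : set (set wtype) :=
  [set N | exists V, [/\ sgp V, nbhs (1 : G) V, forall w, W w -> nz V w & N = wF V]].

Lemma wbase_sgp N : wbase N -> sgp N.
Proof.
move=> [V [sV _ _ ->]]; have sW := wW_sgp d; have sY := wY_sgp d; split.
- by exists (fun=> 1) => // i; split; [exact: sgp1|split; exact: sgp1].
- move=> _ _ [y hy ->] [z hz ->]; exists (fun i => y i * z i).
    by move=> i; have [? [? ?]] := hy i; have [? [? ?]] := hz i; split; [|split]; exact: sgpM.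
  rewrite welM; [|by move=> i; case: (hy i) => _ []|by move=> i; case: (hz i) => _ []].
  by rewrite mulg1; congr wel; apply/funext => i; rewrite perm1.
- move=> _ [y hy ->]; exists (fun i => (y i)^-1).
    by move=> i; have [? [? ?]] := hy i; split; [|split]; exact: sgpV.
  have Wy i : W (y i) by case: (hy i) => _ [].
  apply: (@mulgI _ (wel 1 y)); rewrite mulgV welM//; last by move=> i; exact: sgpV.
  rewrite mulg1 -wel1; congr wel.
  by apply/funext => i; rewrite perm1 mulgV.
Qed.

Lemma wel_conj s u y : (forall i, W (u i)) -> (forall i, W (y i)) ->
  wel s u * wel 1 y * (wel s u)^-1 =
  wel 1 (fun i => u ((s^-1)%g i) * y ((s^-1)%g i) * (u ((s^-1)%g i))^-1).
Proof.
move=> Wu Wy; have sW := wW_sgp d; apply: (@mulIg _ (wel s u)); rewrite mulgVK !welM//; last first.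
  by move=> i; apply: (sgpM sW); [apply: (sgpM sW)|apply: (sgpV sW)].
rewrite mul1g mulg1; congr wel; apply/funext => i.
by rewrite perm1 permK mulgVK.
Qed.

Lemma wbase_normal N x : wbase N -> nz N x.
Proof.
move=> [V [sV _ nV ->]] _ [y hy ->]; have [s [u [Wu ->]]] := welP x.
have sW := wW_sgp d.
rewrite wel_conj//; last by move=> i; case: (hy i) => _ [].
eexists; last reflexivity.
move=> i /=; have [h1 [h2 h3]] := hy ((s^-1)%g i).
split; [exact: wW_nz|split; [exact: nV|]].
by apply: (sgpM sW); [apply: (sgpM sW)|apply: (sgpV sW)].
Qed.

Lemma wbase_nonempty : exists N, wbase N.
Proof. by exists (wF setT), setT; split=> //; exact: filterT. Qed.

Lemma wbase_directed N N' : wbase N -> wbase N' ->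
  exists2 N'', wbase N'' & N'' `<=` N `&` N'.
Proof.
move=> [V [sV nV zV ->]] [V' [sV' nV' zV' ->]]; exists (wF (V `&` V')).
  exists (V `&` V'); split=> //; [exact: sgpI|exact: filterI|].
  by move=> w Ww; apply: nzI; split; [exact: zV|exact: zV'].
by move=> _ [y hy ->]; split; exists y => // i; have [? [[? ?] ?]] := hy i.
Qed.

Definition wreath_filtered := FilteredGroup wbase_nonempty wbase_directed wbase_sgp wbase_normal.
Definition wreath := fgtop wreath_filtered.
HB.instance Definition _ := TopGroup.on wreath.

End Wreath.

(** * The wreath product of a tile is profinite and just infinite *)

Section JustInfinite.
Variables (G : topGroupType) (HG : ldgroup G) (I : finType) (i0 : I).
Variables (U V E : set G).
Hypotheses (coU : co U) (coV : co V) (VU : V `<=` U) (nV : forall u, U u -> nz V u).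
Hypotheses (rE : reg E) (E1 : E <> [set 1]) (irrE : irreducible_under U E).
Let hG := ld_hausdorff HG.
Let lE : lnorm E := reg_lnorm rE.
Let sE : sgp E. Proof. by case: lE. Qed.
Let sU : sgp U. Proof. by case: coU. Qed.
Let sV : sgp V. Proof. by case: coV. Qed.
Let nbU : nbhs (1 : G) U. Proof. by case: coU. Qed.
Let nbV : nbhs (1 : G) V. Proof. by case: coV. Qed.

Let W := U `&` [set u | nz E u /\ nz E u^-1].
Let Y := E `&` V.

Fact stab_sgp : sgp W.
Proof. by apply: sgpI => //; have := normaliser_sgp E; rewrite normaliserE. Qed.
Fact Y_sgp : sgp Y. Proof. exact: sgpI. Qed.
Fact W_nzY w : W w -> nz Y w.
Proof. by move=> [Uw [n _]]; apply: nzI; split=> //; exact: nV. Qed.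

Let d := WreathData stab_sgp Y_sgp W_nzY.
Definition block_wreath := wreath I d.
Local Notation J := block_wreath.
Let el s (u : I -> G) : J := wel d s u.
Let io (u : {ptws I -> G}) : J := el 1%g u.

Let YW : Y `<=` W.
Proof.
move=> y [Ey Vy]; split; first exact: VU.
by split; apply: nz_sgp => //; exact: sgpV.
Qed.
Let nbW : nbhs (1 : G) W.
Proof. by apply: filterI => //; apply: nbhs_nzV; case: lE. Qed.
Let nbY : nbhs (1 : G) [set x | E x -> Y x].
Proof. by apply: filterS nbV => x Vx Ex. Qed.
Let cY : compact Y.
Proof. by rewrite /Y setIC; apply: compact_closedI; [case: coV|case: lE]. Qed.
Let cW : compact W.
Proof.
have [_ _ cU] := coU; apply: compact_closedI => //.
have := normaliser_sgp E; rewrite normaliserE => s.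
by apply: sgp_open_closed => //; apply: nbhs_nzV; case: lE.
Qed.

Let io_mul u v : boxI (fun=> W) u -> boxI (fun=> W) v -> io (u * v) = io u * io v.
Proof.
move=> Wu Wv; rewrite /io /el; rewrite welM// mulg1; congr wel.
by apply/funext => i; rewrite perm1.
Qed.
Let io_1 : io 1 = 1. Proof. by []. Qed.
Let io_V u : boxI (fun=> W) u -> io u^-1 = (io u)^-1.
Proof.
move=> Wu; have sWb : sgp (boxI (fun _ : I => W)) by apply: sgp_boxI => j; exact: stab_sgp.
by apply: (@mulgI _ (io u)); rewrite -io_mul ?mulgV//; exact: (sgpV sWb Wu).
Qed.
Let boxYW (u : {ptws I -> G}) : boxI (fun=> Y) u -> boxI (fun=> W) u.
Proof. by move=> h i; apply: YW. Qed.

Let central y : (forall z, Y z -> y * z * y^-1 = z) -> perp E y.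
Proof.
move=> h; apply: filterS nbY => z hz Ez; rewrite /commute.
by apply: (@mulIg _ y^-1); rewrite h ?mulgK//; exact: hz.
Qed.

Lemma wel_eq s u t v : boxI (fun=> W) u -> boxI (fun=> W) v -> el s u = el t v <->
  forall i, s i = t i /\ forall y, Y y -> u i * y * (u i)^-1 = v i * y * (v i)^-1.
Proof.
move=> Wu Wv; split.
  move=> /(congr1 sval); rewrite !welE// => e i; split.
    by have := congr1 (fun f => (f (i, 1)).1) e.
  by move=> y Yy; have := congr1 (fun f => (f (i, y)).2) e; rewrite /wmap /= wclipE.
move=> h; apply: val_inj; rewrite /= !welE//.
apply/funext => -[i y]; rewrite /wmap /=; have [-> hy] := h i.
by rewrite hy//; exact: (@wclipY _ d).
Qed.

Let io_inj u v : boxI (fun=> Y) u -> boxI (fun=> Y) v -> io u = io v -> u = v.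
Proof.
move=> Yu Yv /(wel_eq 1%g 1%g (boxYW Yu) (boxYW Yv)) h; apply: ptwsP => i.
have [_ hi] := h i; suff e : (v i)^-1 * u i = 1.
  by apply: (@mulgI _ (v i)^-1); rewrite e mulVg.
have [Eu _] := Yu i; have [Ev _] := Yv i.
apply: (perp_dj HG lE); split; first by apply: sgpM => //; exact: sgpV.
apply: central => z Yz; apply: (@mulgI _ (v i)); apply: (@mulIg _ (v i)^-1).
by have := hi z Yz; rewrite !group_normE => ->.
Qed.

Let J_nbhs1P (A : set J) : nbhs (1 : J) A <->
  exists V', [/\ sgp V', nbhs (1 : G) V', forall w, W w -> nz V' w & @wF G I d V' `<=` A].
Proof.
split=> [/fg_nbhs1P [_ [V' [s n z ->]] h]|[V' [s n z h]]]; first by exists V'.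
by apply/fg_nbhs1P; exists (@wF G I d V') => //; exists V'.
Qed.

Lemma io_lemb : lemb (boxI (fun _ : I => Y)) io setT.
Proof.
split=> //.
- by move=> u v Yu Yv; apply: io_mul; exact: boxYW.
- by move=> u Yu; rewrite -io_1; apply: io_inj => // i; exact: sgp1 Y_sgp.
- move=> A /J_nbhs1P[V' [sV' nV' zV' h]].
  apply: filterS (nbhs_boxI I nV') => u Vu Yu; apply: h; exists u => // i.
  by split; [exact: Yu|split; [exact: Vu|exact: YW]].
- move=> A /ptws_nbhs1P[A' nA' hA]; have [V' [[s n _] _ V'A z]] := normal_core HG coU nA'.
  apply/J_nbhs1P; exists V'; split=> // [w [Uw _]|_ [y hy ->] _]; first exact: z.
  exists (y : {ptws I -> G}); split=> //; first by move=> i; case: (hy i).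
  by apply: hA => i; apply: V'A; case: (hy i) => _ [].
Qed.

Let J_sep (x : J) : (forall N, @fg_base (wreath_filtered I d) N -> N x) -> x = 1.
Proof.
move=> h.
have [|y hy e] := h (@wF G I d setT); first by exists setT; split=> //; exact: filterT.
have Yy : boxI (fun=> Y) (y : {ptws I -> G}) by move=> i; case: (hy i).
rewrite e -io_1 /io; congr wel; apply/funext => i.
apply: contrapT => y1.
have [V' [[s n _] _ V'A z]] := normal_core HG coU (nbhs1_neq (ld_hausdorff HG) y1).
have [|y' hy' e'] := h (@wF G I d V').
  by exists V'; split=> // w [Uw _]; exact: z.
have Yy' : boxI (fun=> Y) (y' : {ptws I -> G}) by move=> j; case: (hy' j).
have ey : y = y' by apply: (io_inj Yy Yy'); rewrite /io /el -e -e'.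
by have [_ [/V'A + _]] := hy' i; apply; rewrite ey.
Qed.

Let hJ : hausdorff_space J. Proof. exact: fg_hausdorff. Qed.
Let tdJ : totally_disconnected [set: J]. Proof. exact: fg_totally_disconnected. Qed.

(** Near 1, an element of [W] is a product of a small [y] in [Y] and an element of [perp E] that
    centralises [Y], so it acts as [y]. Hence [Y] has open image in the group that [W] induces. *)
Let io_hom : hom_on (boxI (fun _ : I => W)) [set: J] io.
Proof.
apply/hom_onP; first by apply: sgp_boxI => i; exact: stab_sgp.
split=> // A /J_nbhs1P[V' [sV' nV' zV' h]].
have [_ _ nE] := lE.
have n : nbhs (1 : G) [set w | W w -> exists y, [/\ Y y, V' y & forall z, Y z -> w * z * w^-1 = y * z * y^-1]].
  apply: filterS (perp_mul_near HG lE (filterI (filterI nV' nbV) nE)).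
  move=> _ [y [p [[Ey [[V'y Vy] _]] [pp [_ np]] ->]]] _; exists y; split=> // z [Ez _].
  have c : commute z p := perp_commute HG lE Ez pp np.
  by rewrite invgM -!mulgA; congr (_ * _); rewrite !mulgA -c !group_normE.
apply: filterS (nbhs_boxI I n) => u hu Wu; apply: h.
have /choice[y yP] i := hu i (Wu i).
have Wy : boxI (fun=> W) (y : {ptws I -> G}) by move=> i; apply: YW; case: (yP i).
exists y; first by move=> i; have [? ? _] := yP i; split=> //; split=> //; exact: Wy.
by apply/wel_eq => // i; split=> //; case: (yP i).
Qed.

(** One translate of the compact image of [W^I] for each of the finitely many permutations. *)
Let cJ : compact [set: J].
Proof.
have cs s : compact [set el s u | u in boxI (fun _ : I => W)].
  have -> : [set el s u | u in boxI (fun _ : I => W)] =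
      (fun z => el s (fun=> 1) * z * 1) @` (io @` boxI (fun _ : I => W)).
    have W1 (i : I) : W 1 by exact: sgp1 stab_sgp.
    have es u : boxI (fun _ : I => W) u -> el s u = el s (fun=> 1) * io u * 1.
      move=> Wu; rewrite mulg1 /io /el; rewrite welM// mul1g; congr wel.
      by apply/funext => i; rewrite mul1g.
    apply/seteqP; split=> [_ [u Wu <-]|_ [_ [u Wu <-] <-]].
      by exists (io u); [exists u|rewrite -es].
    by exists u => //; rewrite -es.
  apply: continuous_compact; first by apply: continuous_subspaceT; exact: (@continuous_conj J).
  apply: continuous_compact; first by case: io_hom.
  by apply: compact_boxI => i; exact: cW.
have cl (l : seq {perm I}) : compact [set x : J | exists s u, [/\ s \in l, boxI (fun _ : I => W) u & x = el s u]].
  elim: l => [|s l IH].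
    rewrite (_ : [set x | _] = set0); first exact: compact0.
    by apply/seteqP; split=> x // -[s [u []]].
  rewrite (_ : [set x | _] = [set el s u | u in boxI (fun _ : I => W)] `|`
     [set x : J | exists s u, [/\ s \in l, boxI (fun _ : I => W) u & x = el s u]]).
    exact: compactU.
  apply/seteqP; split=> x.
    move=> [t [u [+ Wu ->]]]; rewrite inE => /orP[/eqP ->|tl]; first by left; exists u.
    by right; exists t, u.
  move=> [[u Wu <-]|[t [u [tl Wu ->]]]]; first by exists s, u; rewrite mem_head.
  by exists t, u; rewrite inE tl orbT.
rewrite (_ : [set: J] = [set x : J | exists s u, [/\ s \in enum {perm I}, boxI (fun _ : I => W) u & x = el s u]]) //.
apply/seteqP; split=> x // _; have [s [u [Wu ->]]] := welP x.
by exists s, u; rewrite mem_enum.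
Qed.

Lemma block_wreath_profinite : profinite J.
Proof. by []. Qed.

Let de_box (A : set G) i y : sgp A -> A y -> boxI (fun=> A) (single i y : {ptws I -> G}).
Proof. by move=> sA; apply: single_box => j; exact: sgp1. Qed.

(** An abelian [Y] would lie in [perp E] as well as in [E], and [E] would be discrete. *)
Let nt_Y : exists y z, [/\ Y y, Y z & y * z * y^-1 * z^-1 <> 1].
Proof.
apply: contrapT => h; apply: E1; apply: sgp_triv => // x Ex.
apply: (discrete_lnorm HG lE) => //; apply: filterS nbY => y hy Ey; have Yy := hy Ey.
apply: (perp_dj HG lE); split=> //; apply: central => z Yz.
suff e : y * z * y^-1 * z^-1 = 1 by apply: (@mulIg _ z^-1); rewrite e mulgV.
by apply: contrapT => n; apply: h; exists y, z.
Qed.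

Let J_infinite : infinite_set [set: J].
Proof.
move=> fin; apply: E1; apply: sgp_triv => // x Ex.
apply: (discrete_lnorm HG lE) => //.
have n1 : nbhs (1 : J) [set 1] by apply: filterS (finite_near1 hJ fin) => z; exact.
have [_ _ _ fC _] := io_lemb.
have /ptws_nbhs1P[A nA hA] := fC _ n1; have A1 := nbhs_singleton nA.
apply: filterS2 nA nbY => z Az hz Ez; have Yz := hz Ez.
have YY := de_box i0 Y_sgp Yz.
have AA : boxI (fun=> A) (single i0 z) by move=> j; rewrite /single; case: ifP => // _; exact: A1.
have : io (single i0 z) = io 1 by exact: hA.
move=> /(io_inj YY (fun=> sgp1 Y_sgp)) /(congr1 (fun f : {ptws I -> G} => f i0)).
by rewrite /single eqxx.
Qed.

Section NormalSubgroup.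
Variable N : set J.
Hypotheses (sN : sgp N) (cN : closed N) (nN : forall x, nz N x).

(** The part of [N] in coordinate [i]. It is invariant under [W], so by irreducibility of [E] it is
    trivial or open in [E]. *)
Let K i := [set y | Y y /\ N (io (single i y))].

Let K_sgp i : sgp (K i).
Proof.
have YW' y : Y y -> boxI (fun=> W) (single i y) by move=> Yy; apply: boxYW; exact: de_box Y_sgp Yy.
have de1 := single1 G i.
split; first by split; [exact: sgp1 Y_sgp|rewrite de1; exact: (sgp1 sN)].
- move=> x y [Yx Nx] [Yy Ny]; split; first exact: (sgpM Y_sgp).
  by rewrite singleM io_mul; [exact: (sgpM sN Nx Ny)|exact: YW'|exact: YW'].
- move=> x [Yx Nx]; have Yx' := sgpV Y_sgp Yx; split=> //.
  apply: (sgpMl sN Nx); rewrite -io_mul; [|exact: YW'|exact: YW'].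
  by rewrite -singleM mulgV de1; exact: (sgp1 sN).
Qed.

Let io_de_hom i : hom_on Y [set: J] (fun y => io (single i y)).
Proof.
apply/hom_onP; first exact: Y_sgp.
split=> // [x y Yx Yy|A nA].
  by rewrite singleM io_mul//; apply: boxYW; exact: de_box Y_sgp _.
have [_ _ _ fC _] := io_lemb.
have /ptws_nbhs1P[B nB hB] := fC _ nA; have B1 := nbhs_singleton nB.
apply: filterS nB => y By Yy; apply: hB; last exact: de_box Y_sgp Yy.
by move=> j; rewrite /single; case: ifP => // _; exact: B1.
Qed.

Let K_closed i : closed (K i).
Proof.
by have [_ _ c] := io_de_hom i; apply: closed_preimage => //; exact: (compact_closed hG cY).
Qed.

Let K_nz i w : W w -> nz (K i) w.
Proof.
move=> Ww y [Yy Ny]; split; first exact: W_nzY.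
have Wd : boxI (fun=> W) (single i w) by exact: de_box stab_sgp Ww.
have Yd : boxI (fun=> W) (single i y) by apply: boxYW; exact: de_box Y_sgp Yy.
have := nN (io (single i w)) Ny; rewrite /io /el wel_conj//; congr (N (wel d _ _)).
apply/funext => j; rewrite invg1 perm1 /single.
by case: ifP => //; rewrite !group_normE.
Qed.

Let K_lnorm i : lnorm (K i).
Proof. by split=> //; apply: filterS nbW => w; exact: K_nz. Qed.

Let K_near i : K i <> [set 1] -> nbhs (1 : G) [set x | E x -> K i x].
Proof.
move=> K1; apply: irrE => //; first by move=> y [[]].
move=> u Uu e; apply: K_nz; split=> //; split; apply: cj_nz => //.
by rewrite -{1}e cjK.
Qed.

(** Conjugation by the transposition of [i] and [j]; thus all coordinate parts agree. *)
Let K_swap i j : K i `<=` K j.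
Proof.
move=> y [Yy Ny]; split=> //.
have W1 : boxI (fun _ : I => W) (fun=> 1) by move=> k; exact: sgp1 stab_sgp.
have Yd : boxI (fun=> W) (single i y) by apply: boxYW; exact: de_box Y_sgp Yy.
have := nN (el (tperm i j) (fun=> 1)) Ny; rewrite /io /el wel_conj//; congr (N (wel d _ _)).
apply/funext => k; rewrite mul1g invg1 mulg1 tpermV /single.
by rewrite (can2_eq (tpermK i j) (tpermK i j)) tpermL.
Qed.

Let N_box y : boxI (fun=> Y) (y : {ptws I -> G}) ->
  (forall i, N (io (single i (y i)))) -> N (io y).
Proof.
move=> Yy Ny; have sB : sgp (boxI (fun _ : I => Y)) by apply: sgp_boxI => _; exact: Y_sgp.
suff : (boxI (fun _ : I => Y) `&` io @^-1` N) y by case.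
apply: single_prod => [|i]; last by split; [exact: de_box Y_sgp (Yy i)|exact: Ny].
by apply: sgp_preimage => // a b Ya Yb; apply: io_mul; exact: boxYW.
Qed.

Let N_near : K i0 <> [set 1] -> nbhs (1 : J) N.
Proof.
move=> /K_near n; have [V' [[s n' _] _ V'A z]] := normal_core HG coU n.
apply/J_nbhs1P; exists V'; split=> // [w [Uw _]|_ [y hy ->]]; first exact: z.
apply: N_box; first by move=> i; case: (hy i).
move=> i; have [Yi [/V'A h _]] := hy i.
have : K i0 (y i) by apply: h; case: Yi.
by move=> /(@K_swap i0 i) [].
Qed.

(** Commutators of [x] with elements of a single coordinate lie in [N]. If all coordinate parts of
    [N] are trivial, they first force the permutation of [x] to be 1 and then its components to act
    trivially on [Y]. *)
Let K_nontrivial x : N x -> x <> 1 -> K i0 <> [set 1].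
Proof.
have [s [u [Wu ->]]] := welP x => Nx x1 K1; apply: x1.
have KE i y : K i y -> y = 1.
  by move=> /(@K_swap i i0); rewrite K1.
have dW (i : I) y : Y y -> boxI (fun=> W) (single i y).
  by move=> Yy; apply: boxYW; exact: de_box Y_sgp Yy.
have c1 (i : I) y : Y y -> N (io (single (s i) (u i * y * (u i)^-1) * single i y^-1)).
  move=> Yy; have Yy' := sgpV Y_sgp Yy.
  have Yc : Y (u i * y * (u i)^-1) by exact: (W_nzY (Wu i) Yy).
  rewrite io_mul; [|exact: dW|exact: dW].
  have -> : io (single (s i) (u i * y * (u i)^-1)) = el s u * io (single i y) * (el s u)^-1.
    rewrite /io /el wel_conj//; last exact: dW.
    congr wel; apply/funext => j; rewrite /single.
    rewrite (can2_eq (permKV s) (permK s)); case: eqP => [->|_]; rewrite ?permK//.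
    by rewrite mulg1 mulgV.
  rewrite -!mulgA; apply: (sgpM sN Nx); rewrite mulgA.
  have := nN (io (single i y)) (sgpV sN Nx).
  have -> : (io (single i y))^-1 = io (single i y^-1).
    apply: (@mulgI _ (io (single i y))); rewrite mulgV -io_mul; [|exact: dW|exact: dW].
    by rewrite -singleM mulgV -io_1; congr io; apply: ptwsP => j; rewrite /single; case: ifP.
  by rewrite ?mulgA.
(* If [s i] differs from [i], the commutator found above lives on these two coordinates. A further
   commutator with [single i z] removes the one at [s i] and leaves the commutator of [y] and [z],
   nontrivial by the choice of [nt_Y]. *)
have fix_s i : s i = i.
  apply: contrapT => /eqP si; have [y [z [Yy Yz yz]]] := nt_Y.
  have Yy' := sgpV Y_sgp Yy; apply: yz.
  have Nc := c1 i _ Yy'; rewrite invgK in Nc.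
  set c := _ * _ in Nc.
  have Yc : boxI (fun=> Y) c.
    move=> j; rewrite /c ptws_mulE; apply: (sgpM Y_sgp).
      exact: (de_box (s i) Y_sgp (W_nzY (Wu i) Yy') j).
    exact: (de_box i Y_sgp Yy j).
  have Yz' := sgpV Y_sgp Yz.
  have Wc := boxYW Yc.
  have Nz : N (io (single i z) * (io c)^-1 * (io (single i z))^-1) by apply: nN; exact: sgpV.
  have : K i (y * z * y^-1 * z^-1).
    split; first exact: (sgpM Y_sgp (sgpM Y_sgp (sgpM Y_sgp Yy Yz) Yy') Yz').
    have -> : single i (y * z * y^-1 * z^-1) = c * (single i z * c^-1 * single i z^-1).
      apply: ptwsP => j; rewrite !ptws_mulE ptws_invE /c ptws_mulE /single.
      case: eqP => [->|_]; last by rewrite !mulg1 mul1g mulgV.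
      by rewrite eq_sym (negbTE si) !mul1g !mulgA.
    have sWb : sgp (boxI (fun _ : I => W)) by apply: sgp_boxI => j; exact: stab_sgp.
    have W1 := sgpV sWb Wc; have W2 := dW i _ Yz; have W3 := dW i _ Yz'.
    rewrite io_mul//; last exact: (sgpM sWb (sgpM sWb W2 W1) W3).
    apply: (sgpM sN Nc); move: Nz; rewrite io_mul//; last exact: (sgpM sWb W2 W1).
    rewrite io_mul// io_V//.
    have <- : (single i z)^-1 = single i z^-1 by apply: ptwsP => j; rewrite ptws_invE /single; case: ifP; rewrite ?invg1.
    by rewrite io_V.
  exact: KE.
have W1 : boxI (fun _ : I => W) (fun=> 1) by move=> i; exact: sgp1 stab_sgp.
rewrite -io_1; apply/wel_eq => // i; split; first by rewrite fix_s perm1.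
move=> y Yy; have Yy' := sgpV Y_sgp Yy; have Yc : Y (u i * y * (u i)^-1) by exact: (W_nzY (Wu i) Yy).
have := c1 i y Yy; rewrite fix_s -singleM => Nc.
have /KE e : K i (u i * y * (u i)^-1 * y^-1) by split=> //; exact: (sgpM Y_sgp).
by apply: (@mulIg _ y^-1); rewrite e !group_normE.
Qed.

Lemma normal_near : N <> [set 1] -> nbhs (1 : J) N.
Proof. by move=> /(sgp_nt sN) [x Nx x1]; apply: N_near; exact: K_nontrivial Nx x1. Qed.

End NormalSubgroup.

Lemma block_wreath_just_infinite : just_infinite [set: J].
Proof.
split=> // N [/subgroupP[sN _] nN] /(closed_inP _ closedT)[_ cN] N1.
apply: near_finite_index => //.
have n : nbhs (1 : J) N.
  apply: normal_near => // x; have : Defs.normaliser N x by exact: nN.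
  by rewrite normaliserE => -[].
by apply: filterS n => x Nx _.
Qed.

End JustInfinite.

Lemma lemb_locally_isomorphic (G H : topGroupType) (A O : set G) (B : set H) f :
  sgp A -> sgp B -> sgp O -> O `<=` A -> nbhs (1 : G) [set x | A x -> O x] -> lemb O f B ->
  locally_isomorphic A B.
Proof.
move=> sA sB sO OA nO [fM fB fI fC fO]; exists O, f; split.
- by split; [exact/subgroupP|exact: sgp_open_in].
- exact/hom_onP.
- by move=> x y /set_mem Ox /set_mem Oy; exact: (hom_inj sO fM fI).
move=> U oU; have UO : U `<=` O by case: oU.
have UB : f @` U `<=` B by move=> _ [x /UO Ox <-]; exact: fB.
split=> //; apply/open_subspaceP; exists ([set z | B z -> (f @` U) z]°).
  exact: open_interior.
apply/seteqP; split=> z [h Bz]; split=> //; first exact: (interior_subset h).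
case: h => u Uu uz; have n := fO _ (open_in_nbhs oU Uu).
have := @nbhs_ml _ z^-1 z _; rewrite mulVg => /(_ _ n); apply: filterS => w /= hw Bw.
have Bzw : B (z^-1 * w) by apply: sgpM => //; exact: sgpV.
have [y [Oy hy e]] := hw Bzw; have Ou := UO _ Uu.
exists (u * y); first by apply: hy; exact: sgpM.
by rewrite fM// e uz mulVKg.
Qed.

(** * From an isomorphism of powers to a link of factors *)

Section Transfer.
Variables (G : topGroupType) (HG : ldgroup G).
Implicit Types (A B K R S T U V W E : set G) (x y : G).
Let hG := ld_hausdorff HG.

(** [F] may mix coordinates. The subgroup [S] of those elements of [T], placed in coordinate [i0],
    whose image is supported at one coordinate [j] embeds in [R]. A commutator with an element of
    [R] placed at [j] shows that [S] is nontrivial. *)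
Lemma linked_of_power (I J : finType) (i0 : I) K T R V (F : {ptws I -> G} -> {ptws J -> G}) :
  lnorm K -> lnorm T -> T `<=` K -> T <> [set 1] -> reg R -> co V ->
  lemb (boxI (fun _ : I => K `&` V)) F (boxI (fun _ : J => R)) -> linked T R.
Proof.
move=> lK lT TK T1 rR [sV nV cV] [FM FB FI FC FO].
have lR := reg_lnorm rR; have [sR _ _] := lR; have [sT cT nT] := lT; have [sK _ _] := lK.
pose D := boxI (fun _ : I => K `&` V).
have sKV : sgp (K `&` V) by exact: sgpI.
have sD : sgp D by apply: sgp_boxI.
have KVD y : K y -> V y -> D (single i0 y).
  by move=> Ky Vy; apply: single_box => // j; exact: (sgp1 sKV).
pose h y := F (single i0 y).
have hM x y : K x -> V x -> K y -> V y -> h (x * y) = h x * h y.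
  by move=> Kx Vx Ky Vy; rewrite /h singleM FM//; exact: KVD.
have hMKV x y : (K `&` V) x -> (K `&` V) y -> h (x * y) = h x * h y.
  by move=> [Kx Vx] [Ky Vy]; exact: hM.
have h1 := hom1 sKV hMKV.
have hI y : K y -> V y -> h y = 1 -> y = 1.
  by move=> Ky Vy /(FI _ (KVD _ Ky Vy)) e; rewrite -(single_i i0 y) e.
have hR y : K y -> V y -> boxI (fun _ : J => R) (h y) by move=> Ky Vy; apply: FB; exact: KVD.
pose T0 := T `&` V; have sT0 : sgp T0 by exact: sgpI.
have hhom : hom_on T0 [set: {ptws J -> G}] h.
  apply/hom_onP => //; split=> //.
    by move=> x y [Tx Vx] [Ty Vy]; apply: hM => //; exact: TK.
  move=> A /FC /(@single_near I G i0); apply: filterS => y hy [Ty Vy].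
  by apply: hy; apply: KVD => //; exact: TK.
have [y [Ty Vy y1]] := lnorm_nt HG lT T1 nV.
have Ky := TK _ Ty.
have [j xj] : exists j, h y j <> 1.
  apply: contrapT => n; apply: y1; apply: (hI _ Ky Vy); apply: ptwsP => j.
  by apply: contrapT => nj; apply: n; exists j.
pose off := [set f : {ptws J -> G} | forall k, k != j -> f k = 1].
have cloff : closed off.
  have -> : off = boxI (fun k : J => if k != j then [set (1 : G)] else setT).
    apply/seteqP; split=> f hf k; first by case: ifP => // kj; exact: hf.
    by move=> kj; have := hf k; rewrite kj.
  by apply: closed_boxI => k; case: ifP => // _; exact: (closed_1 HG).
have sgoff : sgp off.
  split=> //; first by move=> f g hf hg k kj; rewrite ptws_mulE hf// hg// mulg1.
  by move=> f hf k kj; rewrite ptws_invE hf// invg1.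
have off_conj f g : off g -> off (f * g * f^-1).
  by move=> hg k kj; rewrite !ptws_mulE ptws_invE hg// mulg1 mulgV.
have offE f : off f -> f = single j (f j).
  by move=> hf; apply: ptwsP => k; rewrite /single; case: eqP => [->//|/eqP]; exact: hf.
pose S := T0 `&` h @^-1` off.
have sS : sgp S.
  by apply: sgp_preimage => // a b [Ta Va] [Tb Vb]; apply: hM => //; exact: TK.
have cS : closed S.
  apply: closed_preimage => //; first by case: hhom.
  by apply: closedI => //; exact: sgp_open_closed.
have coS : compact S.
  by apply: subclosed_compact cV _ => // a [[]].
have ST : S `<=` T by move=> a [[]].
have hV a : K a -> V a -> h a^-1 = (h a)^-1.
  by move=> Ka Va; apply: (homV sKV hMKV).
have lS : lnorm S.
  apply: (lnorm_sub HG lK) => //; first by move=> a /ST/TK.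
  apply: filterS2 nT nV => k nk Vk Kk a [[Ta Va] oa]; have Ka := TK _ Ta.
  have Kk' := sgpV sK Kk; have Vk' := sgpV sV Vk.
  split; first by split; [exact: nk|exact: (sgpM sV (sgpM sV Vk Va) Vk')].
  by rewrite /= hM ?hM ?hV//; [exact: off_conj|exact: sgpM|exact: sgpM].
pose g a := h a j.
have gR a : S a -> R (g a) by move=> [[Ta Va] _]; apply: hR => //; exact: TK.
have cg : ciso S (g @` S) g.
  split=> //.
  - by move=> a b [[Ta Va] oa] [[Tb Vb] ob]; rewrite /g hM//; exact: TK.
  - move=> a [[Ta Va] oa] e; apply: hI => //; first exact: TK.
    by rewrite (offE _ oa) -/(g a) e single1.
  - move=> W nW; have [_ _ hc] := (hom_onP _ _ sT0).1 hhom.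
    by apply: filterS (hc _ (nbhs_boxI J nW)) => a ha [Ta _]; exact: ha.
(* [F] is open at 1, so [single j r] with [r] near 1 in [R] is the image of such a [t]. Conjugation
   by [t i0] preserves [T] and corresponds to conjugation by [single j r]. *)
pose good := [set t : {ptws I -> G} | nz T (t i0)].
have ngood : nbhs (1 : {ptws I -> G}) good.
  by apply: filterS (nbhs_boxI I nT) => t ht; exact: ht.
have nz_near := @single_near J G j _ (FO _ ngood).
have lift r : R r -> [set x | [set z | boxI (fun _ : J => R) z -> exists t,
    [/\ boxI (fun _ : I => K `&` V) t, good t & F t = z]] (single j x)] r ->
    exists t, [/\ D t, nz T (t i0) & F t = single j r].
  by move=> Rr /=; apply; apply: single_box => // k; exact: sgp1.
have lS2 : lnorm (g @` S).
  apply: (lnorm_sub HG lR); [exact: ciso_sgp cg| |by move=> _ [a Sa <-]; exact: gR|].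
    by apply: compact_closed => //; exact: ciso_compact cg.
  apply: filterS nz_near => r hr Rr _ [a [[Ta Va] oa] <-].
  have [t [Dt nt et]] := lift r Rr hr.
  have [Kt Vt] := Dt i0; have Ka := TK _ Ta.
  have e : h (t i0 * a * (t i0)^-1) = single j r * h a * (single j r)^-1.
    rewrite /h -single_conj FM ?FM ?(homV sD FM) ?et//.
    - exact: KVD.
    - by apply: (sgpM sD) => //; exact: KVD.
    - exact: (sgpV sD).
  exists (t i0 * a * (t i0)^-1); last first.
    by rewrite /g e !ptws_mulE ptws_invE !single_i.
  split; last by rewrite /= e; exact: off_conj.
  by split; [exact: nt|exact: (sgpM sV (sgpM sV Vt Va) (sgpV sV Vt))].
exists S, (g @` S), g; split=> //; first by split=> // _ [a Sa <-]; exact: gR.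
(* If [h y j] commuted with all such [z], it would lie in [R] and [perp R], against its choice. *)
have [z [Rz hz nc]] : exists z, [/\ R z, [set x | [set z | boxI (fun _ : J => R) z -> exists t,
    [/\ boxI (fun _ : I => K `&` V) t, good t & F t = z]] (single j x)] z & ~ commute (h y j) z].
  apply: contrapT => n; apply: xj; apply: (perp_dj HG lR); split; first exact: hR.
  apply: filterS nz_near => z hz Rz; apply: contrapT => nc; apply: n.
  by exists z; split.
have [t [Dt nt et]] := lift z Rz hz.
have [Kt Vt] := Dt i0.
(* The commutator of [y] with [t i0]. Its image is the commutator of [h y] with [single j z], so it
   is supported at [j], and it is nontrivial by the choice of [z]. *)
pose s := y * (t i0 * y^-1 * (t i0)^-1).
have Vs : V s by apply: (sgpM sV) => //; exact: (sgpM sV (sgpM sV Vt (sgpV sV Vy)) (sgpV sV Vt)).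
have Ts : T s by apply: (sgpM sT) => //; apply: nt; exact: sgpV.
have es : h s = h y * (single j z * (h y)^-1 * (single j z)^-1).
  have Dy := KVD _ Ky Vy; have Dy' := sgpV sD Dy; have Dt' := sgpV sD Dt.
  have -> : h s = F (single i0 y * (t * single i0 y^-1 * t^-1)).
    by rewrite /h /s singleM single_conj.
  rewrite singleV FM//; last exact: (sgpM sD (sgpM sD Dt Dy') Dt').
  rewrite FM//; last exact: (sgpM sD Dt Dy').
  by rewrite FM// !(homV sD FM)// et.
have Ss : S s.
  split=> // k kj; rewrite es !ptws_mulE !ptws_invE /single (negbTE kj).
  by rewrite !mul1g invg1 mulg1 mulgV.
move=> e1; apply: nc; have s1 : s = 1 by have := Ss; rewrite e1.
have := congr1 (fun f : {ptws J -> G} => f j) es.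
rewrite s1 h1 !ptws_mulE !ptws_invE single_i => e.
rewrite /commute; apply: (@mulIg _ (h y j)^-1); apply: (@mulIg _ z^-1).
have e' : h y j * z * (h y j)^-1 * z^-1 = 1 by have := esym e; rewrite !mulgA.
by rewrite mulgK mulgV e'.
Qed.

End Transfer.

(** * Local similarity *)

Section LembImage.
Variables (G H : topGroupType).
Implicit Types (Y : set G) (B : set H) (f : G -> H).

Lemma lemb_inv Y B f : sgp Y -> lemb Y f B ->
  exists g, lemb (f @` Y) g Y /\ forall x, Y x -> g (f x) = x.
Proof.
move=> sY [fM fB fI fC fO].
have [g [gP gf gM]] := hom_inverse sY fM fI erefl.
exists g; split=> //; split=> //.
- by move=> _ [x Yx <-]; rewrite gf.
- move=> _ [x Yx <-]; rewrite gf// => ->; exact: hom1 sY fM.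
- move=> W /fO; apply: filterS => z h [x Yx ez]; move: h; rewrite -ez /= gf// => h.
  have [y [Yy Wy e]] := h (fB _ Yx).
  by rewrite -(hom_inj sY fM fI Yy Yx e).
- move=> W /fC; apply: filterS => x h Yx; exists (f x); split; [by exists x|exact: h|exact: gf].
Qed.

Lemma lemb_image_sgp Y B f : sgp Y -> lemb Y f B -> sgp (f @` Y).
Proof. by move=> sY [fM _ _ _ _]; exact: sgp_image. Qed.

Lemma lemb_image_sub Y B f : lemb Y f B -> f @` Y `<=` B.
Proof. by move=> [_ fB _ _ _] _ [x Yx <-]; exact: fB. Qed.

Lemma lemb_image_near Y B f : lemb Y f B -> nbhs (1 : H) [set z | B z -> (f @` Y) z].
Proof.
by move=> [_ _ _ _ fO]; apply: filterS (fO _ filterT) => z h /h [x [Yx _ <-]]; exists x.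
Qed.

Lemma lemb_image_codom Y B f : lemb Y f B -> lemb Y f (f @` Y).
Proof.
move=> h; apply: (lemb_codom h) => [x Yx|]; first by exists x.
by apply: filterS filterT => z _; exact: lemb_image_sub h _.
Qed.

Lemma lemb_image_compact_open Y B f : sgp Y -> sgp B -> compact Y -> lemb Y f B ->
  compact_open_subgroup B (f @` Y).
Proof.
move=> sY sB cY h; have sf := lemb_image_sgp sY h; have sub := lemb_image_sub h.
split; first by split; [exact/subgroupP|exact: (sgp_open_in sB sf sub (lemb_image_near h))].
apply: continuous_compact => //; have [fM fB _ fC _] := h.
by have [] := (hom_onP B f sY).2 (And3 fB fM fC).
Qed.

End LembImage.

(** A transposition of indices: both sides are powers of [Y] over pairs from [I] and [I'], grouped
    in the two possible ways. *)
Lemma reindex_lemb (G : topGroupType) (I I' : finType) (Y : set G) :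
  lemb (boxI (fun _ : 'I_#|I'| => boxI (fun _ : I => Y)))
    (fun y : {ptws 'I_#|I'| -> {ptws I -> G}} =>
      (fun k => (fun i => y (enum_rank i) (enum_val k)) : {ptws I' -> G})
      : {ptws 'I_#|I| -> {ptws I' -> G}})
    (boxI (fun _ : 'I_#|I| => boxI (fun _ : I' => Y))).
Proof.
split=> //.
- by move=> x hx k i; exact: hx.
- move=> x hx e; apply: ptwsP => k; apply: ptwsP => i.
  have := congr1 (fun f : {ptws 'I_#|I| -> {ptws I' -> G}} => f (enum_rank i) (enum_val k)) e.
  by rewrite /= enum_valK enum_rankK.
- move=> W /ptws_nbhs1P[V /ptws_nbhs1P[A nA AV] VW].
  apply/ptws_nbhs1P; exists (boxI (fun=> A)); first exact: nbhs_boxI.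
  by move=> x hx _; apply: VW => k; apply: AV => i; exact: hx.
- move=> W /ptws_nbhs1P[V /ptws_nbhs1P[A nA AV] VW].
  apply/ptws_nbhs1P; exists (boxI (fun=> A)); first exact: nbhs_boxI.
  move=> z hz Yz; exists ((fun k => (fun i => z (enum_rank i) (enum_val k)) : {ptws I -> G})
      : {ptws 'I_#|I'| -> {ptws I -> G}}); split.
  + by move=> k i; exact: Yz.
  + by apply: VW => k; apply: AV => i; exact: hz.
  + by apply: ptwsP => k; apply: ptwsP => i; rewrite /= enum_valK enum_rankK.
Qed.

Lemma finite_index_refl (G : topGroupType) (A : set G) : sgp A -> finite_index A A.
Proof.
move=> sA; apply: sub_finite_set (finite_set1 A) => _ [g Ag <-] /=.
apply/seteqP; split=> [_ [x Ax <-]|x Ax]; first exact: sgpM.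
by exists (g^-1 * x); [apply: sgpM => //; exact: sgpV|rewrite mulVKg].
Qed.

Section Similar.
Variables (G : topGroupType) (HG : ldgroup G).
Implicit Types (A B K R S T U V W E : set G) (x y : G).
Let hG := ld_hausdorff HG.

Lemma pw_locally_similar (H1 H2 : topGroupType) (A1 : set H1) (A2 : set H2) E (I1 I2 : finType) :
  lnorm E -> sgp A1 -> sgp A2 -> (0 < #|I1|)%N -> (0 < #|I2|)%N ->
  pw E I1 A1 -> pw E I2 A2 -> locally_similar A1 A2.
Proof.
move=> [sE cE nE] s1 s2 c1 c2 p1 p2.
have [V' [f1' [[_ nV' _] _ h1 _]]] := pw_small HG p1 filterT filterT.
have [V [f2 [[sV nV cV] VV' h2 _]]] := pw_small HG p2 filterT nV'.
have {}h1 := lemb_box_shrink nV VV' h1.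
have sY : sgp (E `&` V) by exact: sgpI.
have cY : compact (E `&` V) by rewrite setIC; apply: compact_closedI.
have sB1 : sgp (boxI (fun _ : I1 => E `&` V)) by exact: sgp_boxI.
have sB2 : sgp (boxI (fun _ : I2 => E `&` V)) by exact: sgp_boxI.
set Y1 := boxI _ in h1 sB1; set Y2 := boxI _ in h2 sB2.
exists (f1' @` Y1), (f2 @` Y2); split.
- by apply: lemb_image_compact_open h1 => //; apply: compact_boxI.
- by apply: lemb_image_compact_open h2 => //; apply: compact_boxI.
(* With these exponents both sides become the power of [E] near 1 with [#|I1| * #|I2|] factors, so
   the full powers are isomorphic and both indices are 1. *)
exists #|I2|, #|I1|; split=> //.
have [g [hg gf]] := lemb_inv sB1 h1.
have h2' := lemb_image_codom h2.
have hF := lemb_comp (lemb_comp (lemb_box 'I_#|I2| hg) (reindex_lemb I1 I2 (E `&` V)))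
  (lemb_box 'I_#|I1| h2').
have sP1 : sgp (boxI (fun _ : 'I_#|I2| => f1' @` Y1)).
  by apply: sgp_boxI => _; exact: lemb_image_sgp h1.
have sP2 : sgp (boxI (fun _ : 'I_#|I1| => f2 @` Y2)).
  by apply: sgp_boxI => _; exact: lemb_image_sgp h2.
exists (power (f1' @` Y1) #|I2|), (power (f2 @` Y2) #|I1|); eexists; split.
- by split; [exact: open_subgroup_refl|exact: finite_index_refl].
- by split; [exact: open_subgroup_refl|exact: finite_index_refl].
apply: lemb_top_iso hF _ => // z hz.
have /choice[y yP] (k : 'I_#|I1|) : exists y : {ptws I2 -> G}, Y2 y /\ f2 y = z k by have [y Yy e] := hz k; exists y.
pose x : {ptws 'I_#|I2| -> {ptws I1 -> G}} := fun k => (fun i => y (enum_rank i) (enum_val k)).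
have Yx k : Y1 (x k) by move=> i; have [h _] := yP (enum_rank i); exact: h.
exists (fun k => f1' (x k)); first by move=> k; exists (x k).
apply: ptwsP => k /=; have [_ <-] := yP k; congr (f2 _).
by apply: ptwsP => i; rewrite gf// /x enum_valK enum_rankK.
Qed.

Lemma pow_boxI E n (A : 'I_n -> set G) : (forall j, pow E (A j)) ->
  pow E (boxI A).
Proof.
move=> pA; have /choice[I pI] (j : 'I_n) : exists I : finType, pw E I (A j) by exact: pA.
pose cV j := cid (pI j); pose cf j := cid (svalP (cV j)); pose f j := sval (cf j).
have nW : nbhs (1 : G) [set x | forall j, sval (cV j) x].
  by apply: filter_forall => j; have [] := svalP (cf j).
have [V [sV nV _ VW]] := ld_base HG nW.
have hf j : lemb (boxI (fun _ : I j => E `&` V)) (f j) (A j).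
  have [_ _ h] := svalP (cf j); apply: (lemb_box_shrink nV _ h) => x /VW; exact.
exists {j : 'I_n & I j}; pose T := {j : 'I_n & I j}.
pose sl (y : {ptws {j : 'I_n & I j} -> G}) j : {ptws I j -> G} := fun i => y (Tagged I i).
have slB (y : {ptws {j : 'I_n & I j} -> G}) j : boxI (fun=> E `&` V) y -> boxI (fun=> E `&` V) (sl y j) by move=> h i; exact: h.
exists V, (fun y : {ptws {j : 'I_n & I j} -> G} => (fun j => f j (sl y j)) : {ptws 'I_n -> G}); split=> //; split.
- move=> x y hx hy; apply: ptwsP => j; have [fM _ _ _ _] := hf j.
  by rewrite ptws_mulE -fM//; exact: slB.
- by move=> x hx j; have [_ fB _ _ _] := hf j; apply: fB; exact: slB.
- move=> x hx e; apply: ptwsP => -[j i]; have [_ _ fI _ _] := hf j.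
  have := congr1 (fun h : {ptws 'I_n -> G} => h j) e => /= /(fI _ (slB _ _ hx)) ej.
  by have := congr1 (fun h : {ptws I j -> G} => h i) ej.
- move=> W /ptws_nbhs1P[B nB BW].
  have /choice[C CP] j : exists C, nbhs (1 : G) C /\ boxI (fun _ : I j => C) `<=`
      [set x | boxI (fun _ : I j => E `&` V) x -> B (f j x)].
    by have [_ _ _ fC _] := hf j; have /ptws_nbhs1P[C nC CB] := fC _ nB; exists C.
  have nC : nbhs (1 : G) [set x | forall j, C j x].
    by apply: filter_forall => j; case: (CP j).
  apply/ptws_nbhs1P; exists [set x | forall j, C j x] => // x hx Bx.
  by apply: BW => j; have [_ h] := CP j; apply: h; [move=> i; exact: hx|exact: slB].
- move=> W /ptws_nbhs1P[B nB BW].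
  have nn : nbhs (1 : G) [set z | forall j, A j z -> exists x : {ptws I j -> G},
      [/\ boxI (fun _ : I j => E `&` V) x, boxI (fun=> B) x & f j x = z]].
    apply: filter_forall => j; have [_ _ _ _ fO] := hf j.
    by apply: fO; exact: nbhs_boxI.
  apply/ptws_nbhs1P; eexists; first exact: nn.
  move=> z hz Az; pose xs j := cid (hz j j (Az j)).
  exists (fun u : T => sval (xs (tag u)) (tagged u)); split.
  + by move=> -[j i]; have [h _ _] := svalP (xs j); exact: h.
  + by apply: BW => -[j i]; have [_ h _] := svalP (xs j); exact: h.
  + by apply: ptwsP => j; have [_ _ h] := svalP (xs j).
Qed.

End Similar.

Lemma near_discrete (G : topGroupType) (K : set G) : sgp K ->
  nbhs (1 : G) [set z | K z -> z = 1] -> discrete_subgroup K.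
Proof.
move=> sK n x Kx; split; first by move=> _ ->.
apply/open_subspaceP; exists ([set z | K z -> z = x]°); first exact: open_interior.
apply/seteqP; split=> z [h Kz]; split=> //; first exact: (interior_subset h).
have := @nbhs_ml _ z^-1 z _; rewrite mulVg => /(_ _ n); apply: filterS => w hw Kw.
have /hw e : K (z^-1 * w) by apply: sgpM => //; exact: sgpV.
by rewrite -h; apply: (@mulgI _ z^-1); rewrite e mulVg.
Qed.

Section LocallyMonomial.
Variables (G : topGroupType) (HG : ldgroup G).
Implicit Types (A B K R S T U V W E : set G) (x y : G).
Let hG := ld_hausdorff HG.

Lemma pw_nonempty (H : topGroupType) E (I : finType) (A : set H) : pw E I A ->
  ~ nbhs (1 : H) [set z | A z -> z = 1] -> (0 < #|I|)%N.
Proof.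
move=> [V [f [_ _ hf]]] n; rewrite lt0n; apply/negP => /eqP I0; apply: n.
have empty (i : I) : False by have := fintype0 i I0.
apply: filterS (lemb_image_near hf) => z h /h [x hx <-].
have x1 : x = 1 by apply: ptwsP => i; case: (empty i).
have [fM _ _ _ _] := hf.
by apply: (@mulgI _ (f x)); rewrite -fM// {2}x1 !mulg1.
Qed.

Lemma cl_not_near R : lnorm R -> R <> [set 1] -> ~ nbhs (1 : G) [set z | R z -> z = 1].
Proof.
move=> lR R1 n; apply: R1; have [sR _ _] := lR; apply: sgp_triv => //.
exact: discrete_lnorm.
Qed.

(** Locally, [K] is the box of its coordinate parts [Kj j]. Tiling [R] together with their regular
    hulls makes both [R] and [K] local powers of the same [E]. *)
Lemma locally_monomial_cl R : atom (@cl G) R -> locally_monomial R.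
Proof.
move=> aR; have [cR R1 _] := aR; have [rR _] := cR; have lR := reg_lnorm rR.
have [sR clR nR] := lR.
split.
  move=> dR; apply: (cl_not_near lR R1).
  by apply: filterS (open_in_nbhs (dR 1 (sgp1 sR)) erefl) => y; rewrite /= mul1g.
move=> a K lK nd.
pose A : set {ptws 'I_a -> G} := boxI (fun _ : 'I_a => R).
have sA : sgp A by exact: sgp_boxI.
have cA : closed A by exact: closed_boxI.
have [sK KA cK nK] := (lnormP K sA cA).1 lK.
have singleA j x : R x -> A (single j x).
  by move=> Rx; apply: single_box => // k; exact: sgp1.
pose Kj j := [set x | R x /\ K (single j x)].
have sKj j : sgp (Kj j) by apply: sgp_preimage => // x y _ _; exact: singleM.
have lKj j : lnorm (Kj j).
  apply: (lnorm_sub HG lR) => //; [|by move=> x []|].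
    have -> : Kj j = R `&` single j @^-1` K by [].
    apply: closed_preimage => //.
    have [] // := (hom_onP [set: {ptws 'I_a -> G}] (@single _ _ j) sR).2 _.
    split=> // [x y _ _|B nB]; first exact: singleM.
    by apply: filterS (single_near j nB) => x hx _.
  apply: filterS (single_near j nK) => r hr Rr x [Rx Kx]; split; first exact: nz_sgp.
  by rewrite !singleM singleV; apply: hr => //; exact: singleA.
(* The commutator of [k j] with a small [z] in [R] and [perp (Kj j)] lies in [Kj j] because
   [single j z] normalises [K], and in [perp (Kj j)] because [k j] normalises [Kj j]. So it is
   trivial. *)
have KKj k j : K k -> perp (perp (Kj j)) (k j).
  move=> Kk; have Rk : R (k j) by exact: (KA _ Kk).
  have nk (x : {ptws 'I_a -> G}) : K x -> nz (Kj j) (x j).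
    move=> Kx y [Ry Ky]; have Rx := KA _ Kx j; split; first exact: nz_sgp.
    by rewrite -single_conj; exact: nz_sgp.
  have nk1 := nk _ Kk; have nk2 := nk _ (sgpV sK Kk); rewrite ptws_invE in nk2.
  have nkp := perp_nz nk1 nk2.
  have n1 : nbhs (1 : G) [set z | R z -> perp (Kj j) z -> commute (k j) z].
    apply: filterS (single_near j nK) => z hz Rz pz.
    have e : k j * z * (k j)^-1 * z^-1 = 1.
      apply: (perp_dj HG (lKj j)); split; last first.
        by apply: (sgpM (perp_sgp _)); [exact: nkp|exact: (sgpV (perp_sgp _))].
      split; first by apply: sgpM; [exact: sR|exact: nz_sgp|exact: sgpV].
      rewrite singleM -single_conj singleV -!mulgA; apply: (sgpM sK Kk); rewrite !mulgA.
      by apply: hz; [exact: singleA|exact: sgpV].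
    apply: (@mulIg _ (k j)^-1); apply: (@mulIg _ z^-1); by rewrite e !group_normE.
  apply: filterS (perp_mul_near HG lR (filterI n1 nR)) => _ [z [p [[Rz [hz _]] [pp [_ np]] ->]]] pzp.
  have pK : perp (Kj j) p by apply: perpS pp => x [].
  apply: commuteM; first by apply: hz => //; exact: (sgpMr (perp_sgp _) pK pzp).
  exact: perp_commute lR Rk pp np.
pose F := [seq perp (perp (Kj j)) | j <- enum 'I_a].
have [|U [E [[coU rE] [E1 ER] powR powF _]]] := tiling HG aR (F := F).
  move=> B /mapP[j _ ->]; split; first exact: reg_pp.
  by apply: pp_sub => // x [].
have [I1 p1] := powR.
have [j|I2 p2] := pow_boxI HG (E := E) (A := fun j => perp (perp (Kj j))).
  by apply: powF; apply: map_f; rewrite mem_enum.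
have p2' : pw E I2 K.
  apply: (pw_near HG p2).
    have n : nbhs (1 : G) [set x | forall j, perp (perp (Kj j)) x -> Kj j x].
      by apply: filter_forall => j; exact: perp_perp_near.
    apply: filterS (nbhs_boxI 'I_a n) => f hf Pf; apply: single_prod => // j.
    by have [] := hf j j (Pf j).
  by apply: filterS filterT => f _ Kf j; exact: KKj.
have c1 := pw_nonempty p1 (cl_not_near lR R1).
have c2 : (0 < #|I2|)%N.
  by apply: (pw_nonempty p2') => n; apply: nd; exact: near_discrete.
exact: (pw_locally_similar HG (reg_lnorm rE) sR sK c1 c2 p1 p2').
Qed.

Lemma exists_just_infinite R : atom (@cl G) R -> exists (J : topGroupType) (O : set G) (f : G -> J),
  [/\ profinite J, just_infinite [set: J], sgp O,
      O `<=` R /\ nbhs (1 : G) [set x | R x -> O x] & lemb O f [set: J]].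
Proof.
move=> aR; have [cR R1 _] := aR; have [rR _] := cR; have lR := reg_lnorm rR.
have [//|U [E [[coU rE] [E1 ER] [I pI] _ irr]]] := tiling HG aR (F := [::]).
have [V0 [f0 [[_ nV0 _] _ h0 _]]] := pw_small HG pI filterT filterT.
have [V [coV VU VV0 nV]] := normal_core HG coU nV0.
have [sV nbV cV] := coV.
have {}h0 := lemb_box_shrink nbV VV0 h0.
have /card_gt0P[i0 _] := pw_nonempty pI (cl_not_near lR R1).
have [sE cE nE] := reg_lnorm rE.
have sB : sgp (boxI (fun _ : I => E `&` V)) by apply: sgp_boxI => _; exact: sgpI.
have [g [hg gf]] := lemb_inv sB h0.
have hio := io_lemb HG I coU coV VU nV rE.
exists (block_wreath I coU coV nV rE).
exists (f0 @` boxI (fun _ : I => E `&` V)); eexists; split.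
- exact: block_wreath_profinite.
- exact: block_wreath_just_infinite.
- exact: lemb_image_sgp h0.
- by split; [exact: lemb_image_sub h0|exact: lemb_image_near h0].
- exact: lemb_comp hg hio.
Qed.

End LocallyMonomial.

(** * First-countability and the theorem *)

Section FirstCountable.
Variables (G : topGroupType) (HG : ldgroup G).
Implicit Types (A B K R S T U V W E : set G) (x y : G).
Let hG := ld_hausdorff HG.

(** A nontrivial meet of [K] with [perp R] would, through the isomorphism of powers and
    [linked_of_power], be linked to [R], although [perp R] is in [cl]. *)
Lemma similar_sub R (J : topGroupType) O (f : G -> J) K : cl R -> sgp O -> O `<=` R ->
  nbhs (1 : G) [set x | R x -> O x] ->
  lemb O f [set: J] -> lnorm K -> locally_similar K [set: J] -> K `<=` R.
Proof.
move=> cR sO OR nO hf lK [U [V [[[/subgroupP[sU UK] oU] cU] [[/subgroupP[sV _] oV] cV] sim]]].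
have [a [b [a0 b0 [A [B [h [[oA' _] [oB' _] iso]]]]]]] := sim.
have [/subgroupP[sA AU] oA] := oA'; have [/subgroupP[sB BV] oB] := oB'.
have [rR _] := cR; have lR := reg_lnorm rR; have [sK _ _] := lK.
apply: (dj_sub HG rR lK); apply: contrapT => nd.
have [_ nl] := cl_perp HG cR; apply: nl; rewrite (regE HG rR).
have lT : lnorm (K `&` perp R) by apply: lnormI => //; exact: (lnorm_perp HG).
have [hl hs] := top_iso_lemb sA sB iso.
have [g [hg gf]] := lemb_inv sO hf.
have sPU : sgp (power U a) by apply: (@sgp_boxI 'I_a).
have sPV : sgp (power V b) by apply: (@sgp_boxI 'I_b).
have nU := (open_in_sgp sK sU UK).1 oU.
have nV : nbhs (1 : J) V.
  by apply: filterS ((open_in_sgp (@sgpT J) sV (@subsetT _ _)).1 oV) => x hx; exact: hx.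
have nA := (open_in_sgp sPU sA AU).1 oA; have nB := (open_in_sgp sPV sB BV).1 oB.
have nQ : nbhs (1 : J) (f @` O).
  by apply: filterS (lemb_image_near hf) => x hx; exact: hx.
have [_ _ _ hC _] := hl.
have /ptws_nbhs1P[W1 nW1 h1] := hC _ (nbhs_boxI 'I_b nQ).
have /ptws_nbhs1P[W2 nW2 h2] := nA.
have [V0 [sV0 nV0 cV0 VW]] := ld_base HG (filterI (filterI nW1 nW2) nU).
pose D := boxI (fun _ : 'I_a => K `&` V0).
have DA : D `<=` A.
  move=> x hx; apply: h2 => i; first by have [_ /VW[[]]] := hx i.
  by have [Kx /VW[_ Ux]] := hx i; exact: Ux.
have nD : nbhs (1 : {ptws 'I_a -> G}) [set x | A x -> D x].
  apply/ptws_nbhs1P; exists V0 => // x hx Ax i; split; last exact: hx.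
  exact: UK (AU _ Ax i).
have lD : lemb D h (boxI (fun _ : 'I_b => f @` O)).
  apply: (lemb_codom (lemb_shrink hl DA nD)).
    move=> x Dx; apply: (h1 x) => //; last exact: DA.
    by move=> i; have [_ /VW[[]]] := Dx i.
  have n : nbhs (1 : {ptws 'I_b -> J}) (power V b) by exact: (nbhs_boxI 'I_b nV).
  by apply: filterS2 n nB => z Pz Bz _; exact: Bz.
have hgR : lemb (f @` O) g R.
  apply: (lemb_codom hg) => // z [x Ox <-]; rewrite gf//; exact: OR.
have lF := lemb_comp lD (lemb_box 'I_b hgR).
have coV0 : co V0 by [].
apply: linkedS (linked_of_power HG (Ordinal a0) lK lT (@subIsetl _ _ _) _ rR coV0 lF) => //.
by move=> e; apply: nd => x; rewrite e.
Qed.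

(** The meet [H] of [R] with the chain is [U]-invariant, so it is trivial or open in the atom [R].
    The chain is built to decrease strictly inside [R], which rules out the second case. *)
Lemma atom_sequence U R : co U -> atom (invreg U) R ->
  exists V : nat -> set G, [/\ forall n, co (V n) /\ (forall u, U u -> nz (V n) u),
    forall n m, (n <= m)%N -> V m `<=` V n & R `&` \bigcap_n V n `<=` [set 1]].
Proof.
move=> coU [iR R1 hR]; have [rR nR] := iR; have lR := reg_lnorm rR.
have [sU nU cU] := coU; have [sR _ _] := lR.
have step V : exists V', co V -> [/\ co V', V' `<=` V, forall u, U u -> nz V' u &
    exists x, [/\ R x, V x & ~ V' x]].
  have [[sV nV cV]|n] := pselect (co V); last by exists V.
  have [x [Rx Vx x1]] := lnorm_nt HG lR R1 nV.
  have nx := nbhs1_neq hG x1.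
  have [V' [coV' _ V'W nV']] := normal_core HG coU (filterI nx nV).
  exists V' => _; split=> //; first by move=> y /V'W[].
  by exists x; split=> // /V'W[h _]; exact: h.
have [f fP] := choice step.
(* Starting at [f U] makes every term a value of the step function, hence normalised by [U]. *)
pose V n := iter n.+1 f U.
have coV n : co (V n) by elim: n => [|n IH]; [case: (fP U coU)|case: (fP _ IH)].
have VS n : V n.+1 `<=` V n by case: (fP _ (coV n)).
have nV n : forall u, U u -> nz (V n) u.
  by case: n => [|n]; [case: (fP U coU)|case: (fP _ (coV n))].
have Vle n m : (n <= m)%N -> V m `<=` V n.
  move=> nm; rewrite -(subnKC nm); elim: (m - n)%N => [|k IH]; first by rewrite addn0.
  by rewrite addnS; apply: subset_trans (VS _) IH.
exists V; split=> [n|//|]; first by split; [exact: coV|exact: nV].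
set H := R `&` _.
have lH : lnorm H.
  split.
  - by apply: sgpI => //; apply: sgp_bigcap => n _; case: (coV n).
  - apply: closedI; first by case: lR.
    by apply: closed_bigI => n _; have [s n' _] := coV n; exact: sgp_open_closed.
  - apply: filterS nU => u Uu; apply: nzI; split; first exact: nR.
    by apply: nz_bigcap => n _; exact: nV.
have nH u : U u -> nz H u.
  by move=> Uu; apply: nzI; split; [exact: nR|apply: nz_bigcap => n _; exact: nV].
have [-> //|H1] := pselect (H = [set 1]).
have RH : R `<=` perp (perp H).
  apply: hR; [exact: (invreg_pp HG)|by apply: pp_sub => // x []|exact: (pp_nt HG)].
have n1 : nbhs (1 : G) [set x | R x -> H x].
  by apply: filterS (perp_perp_near HG lH) => x hx /RH.
have /choice[x xP] n : exists x, [/\ R x, V n x & ~ V n.+1 x].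
  by have [_ _ _ h] := fP _ (coV n); exact: h.
have xV0 n : V 0%N (x n) by apply: (Vle 0%N n) => //; case: (xP n).
have cV0 : compact (V 0%N) by case: (coV 0%N).
(* Two witnesses of strictness differ by an element of [H]. The later one lies in [V n.+1], as does
   [H], so [x n] would lie there too. *)
have [n [m [nm hnm]]] := compact_pigeonhole cV0 xV0 n1.
have [Rn _ nVn] := xP n; have [Rm Vm _] := xP m.
have /hnm [_ h] : R ((x n)^-1 * x m) by apply: sgpM => //; exact: sgpV.
case: nVn; have sV : sgp (V n.+1) by case: (coV n.+1).
apply: (sgpVE sV); apply: (sgpMr sV (Vle _ _ nm _ Vm)); exact: h.
Qed.

(** [U] has finitely many atoms, so the chains of [atom_sequence] can be intersected term by term.
    The resulting chain has an intersection disjoint from every atom, hence trivial. *)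
Lemma first_countable_ld : first_countable G.
Proof.
have [U [sU nU cU _]] := ld_base HG filterT.
have coU : co U by [].
have iT : invreg U [set: G] by split; [exact: reg_T|move=> u _ x].
have [l [lA cov]] := atoms_exist HG coU (sublat_invreg HG coU) iT.
have /choice[V VP] A : exists V : nat -> set G, A \in l ->
    [/\ forall n, co (V n) /\ (forall u, U u -> nz (V n) u),
      forall n m, (n <= m)%N -> V m `<=` V n & A `&` \bigcap_n V n `<=` [set 1]].
  have [Al|nAl] := boolP (A \in l); last by exists (fun=> setT).
  by have [aA _] := lA _ Al; have [V hV] := atom_sequence coU aA; exists V.
pose W n := U `&` \bigcap_(A in [set` l]) V A n.
have sW n : sgp (W n).
  by apply: sgpI => //; apply: sgp_bigcap => A /VP[/(_ n) [[]]].
have nW n : nbhs (1 : G) (W n).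
  by apply: filterI => //; apply: filter_seq => A /VP[/(_ n) [[]]].
have Wle n m : (n <= m)%N -> W m `<=` W n.
  by move=> nm x [Ux hx]; split=> // A Al; have [_ le _] := VP _ Al; exact: le nm _ (hx A Al).
pose H := \bigcap_n W n.
have nzH u : U u -> nz H u.
  move=> Uu; apply: nz_bigcap => n _; apply: nzI; split; first exact: nz_sgp.
  by apply: nz_bigcap => A /VP[/(_ n) [_ nV] _ _]; exact: nV.
have lH : lnorm H.
  split; [by apply: sgp_bigcap|by apply: closed_bigI => n _; exact: sgp_open_closed|].
  by apply: filterS nU => u; exact: nzH.
have H1 x : H x -> x = 1.
  move=> Hx; apply: (cov _ (reg_pp HG lH)); last by split=> //; exact: sub_perp_perp.
  move=> A Al; have [[[rA _] _ _] _] := lA _ Al; have lA' := reg_lnorm rA.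
  apply: (sub_dj HG lA'); apply: pp_sub; last exact: (reg_perp HG).
  apply: (dj_perp HG lA' lH) => y [Ay Hy]; have [_ _] := VP _ Al; apply; split=> // n _.
  by have [_ h] := Hy n Logic.I; exact: h.
(* If every [W n] left [A], points chosen outside [A] would cluster, by compactness of [U], at a
   point of the trivial intersection [H], that is at 1, which is interior to [A]. *)
have base A : nbhs (1 : G) A -> exists n, W n `<=` A.
  move=> nA; apply: contrapT => nex.
  have /choice[y yP] n : exists x, W n x /\ ~ A x.
    apply: contrapT => h; apply: nex; exists n => x Wx; apply: contrapT => nAx.
    by apply: h; exists x.
  have [|z [Uz clz]] := cU (y @ \oo) _; first by exists 0%N => // n _; case: (yP n) => -[].
  have tail n : (y @ \oo) [set x | W n x /\ ~ A x].
    by exists n => // k /= nk; have [h1 h2] := yP k; split=> //; exact: Wle nk _ h1.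
  have Hz : H z.
    move=> n _; apply: (sgp_open_closed (sW n) (nW n)) => N Nz.
    by have [x [[Wx _] Nx]] := clz _ _ (tail n) Nz; exists x.
  have [x [[_ nAx] Ax]] : ([set x | W 0%N x /\ ~ A x] `&` A) !=set0.
    by apply: clz (tail 0%N) _; rewrite (H1 _ Hz).
  by [].
move=> x; exists [set [set z | W n (x^-1 * z)] | n in [set: nat]]; split.
- by apply: (sub_countable (card_image_le _ _)); exact: countableP.
- move=> _ [n _ <-]; apply: nbhs_ml; rewrite mulVg; exact: nW.
- move=> A Ax; have [|n WA] := base [set y | A (x * y)].
    by apply: nbhs_ml; rewrite mulg1.
  exists [set z | W n (x^-1 * z)]; first by exists n.
  by move=> z /WA; rewrite /= mulVKg.
Qed.

End FirstCountable.

Theorem theorem1p11 (G : topGroupType) (tdlcG : tdlc G) (LDG : property_LD G)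
    (QZG : quasi_centre [set: G] = [set 1]) :
  first_countable G /\
  exists (n : nat) (M : 'I_n -> set G) (P : set G),
    [/\ open_subgroup [set: G] P,
        internal_product M P,
        (* (i) *)
        forall i, closed (M i) /\
          forall K : set G, closed_locally_normal [set: G] K ->
            M i `<=` K -> characteristic K (M i),
        (* (ii) and (iii) *)
        forall i,
          [/\ exists J : topGroupType,
                [/\ profinite J, just_infinite [set: J],
                    locally_isomorphic (M i) [set: J]
                  & forall K : set G, closed_locally_normal [set: G] K ->
                      locally_similar K [set: J] -> K `<=` M i],
              locally_monomial (M i)
            & forall J : set G, closed_locally_normal [set: G] J ->
                compact J -> just_infinite J -> locally_equivalent J (M i) ->
                J `<=` M i /\
                forall N : set G, normal_subgroup (M i) N ->
                  closed_in (M i) N -> N <> [set 1] -> open_in (M i) N]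
      & (* (iv) *)
        equals_germ_group [set: G] ->
          P = [set: G] /\
          forall i, equals_germ_group (M i) /\
            exists U : set G,
              compact_open_subgroup (M i) U /\ just_infinite U].
Proof.
have HG := tdlc_ldgroup tdlcG LDG QZG.
split; first exact: first_countable_ld.
have [n [M [aM dM nM _]]] := cl_family HG.
have cM i : cl (M i) by case: (aM i).
have lM i : lnorm (M i) by have [[]] := cM i.
have [P [sP nP iP PE]] := internal_product_cl HG cM dM nM.
exists n, M, P; split=> //.
- exact/openT_sgp.
- move=> i; split; first by case: (lM i).
  by move=> K /lnormTP lK; exact: cl_characteristic.
- move=> i; have [sM _ _] := lM i; split.
  + have [J [O [f [pJ jiJ sO [OM nO] hf]]]] := exists_just_infinite HG (aM i).
    exists J; split=> //; first exact: lemb_locally_isomorphic hf.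
    by move=> K /lnormTP lK sim; exact: (similar_sub HG (cM i) sO OM nO hf lK sim).
  + exact: locally_monomial_cl.
  + by move=> J /lnormTP lJ _ jiJ; exact: just_infinite_clause.
- move=> germG; split.
    apply/seteqP; split=> // g _; apply/PE; exact: germ_product.
  move=> i; split; first exact: germ_factor.
  have [J [O [f [[_ cJ _] jiJ sO [OM nO] hf]]]] := exists_just_infinite HG (aM i).
  have [_ M1 _] := aM i.
  exact: (just_infinite_envelope HG germG (cM i) M1 cJ jiJ sO OM nO hf).
Qed.
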